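(* Let $b\ge 2$ be an integer and $0<\alpha<1$. Then a prevalent function $g\in\mathrm{Lip}(\mathbb{S}^1)$ satisfies $$\mathcal{L}^1\Big(\big\{y\in W_g^{\alpha,b}(\mathbb{S}^1): \dim_H\big((W_g^{\alpha,b})^{-1}(\{y\})\big)=1-\alpha\big\}\Big)>0.$$
   Context: $\mathbb{S}^1$ is identified with $\mathbb{R}/\mathbb{Z}$, and functions on $\mathbb{S}^1$ are $1$-periodic functions on $\mathbb{R}$. $\mathrm{Lip}(\mathbb{S}^1)$ is the Banach space of Lipschitz functions $g\colon\mathbb{S}^1\to\mathbb{R}$ with norm $\|g\|_{\mathrm{Lip}}=\sup_x|g(x)|+\sup_{x\ne y}\frac{|g(x)-g(y)|}{|x-y|}$. For an integer $b\ge2$, $0<\alpha\le 1$ and $g\in\mathrm{Lip}(\mathbb{S}^1)$, the Weierstrass function is $W_g^{\alpha,b}(x)=\sum_{k=0}^\infty b^{-\alpha k}g(b^kx)$. A subset $A$ of a Banach space $X$ is shy if there exist a Borel measure $\mu$ on $X$ and a Borel set $B\supset A$ such that $0<\mu(K)<\infty$ for some compact $K\subset X$ and $\mu(x+B)=0$ for all $x\in X$; a set is prevalent if its complement is shy. $\mathcal{L}^1$ is Lebesgue measure and $\dim_H$ Hausdorff dimension. *)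

(* Defs.v *)
From HB Require Import structures.
From mathcomp Require Import all_boot all_order all_algebra.
From mathcomp Require Import all_classical all_reals all_analysis.
Set Implicit Arguments. Unset Strict Implicit. Unset Printing Implicit Defensive.
Import Order.TTheory GRing.Theory Num.Theory.
Import numFieldNormedType.Exports.
Local Open Scope classical_set_scope.
Local Open Scope ring_scope.

Section Defs.
Variable R : realType.

(* Functions on S^1 = R/Z are 1-periodic functions R -> R. *)
Record lipS1 := LipS1 {
  lipfun :> R -> R;
  lipfun_periodic : forall x, lipfun (x + 1) = lipfun x;
  lipfun_lipschitz : exists L : R, forall x y, `|lipfun x - lipfun y| <= L * `|x - y| }.

HB.instance Definition _ := gen_eqMixin lipS1.
HB.instance Definition _ := gen_choiceMixin lipS1.

Program Definition lip_zero : lipS1 := @LipS1 (fun _ => 0) _ _.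
Next Obligation. by []. Qed.
Next Obligation. by exists 0 => x y; rewrite subrr normr0 mul0r. Qed.

HB.instance Definition _ := isPointed.Build lipS1 lip_zero.

Definition lip_norm (g : R -> R) : R :=
  sup [set `|g x| | x in [set: R]] +
  sup [set r | exists x y : R, x != y /\ r = `|g x - g y| / `|x - y|].

Definition lip_open (A : set lipS1) : Prop :=
  forall g, A g -> exists2 e : R, 0 < e &
    forall h : lipS1, lip_norm (fun t => h t - g t) < e -> A h.

Definition lip_compact (K : set lipS1) : Prop :=
  forall (I : Type) (U : I -> set lipS1), (forall i, lip_open (U i)) ->
    K `<=` \bigcup_i U i ->
    exists2 D : set I, finite_set D & K `<=` \bigcup_(i in D) U i.

Definition lipBorel := g_sigma_algebraType lip_open.

Definition lip_translate (x : lipS1) (B : set lipS1) : set lipS1 :=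
  [set h | exists2 b, B b & forall t, h t = x t + b t].

Definition shy (A : set lipS1) : Prop :=
  exists (mu : {measure set lipBorel -> \bar R}) (B : set lipBorel),
    [/\ measurable B, A `<=` B,
        (exists K : set lipS1, lip_compact K /\ (0 < mu K < +oo)%E) &
        forall x : lipS1, mu (lip_translate x B) = 0%E].

Definition prevalent (A : set lipS1) : Prop := shy (~` A).

Definition weierstrass (alpha : R) (b : nat) (g : R -> R) (x : R) : R :=
  limn (series (fun k : nat => b%:R `^ (- (alpha * k%:R)) * g (b%:R ^+ k * x))).

Definition diam (U : set R) : \bar R :=
  ereal_sup [set (`|x - y|)%:E | x in U & y in U].

Definition hcontent (s : R) (U : set R) : R :=
  if pselect (U = set0) is left _ then 0 else (fine (diam U)) `^ s.

Definition hausdorff_content (s delta : R) (E : set R) : \bar R :=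
  ereal_inf [set (\sum_(0 <= i <oo) (hcontent s (F i))%:E)%E | F in
    [set F : nat -> set R | E `<=` \bigcup_i F i /\
                            forall i, (diam (F i) <= delta%:E)%E]].

Definition hausdorff_measure (s : R) (E : set R) : \bar R :=
  ereal_sup [set hausdorff_content s delta E | delta in [set d : R | 0 < d]].

Definition hausdorff_dim (E : set R) : \bar R :=
  ereal_inf [set s%:E | s in [set s : R | 0 <= s /\ hausdorff_measure s E = 0%E]].

End Defs.
Arguments lip_zero {R}.

(* Main.v *)
(** The upper bound for the dimension of almost every level is the Hölder
    exponent [alpha] and a first moment computation: a level [y] meets on average
    at most [C b ^ ((1 - alpha) j)] of the [b]-adic intervals of length [b ^ - j].

    For the lower bound the probe measure is the law of a random series
    [sum_i eps_i h_i] of tent functions with independent fair bits. Points [x] of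
    the circle are coded by [b]-adic expansions cut into blocks of length about
    [m ^ 2], where a sparse set of forced digits makes the [m]-th tent vanish at
    all but one of the relevant shifts of [x]. If the expansions of [x] and [x']
    first differ in block [m], the [m]-th tent thus separates the values of the
    Weierstrass functions by nearly [b ^ (- alpha N)], [N] being the start of the
    block. Each tent appears with the weights [2 ^ - j], whose bits sweep a dyadic
    grid, so for every fixed translate [g] the probability that the two values are
    within [r] is at most about [r b ^ (alpha N)]. The expected energy of pairs of
    coded points with nearly equal values is therefore bounded, so almost surely
    the energy stays bounded along infinitely many scales. A second moment and mass
    distribution argument then gives a set of levels of positive measure on which
    the level sets have positive [s]-dimensional content for all [s < 1 - alpha]. *)

Require Import Defs.
From HB Require Import structures.
From mathcomp Require Import all_boot all_order all_algebra.
From mathcomp Require Import all_classical all_reals all_analysis.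
From mathcomp Require Import measurable_realfun.
From mathcomp Require Import zify ring lra.
Import Order.TTheory GRing.Theory Num.Theory.
Import numFieldNormedType.Exports.
Local Open Scope classical_set_scope.
Local Open Scope ring_scope.

Set Implicit Arguments.
Unset Strict Implicit.
Unset Printing Implicit Defensive.

(** The exponent [1 - alpha] tolerates no loss exponential in the position [N m] of a block. A block
    of length [cell m ^ 2] has at most [3 * cell m] forced digits, so forcing costs a factor
    [b ^ O(m ^ 2)] in counting words, and resolving a whole block costs [b ^ (cell m ^ 2)] in the
    separation, while [N m] is cubic in [m].

    A marker cannot be made to vanish at every later shift: far beyond block [m] the forced digits
    are too sparse to exclude long runs of zeros. It is controlled up to block [m + k0 - 1]; from
    there on the factor [b ^ (- alpha k)] makes the trivial bound smaller than the separation, which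
    is why cells start at a large [k0].

    The translate is arbitrary, so all smallness of probabilities must come from the bits of the
    probe. The exceptional functions are enclosed in the Borel set where the smoothed energies tend
    to infinity, so the dimension condition itself never has to be shown Borel. *)

Section TailBound.
Context {R : realType}.
Implicit Types u T : nat -> R.

Lemma series_sub_le u T n m : (n <= m)%N ->
  (forall k, `|u k| <= T k - T k.+1) ->
  `|series u m - series u n| <= T n - T m.
Proof.
move=> nm uT; rewrite sub_series nm.
apply: (le_trans (ler_norm_sum _ _ _)).
have -> : T n - T m = \sum_(n <= k < m) (T k - T k.+1).
  rewrite (@telescope_sumr_eq _ n m (fun k => - T k)) //.
    by rewrite addrC opprK.
  by move=> k _; rewrite opprK addrC.
by apply: ler_sum_nat => k _; exact: uT.
Qed.

Lemma series_tail_cvg u T : (forall k, 0 <= T k) ->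
  (forall k, `|u k| <= T k - T k.+1) -> cvgn (series u).
Proof.
move=> T0 uT; apply: normed_cvg.
apply: nondecreasing_is_cvgn.
  by apply: nondecreasing_series => k _ _ /=.
exists (T 0%N) => _ [n _ <-].
have uT' k : `| `|u k| | <= T k - T k.+1 by rewrite normr_id.
have /= := @series_sub_le (fun k => `|u k|) T 0 n (leq0n _) uT'.
rewrite [series _ 0]/series /= big_geq// subr0 => h.
by apply: (le_trans (ler_norm _)); apply: (le_trans h); rewrite gerBl.
Qed.

(** Dominating the terms by increments of [T] makes the tail bound a telescoping sum; it serves the
    geometric tails [wtail] and the diagonal weights [dtailw] alike. *)
Lemma series_tail_bound u T n : (forall k, 0 <= T k) ->
  (forall k, `|u k| <= T k - T k.+1) ->
  `|limn (series u) - series u n| <= T n.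
Proof.
move=> T0 uT; have cu := series_tail_cvg T0 uT.
have c1 : (fun m => `|series u m - series u n|) @ \oo -->
   `|limn (series u) - series u n|.
  by apply: cvg_norm; apply: cvgB => //; exact: cvg_cst.
rewrite -(cvg_lim _ c1)//; apply: limr_le; first by apply/cvg_ex; eexists; exact: c1.
near=> m.
apply: (le_trans (@series_sub_le u T n m _ uT)); last by rewrite gerBl.
by near: m; exists n.
Unshelve. all: by end_near.
Qed.

End TailBound.

(** * Convergence, linearity and Hölder regularity of Weierstrass functions *)

Section Weierstrass.
Context (R : realType) (b : nat) (alpha : R).
Hypotheses (b2 : (2 <= b)%N) (a01 : 0 < alpha < 1).

Definition wratio : R := b%:R `^ (- alpha).
Notation q := wratio.

Lemma b_gt1 : 1 < b%:R :> R. Proof. by rewrite ltr1n. Qed.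
Lemma b_gt0 : 0 < b%:R :> R. Proof. exact: lt_trans b_gt1. Qed.

Lemma wratio_gt0 : 0 < q. Proof. by rewrite powR_gt0// b_gt0. Qed.

Lemma powR_b_ltP (x y : R) : (b%:R `^ x < b%:R `^ y) = (x < y).
Proof. by rewrite /powR gt_eqF ?b_gt0// ltr_expR ltr_pM2r// ln_gt0// b_gt1. Qed.

Lemma wratio_lt1 : q < 1.
Proof.
rewrite /q -[ltRHS](powRr0 b%:R) powR_b_ltP oppr_lt0.
by case/andP: a01.
Qed.

Lemma wratio_expE n : q ^+ n = b%:R `^ (- (alpha * n%:R)).
Proof. by rewrite -powR_mulrn ?powR_ge0// -powRrM mulNr. Qed.

(** As [q * b = b ^ (1 - alpha)], the Lipschitz bounds of the low frequencies grow geometrically and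
    are dominated by the last one. *)
Lemma wratio_b_gt1 : 1 < q * b%:R.
Proof.
rewrite /q -{2}[b%:R](powRr1 (ltW b_gt0)) -powRD; last by rewrite (gt_eqF b_gt0) implybT.
rewrite -[ltLHS](powRr0 b%:R) powR_b_ltP; case/andP: a01; lra.
Qed.

Lemma onem_wratio_gt0 : 0 < 1 - q.
Proof. by rewrite subr_gt0 wratio_lt1. Qed.

Definition wterm (g : R -> R) x := fun k : nat => q ^+ k * g (b%:R ^+ k * x).

Lemma weierstrassE g x : weierstrass alpha b g x = limn (series (wterm g x)).
Proof.
rewrite /weierstrass; congr (limn (series _)); apply/funext => k.
by rewrite /wterm wratio_expE.
Qed.

Definition wtail (M : R) k := M * q ^+ k / (1 - q).

Lemma wtail_ge0 (M : R) k : 0 <= M -> 0 <= wtail M k.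
Proof.
move=> M0; by rewrite /wtail divr_ge0 ?mulr_ge0 ?exprn_ge0 ?(ltW wratio_gt0) ?(ltW onem_wratio_gt0).
Qed.

Lemma wtailB M k : wtail M k - wtail M k.+1 = M * q ^+ k.
Proof.
rewrite /wtail exprS; have := onem_wratio_gt0; rewrite lt0r => /andP[h _].
by field.
Qed.

Lemma sup_ge0 (g : R -> R) (M : R) : (forall t, `|g t| <= M) -> 0 <= M.
Proof. by move=> /(_ 0); apply: le_trans. Qed.

Lemma wterm_le g (M : R) x : (forall t, `|g t| <= M) ->
  forall k, `|wterm g x k| <= wtail M k - wtail M k.+1.
Proof.
move=> gM k; have q0 := ltW wratio_gt0.
rewrite wtailB /wterm normrM ger0_norm ?exprn_ge0//.
by rewrite mulrC ler_wpM2r// exprn_ge0.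
Qed.

Lemma weierstrass_cvg g (M : R) x : (forall t, `|g t| <= M) ->
  series (wterm g x) @ \oo --> weierstrass alpha b g x.
Proof.
move=> gM; rewrite weierstrassE; apply: (@series_tail_cvg _ _ (wtail M)).
  by move=> k; apply/wtail_ge0/(sup_ge0 gM).
exact: wterm_le.
Qed.

Lemma weierstrass_tail g (M : R) x n : (forall t, `|g t| <= M) ->
  `|weierstrass alpha b g x - series (wterm g x) n| <= wtail M n.
Proof.
move=> gM; rewrite weierstrassE; apply: (@series_tail_bound _ _ (wtail M)).
  by move=> k; apply/wtail_ge0/(sup_ge0 gM).
exact: wterm_le.
Qed.

Lemma weierstrass_le g (M : R) x : (forall t, `|g t| <= M) ->
  `|weierstrass alpha b g x| <= M / (1 - q).
Proof.
move=> gM; have := @weierstrass_tail g M x 0 gM.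
by rewrite /series /= big_geq// subr0 /wtail expr0 mulr1.
Qed.

Lemma weierstrassD g h (M N : R) x : (forall t, `|g t| <= M) -> (forall t, `|h t| <= N) ->
  weierstrass alpha b (fun t => g t + h t) x =
  weierstrass alpha b g x + weierstrass alpha b h x.
Proof.
move=> gM hN; rewrite weierstrassE; apply: cvg_lim => //.
rewrite (_ : series _ = series (wterm g x) \+ series (wterm h x)).
  exact: cvgD (weierstrass_cvg gM) (weierstrass_cvg hN).
by apply/funext => n; rewrite /series /= -big_split; apply: eq_bigr => i _; rewrite /wterm mulrDr.
Qed.

Lemma weierstrassZ g (c M : R) x : (forall t, `|g t| <= M) ->
  weierstrass alpha b (fun t => c * g t) x = c * weierstrass alpha b g x.
Proof.
move=> gM; rewrite weierstrassE; apply: cvg_lim => //.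
rewrite (_ : series _ = fun n => c * series (wterm g x) n).
  exact: cvgMl_tmp (weierstrass_cvg gM).
apply/funext => n; rewrite /series /= mulr_sumr; apply: eq_bigr => i _.
by rewrite /wterm mulrCA.
Qed.

Lemma weierstrassB g h (M N : R) x : (forall t, `|g t| <= M) -> (forall t, `|h t| <= N) ->
  weierstrass alpha b (fun t => g t - h t) x =
  weierstrass alpha b g x - weierstrass alpha b h x.
Proof.
move=> gM hN; rewrite -[in RHS]mulN1r -(weierstrassZ (-1) x hN).
rewrite -(@weierstrassD _ _ M N)//; last by move=> t; rewrite mulN1r normrN.
by congr (weierstrass _ _ _ _); apply/funext => t; rewrite mulN1r.
Qed.

Lemma weierstrass_sum (I : Type) (s : seq I) (g : I -> R -> R) (M : I -> R) x :
  (forall i t, `|g i t| <= M i) ->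
  weierstrass alpha b (fun t => \sum_(i <- s) g i t) x =
  \sum_(i <- s) weierstrass alpha b (g i) x.
Proof.
move=> gM; elim: s => [|i s ih].
  rewrite big_nil.
  have := @weierstrass_le (fun t => \sum_(i <- [::]) g i t) 0 x.
  rewrite mul0r normr_le0 => h; apply/eqP/h => t.
  by rewrite big_nil normr0.
rewrite big_cons -ih -(@weierstrassD _ _ (M i) (\sum_(i <- s) M i))//.
  by congr (weierstrass _ _ _ _); apply/funext => t; rewrite big_cons.
by move=> t; apply: (le_trans (ler_norm_sum _ _ _)); apply: ler_sum.
Qed.

(* Split at the scale [b ^ - j] of [x - y]: Lipschitz bound below, sup bound above. *)
Lemma weierstrass_holder g (M L x y : R) j : (forall t, `|g t| <= M) ->
  (forall s t, `|g s - g t| <= L * `|s - t|) ->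
  `|x - y| <= b%:R ^- j ->
  `|weierstrass alpha b g x - weierstrass alpha b g y| <=
    (L / (q * b%:R - 1) + 2 * M / (1 - q)) * q ^+ j.
Proof.
move=> gM gL xy.
have b0 := b_gt0; have q0 := ltW wratio_gt0.
have L0 : 0 <= L by have := gL 0 1; rewrite sub0r normrN1 mulr1; exact: le_trans.
have qb1 := wratio_b_gt1.
have tx := @weierstrass_tail g M x j gM; have ty := @weierstrass_tail g M y j gM.
have hs : `|series (wterm g x) j - series (wterm g y) j| <= L / (q * b%:R - 1) * q ^+ j.
  rewrite /series /= -sumrB; apply: (le_trans (ler_norm_sum _ _ _)).
  apply: (@le_trans _ _ (\sum_(0 <= k < j) L * b%:R ^- j * (q * b%:R) ^+ k)).
    apply: ler_sum => k _; rewrite /wterm -mulrBr normrM ger0_norm ?exprn_ge0//.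
    rewrite exprMn [leRHS]mulrCA ler_wpM2l ?exprn_ge0//.
    apply: (le_trans (gL _ _)); rewrite -mulrBr normrM ger0_norm ?exprn_ge0 ?(ltW b0)//.
    by rewrite -mulrA ler_wpM2l// [leRHS]mulrC ler_wpM2l// exprn_ge0// ltW.
  rewrite -mulr_sumr.
  have -> : \sum_(0 <= k < j) (q * b%:R) ^+ k = ((q * b%:R) ^+ j - 1) / (q * b%:R - 1).
    rewrite subrX1 mulrAC divff ?mul1r ?big_mkord//.
    by rewrite gt_eqF// subr_gt0.
  have D0 : 0 < q * b%:R - 1 by rewrite subr_gt0.
  have bj0 : 0 < b%:R ^+ j :> R by rewrite exprn_gt0.
  have -> : L / b%:R ^+ j * (((q * b%:R) ^+ j - 1) / (q * b%:R - 1)) =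
    L / (q * b%:R - 1) * (q ^+ j - b%:R ^- j).
    by rewrite exprMn; field; rewrite !lt0r_neq0.
  by rewrite ler_wpM2l ?divr_ge0 ?(ltW D0)// gerBl invr_ge0 ltW.
rewrite mulrDl.
have -> : weierstrass alpha b g x - weierstrass alpha b g y =
  (series (wterm g x) j - series (wterm g y) j) +
  ((weierstrass alpha b g x - series (wterm g x) j) -
  (weierstrass alpha b g y - series (wterm g y) j)) by ring.
apply: (le_trans (ler_normD _ _)); apply: lerD => //.
apply: (le_trans (ler_normB _ _)); apply: (le_trans (lerD tx ty)).
by rewrite /wtail le_eqVlt; apply/orP; left; apply/eqP; ring.
Qed.

End Weierstrass.

(** * Levels of Hölder functions *)

Section StepFunctions.
Context {R : realType} (I : finType).
Variables (w : I -> R) (A : I -> set R).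
Hypotheses (w0 : forall i, 0 <= w i) (mA : forall i, measurable (A i)).
Local Notation leb := (@lebesgue_measure R).

Definition step (y : R) : R := \sum_i w i * \1_(A i) y.

Lemma step_ge0 y : 0 <= step y.
Proof. by apply: sumr_ge0 => i _; rewrite mulr_ge0. Qed.

Lemma measurable_step : measurable_fun [set: R] step.
Proof.
by apply: measurable_sum => i; apply: measurable_funM => //; exact: measurable_indic.
Qed.

Lemma integral_step : (\int[leb]_y (step y)%:E = \sum_i (w i)%:E * leb (A i))%E.
Proof.
have mI i : measurable_fun [set: R] (\1_(A i) : R -> R) by exact: measurable_indic.
under eq_integral do rewrite /step -sumEFin.
rewrite ge0_integral_sum//; last 2 first.
- by move=> i; apply/measurable_EFinP; apply: measurable_funM => //; exact: mI.
- by move=> i y _; rewrite lee_fin mulr_ge0.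
apply: eq_bigr => i _; under eq_integral do rewrite EFinM.
rewrite ge0_integralZl_EFin//; last by apply/measurable_EFinP; exact: mI.
congr (_ * _)%E; rewrite integral_indic//; last exact: mA.
by congr (leb _); exact: setIT.
Qed.

Lemma step_markov (t : R) : 0 < t ->
  (t%:E * leb [set y | (t <= step y)%R] <= \sum_i (w i)%:E * leb (A i))%E.
Proof.
move=> t0; rewrite -integral_step.
set E := [set y | _].
have mE : measurable E.
  rewrite /E -[X in measurable X]setTI.
  exact: (measurable_fun_le measurableT (measurable_cst t) measurable_step).
rewrite -[X in leb X](setIT E) -(@integral_indic _ _ _ _ setT)//.
have mi : measurable_fun setT (EFin \o (\1_E : R -> R)).
  by apply/measurable_EFinP; exact: measurable_indic.
rewrite -ge0_integralZl_EFin ?(ltW t0)//.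
apply: ge0_le_integral => //.
- by move=> y _; rewrite mule_ge0// lee_fin// ltW.
- exact: measurable_funeM.
- by apply/measurable_EFinP; exact: measurable_step.
- move=> y _; rewrite -EFinM lee_fin indicE.
  by case: (boolP (y \in E)) => [|_]; rewrite ?inE ?mulr1 ?mulr0 ?step_ge0.
Qed.

End StepFunctions.

Section NullSets.
Context {R : realType}.
Local Notation leb := (@lebesgue_measure R).

(** Argued through the outer measure, since the sets of levels compared later are not shown to be
    measurable. *)
Lemma le_leb (A B : set R) : A `<=` B -> (leb A <= leb B)%E.
Proof. move=> AB; apply: (@le_outer_measure R _ (mu_ext (wlength idfun))); exact: AB. Qed.

Lemma leb_ge0 (A : set R) : (0 <= leb A)%E.
Proof. exact: outer_measure_ge0. Qed.

Lemma leb_bigcup0 (F : nat -> set R) : (forall n, leb (F n) = 0%E) ->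
  leb (\bigcup_n F n) = 0%E.
Proof.
move=> F0; apply/eqP; rewrite eq_le leb_ge0 andbT.
rewrite -[\bigcup_n F n]setTI.
apply: (le_trans (outer_measure_bigcup_lim (mu_ext (wlength idfun)) F setT)).
rewrite eseries0// => i _ _; rewrite setTI; exact: F0.
Qed.

Lemma leb_eq0 (A : set R) : (forall e : R, 0 < e -> (leb A <= e%:E)%E) -> leb A = 0%E.
Proof.
move=> h; apply/eqP; rewrite eq_le leb_ge0 andbT.
by apply/lee_addgt0Pr => e e0; rewrite add0e; exact: h.
Qed.

End NullSets.

Section HausdorffUpper.
Context {R : realType}.
Implicit Types (E : set R) (s d : R).

Lemma hcontent_ge0 s (U : set R) : 0 <= hcontent s U.
Proof. by rewrite /hcontent; case: pselect => // _; exact: powR_ge0. Qed.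

Lemma diam_le (U : set R) d : 0 <= d -> (forall x y, U x -> U y -> `|x - y| <= d) ->
  (diam U <= d%:E)%E.
Proof.
by move=> d0 h; apply: ge_ereal_sup => _ [x Ux [y Uy <-]]; rewrite lee_fin; exact: h.
Qed.

Lemma diam_ge (U : set R) x y : U x -> U y -> (`|x - y|%:E <= diam U)%E.
Proof. by move=> Ux Uy; apply: ereal_sup_ubound; exists x => //; exists y. Qed.

Lemma hcontent_le s d (U : set R) : 0 <= s -> 0 <= d ->
  (forall x y, U x -> U y -> `|x - y| <= d) -> hcontent s U <= d `^ s.
Proof.
move=> s0 d0 h; rewrite /hcontent; case: pselect => [_|U0]; first exact: powR_ge0.
have [x Ux] : U !=set0 by apply/set0P/eqP.
have dU := diam_le d0 h.
have dU0 : (0 <= diam U)%E by have := diam_ge Ux Ux; rewrite subrr normr0.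
have fU : diam U \is a fin_num.
  by rewrite ge0_fin_numE//; exact: le_lt_trans dU (ltry _).
by apply: ge0_ler_powR; rewrite ?nnegrE// ?fine_ge0// -lee_fin fineK.
Qed.

Lemma hausdorff_content_finite s d E (N : nat) (F : nat -> set R) (c : R) :
  0 <= d -> (forall i, (N <= i)%N -> F i = set0) ->
  E `<=` \bigcup_i F i ->
  (forall i x y, F i x -> F i y -> `|x - y| <= d) ->
  \sum_(i < N) hcontent s (F i) <= c -> (hausdorff_content s d E <= c%:E)%E.
Proof.
move=> d0 F0 cov dF Fc; apply: ge_ereal_inf.
exists (\sum_(0 <= i <oo) (hcontent s (F i))%:E)%E.
  by exists F => //; split => // i; apply: diam_le => //; exact: dF.
rewrite (nneseries_split 0 N)//; last by move=> k _; rewrite lee_fin hcontent_ge0.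
rewrite add0n eseries0 ?adde0; last first.
  by move=> i Ni _; rewrite F0// /hcontent; case: pselect.
by rewrite sumEFin lee_fin big_mkord.
Qed.

Lemma hausdorff_measure_eq0 s E :
  (forall d e : R, 0 < d -> 0 < e -> (hausdorff_content s d E <= e%:E)%E) ->
  hausdorff_measure s E = 0%E.
Proof.
move=> h.
have c0 d : (0 <= hausdorff_content s d E)%E.
  apply: le_ereal_inf_tmp => _ [F _ <-].
  by apply: nneseries_ge0 => i _ _; rewrite lee_fin hcontent_ge0.
apply/eqP; rewrite eq_le; apply/andP; split.
  apply: ge_ereal_sup => _ [d d0 <-].
  by apply/lee_addgt0Pr => e e0; rewrite add0e; exact: h.
by apply: (le_trans (c0 1)); apply: ereal_sup_ubound; exists 1 => //=.
Qed.

End HausdorffUpper.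

Section PowerDecay.
Context {R : realType}.

Lemma bernoulli_ge (x : R) n : 0 <= x -> 1 + n%:R * x <= (1 + x) ^+ n.
Proof.
move=> x0; elim: n => [|n ih]; first by rewrite mul0r addr0.
rewrite exprS -natr1.
have h : (1 + x) * (1 + n%:R * x) <= (1 + x) * (1 + x) ^+ n by rewrite ler_pM2l// ltr_pwDl.
have n0 : 0 <= n%:R :> R by [].
apply: le_trans h; nra.
Qed.

Lemma expr_lt_eps (rho e : R) : 0 <= rho < 1 -> 0 < e ->
  exists J : nat, forall j, (J <= j)%N -> rho ^+ j < e.
Proof.
move=> /andP[r0 r1] e0.
have : (fun n => rho ^+ n) @ \oo --> 0 by apply: cvg_expr; rewrite ger0_norm.
move/cvgrPdist_lt => /(_ e e0) [J _ h]; exists J => j Jj.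
by have := h j Jj; rewrite /= sub0r normrN ger0_norm// exprn_ge0.
Qed.

Lemma nat_expr_lt_eps (rho e : R) : 0 < rho < 1 -> 0 < e ->
  exists J : nat, forall j, (J <= j)%N -> j.+1%:R * rho ^+ j < e.
Proof.
move=> /andP[r0 r1] e0.
pose s := Num.sqrt rho.
have s0 : 0 < s by rewrite sqrtr_gt0.
have s1 : s < 1 by rewrite -[ltRHS]sqrtr1 ltr_sqrt.
have ss : rho = s * s by rewrite -expr2 sqr_sqrtr// ltW.
pose x := s^-1 - 1.
have x0 : 0 < x by rewrite subr_gt0 invf_gt1.
(* Chosen so that [j + 1 <= K * (1 + j x)], while Bernoulli gives [(1 + j x) s ^ j <= 1] for
   [s^-1 = 1 + x]. *)
pose K := 1 + x^-1.
have K0 : 0 < K by rewrite addr_gt0// invr_gt0.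
have [J hJ] := @expr_lt_eps s (e / K) ltac:(by rewrite (ltW s0) s1) (divr_gt0 e0 K0).
exists J => j /hJ; rewrite ltr_pdivlMr// => h.
apply: le_lt_trans h.
have := @bernoulli_ge x j (ltW x0); rewrite /x subrKC exprVn => hb.
have sj : 0 < s ^+ j by rewrite exprn_gt0.
rewrite ss exprMn mulrA -/(_ * K) mulrC ler_pM2l//.
have hb' : (1 + j%:R * x) * s ^+ j <= 1.
  by rewrite -[leRHS](mulVf (lt0r_neq0 sj)) ler_pM2r.
apply: (@le_trans _ _ (K * (1 + j%:R * x) * s ^+ j)); last first.
  by rewrite -mulrA -[leRHS]mulr1 ler_pM2l.
rewrite ler_pM2r// -natr1.
have -> : K * (1 + j%:R * x) = 1 + j%:R * x + x^-1 + j%:R.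
  by rewrite /K; field; rewrite lt0r_neq0.
have : 0 <= j%:R * x by rewrite mulr_ge0// ltW.
have : 0 < x^-1 by rewrite invr_gt0.
lra.
Qed.

End PowerDecay.

Section LevelSetsUpper.
Context (R : realType) (b : nat) (alpha : R).
Hypotheses (b2 : (2 <= b)%N) (a01 : 0 < alpha < 1).
Local Notation q := (wratio b alpha).
Local Notation leb := (@lebesgue_measure R).
Local Notation bR := (b%:R : R).

Variables (f : R -> R) (C : R).
Hypothesis C0 : 0 < C.
Hypothesis fC : forall x y j, `|x - y| <= bR ^- j -> `|f x - f y| <= C * q ^+ j.

Let P j := (bR * q) ^+ j.
(* [cnt j y] bounds the number of [b]-adic intervals of level [j] meeting the
   level set of [y]; its mean is of order [P j = b ^ ((1 - alpha) j)]. *)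
Let Ival (j : nat) (i : 'I_(b ^ j)) : set R :=
  `[f (i%:R * bR ^- j) - C * q ^+ j, f (i%:R * bR ^- j) + C * q ^+ j]%classic.
Let cnt j := step (fun=> 1) (@Ival j).

(** Markov's inequality: the [b ^ j] intervals [Ival] have total length [2 C P j]. *)
Lemma level_cnt_leb j (t : R) : 0 < t ->
  (leb [set y | (t * P j <= cnt j y)%R] <= (2 * C / t)%:E)%E.
Proof.
move=> t0.
have q0 := wratio_gt0 alpha b2; have b0 := @b_gt0 R _ b2.
have P0 : 0 < P j by rewrite exprn_gt0// mulr_gt0.
have cq : 0 < C * q ^+ j by rewrite mulr_gt0// exprn_gt0.
have := @step_markov R _ (fun=> 1) (@Ival j) (fun=> ler01) _ (t * P j) (mulr_gt0 t0 P0).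
move=> /(_ (fun i => measurable_itv _)).
rewrite (eq_bigr (fun=> (2 * (C * q ^+ j))%:E)); last first.
  move=> i _; rewrite mul1e lebesgue_measure_itv /= lte_fin ltrD2l.
  rewrite (_ : - _ < _); last by lra.
  by rewrite -EFinB; congr EFin; ring.
have -> : (\sum_(i : 'I_(b ^ j)) (2 * (C * q ^+ j))%:E = (bR ^+ j * (2 * (C * q ^+ j)))%:E)%E.
  by rewrite sumEFin sumr_const card_ord -[_ *+ _]mulr_natl natrX.
move=> h.
rewrite -(@lee_pmul2l _ (t * P j)%:E)// ?lte_fin ?mulr_gt0//.
apply: (le_trans h); rewrite -EFinM lee_fin.
rewrite le_eqVlt; apply/orP; left; apply/eqP.
rewrite /P exprMn; field; exact: lt0r_neq0.
Qed.

(** The exceptional measures [2 C / (j + 1)] tend to 0 but are not summable, so only levels crowded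
    at all large scales are discarded. This suffices: contents are infima over covers, and one good
    fine scale gives a cover. *)
Definition level_null : set R :=
  \bigcup_J [set y | forall j, (J <= j)%N -> j.+1%:R * P j <= cnt j y].

Lemma leb_level_null : leb level_null = 0%E.
Proof.
apply: leb_bigcup0 => J; apply: leb_eq0 => e e0.
pose j := (J + Num.bound (2 * C / e))%N.
apply: (@le_trans _ _ (leb [set y | j.+1%:R * P j <= cnt j y])).
  by apply: le_leb => y /(_ j) /=; apply; rewrite leq_addr.
apply: (le_trans (@level_cnt_leb j j.+1%:R _)) => //.
rewrite lee_fin ler_pdivrMr// [e * _]mulrC -ler_pdivrMr//.
apply: (le_trans (ltW (archi_boundP _))); first by rewrite divr_ge0 ?mulr_ge0 ?ltW.
by rewrite ler_nat ltnW// ltnS leq_addl.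
Qed.

Lemma level_dim_upper (y s : R) : ~ level_null y -> 1 - alpha < s ->
  hausdorff_measure s [set x | 0 <= x < 1 /\ f x = y] = 0%E.
Proof.
move=> ny hs.
have q0 := wratio_gt0 alpha b2; have b0 := @b_gt0 R _ b2; have b1 := @b_gt1 R _ b2.
have s0 : 0 < s by move: a01 => /andP[]; lra.
apply: hausdorff_measure_eq0 => d e d0 e0.
(* This is [b ^ (1 - alpha - s)], so [(j + 1) * rho ^ j] is the crowding threshold times the
   [s]-power of the mesh [b ^ - j]. *)
pose rho := bR * q * bR `^ (- s).
have rho01 : 0 < rho < 1.
  rewrite !mulr_gt0 ?powR_gt0//=.
  rewrite /rho /wratio -{1}[bR]powRr1 ?ltW// -!powRD ?(gt_eqF b0) ?implybT//.
  by rewrite -[ltRHS](powRr0 bR) powR_b_ltP//; lra.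
have [J1 h1] := nat_expr_lt_eps rho01 e0.
have ib : 0 <= bR^-1 < 1 by rewrite invr_ge0 ltW//= invf_lt1.
have [J2 h2] := expr_lt_eps ib d0.
have [j jJ hj] : exists2 j, (maxn J1 J2 <= j)%N & cnt j y < j.+1%:R * P j.
  apply: contrapT => nj; apply: ny; exists (maxn J1 J2) => // j Jj.
  by rewrite leNgt; apply/negP => lt; apply: nj; exists j.
have {}h1 := h1 j (leq_trans (leq_maxl _ _) jJ).
have {}h2 := h2 j (leq_trans (leq_maxr _ _) jJ).
have bj0 : 0 < bR ^+ j by rewrite exprn_gt0.
pose G (i : nat) : set R := [set x | [/\ (i < b ^ j)%N,
  i%:R * bR ^- j <= x, x - i%:R * bR ^- j < bR ^- j & 0 <= x < 1 /\ f x = y]].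
apply: (@hausdorff_content_finite _ s d _ (b ^ j) G) => //.
- exact: ltW.
- by move=> i bi; apply/seteqP; split => x //= []; rewrite ltnNge bi.
- move=> x [/andP[x0 x1] fx]; pose i := Num.trunc (bR ^+ j * x).
  have /andP[i1 i2] := truncn_itv (mulr_ge0 (ltW bj0) x0).
  exists i => //; split => //.
  + rewrite -(ltr_nat R) natrX; apply: (le_lt_trans i1).
    by rewrite -[ltRHS]mulr1 ltr_pM2l.
  + by rewrite ler_pdivrMr// mulrC.
  + rewrite ltrBlDr -[X in X + _]mul1r -mulrDl ltr_pdivlMr// mulrC.
    by rewrite addrC natr1.
  + by rewrite x0 x1.
- move=> i x x' [_ p1 p2 _] [_ p1' p2' _].
  apply: (@le_trans _ _ (bR ^- j)); first by rewrite ler_norml; lra.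
  by rewrite -exprVn ltW.
apply: (@le_trans _ _ (cnt j y * (bR ^- j) `^ s)).
  rewrite /cnt /step mulr_suml; apply: ler_sum => i _.
  rewrite mul1r indicE; have [Gi0|] := eqVneq (G i) set0.
    rewrite Gi0 {1}/hcontent; case: pselect => // _.
  move=> /set0P[x [_ p1 p2 [x01 fx]]].
  have -> : y \in Ival i.
    rewrite inE /Ival /= in_itv /= -fx.
    have : `|x - i%:R * bR ^- j| <= bR ^- j by rewrite ler_norml; lra.
    by move/fC; rewrite ler_norml => /andP[]; lra.
  rewrite mul1r; apply: hcontent_le; rewrite ?ltW ?invr_gt0//.
  move=> z z' [_ u1 u2 _] [_ v1 v2 _].
  by rewrite ler_norml; lra.
apply: (@le_trans _ _ (j.+1%:R * P j * (bR ^- j) `^ s)).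
  by rewrite ler_wpM2r ?powR_ge0// ltW.
apply: ltW; apply: le_lt_trans h1.
rewrite -mulrA ler_wpM2l// /rho exprMn /P ler_wpM2l ?exprn_ge0 ?mulr_ge0 ?(ltW b0) ?(ltW q0)//.
by rewrite -powR_invn ?(ltW b0)// -powRrM -powR_mulrn ?powR_ge0// -powRrM mulNr mulrC mulNr.
Qed.

End LevelSetsUpper.

(** * Random Lipschitz functions *)

Section LipNorm.
Context {R : realType}.
Implicit Types g h : lipS1 R.

Lemma periodic_nat (g : R -> R) (n : nat) x :
  (forall t, g (t + 1) = g t) -> g (x + n%:R) = g x.
Proof.
by move=> gp; elim: n => [|n ih]; rewrite ?addr0// -addn1 natrD addrA gp.
Qed.

Lemma periodic_int (g : R -> R) (z : int) x :
  (forall t, g (t + 1) = g t) -> g (x + z%:~R) = g x.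
Proof.
move=> gp; case: (intP z) => [|n|n]; rewrite ?addr0//.
- exact: periodic_nat.
- by rewrite -[LHS](@periodic_nat g n.+1)// mulrNz subrK.
Qed.

Lemma lipS1_bounded g : exists M : R, forall t, `|g t| <= M.
Proof.
have [L gL] := lipfun_lipschitz g.
have L0 : 0 <= L by have := gL 0 1; rewrite sub0r normrN1 mulr1; exact: le_trans.
exists (`|g 0| + L) => t.
have -> : g t = g (t - (Num.floor t)%:~R).
  by rewrite -mulrNz periodic_int//; exact: lipfun_periodic.
set s := t - _.
have /andP[s0 s1] : 0 <= s <= 1.
  have := floor_itv t; rewrite intrD => /andP[h1 h2].
  by rewrite /s subr_ge0 h1/= lerBlDl ltW// addrC.
rewrite -[g s](subrK (g 0)) addrC; apply: (le_trans (ler_normD _ _)).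
rewrite lerD2l; apply: (le_trans (gL _ _)).
by rewrite subr0 ger0_norm// ler_piMr.
Qed.

Lemma lip_norm_le (u : R -> R) (A B : R) : (forall t, `|u t| <= A) ->
  (forall s t, `|u s - u t| <= B * `|s - t|) -> lip_norm u <= A + B.
Proof.
move=> uA uB; apply: lerD; apply: ge_sup.
- by exists `|u 0|, 0.
- by move=> _ [t _ <-].
- exists (`|u 0 - u 1| / `|0 - 1|), 0, 1; split => //.
  by rewrite eq_sym oner_neq0.
- move=> _ [s [t [st ->]]].
  by rewrite ler_pdivrMr// normr_gt0 subr_eq0.
Qed.

Lemma lip_norm_ge g h t : `|h t - g t| <= lip_norm (fun t => h t - g t).
Proof.
have [M gM] := lipS1_bounded g; have [N hN] := lipS1_bounded h.
rewrite /lip_norm; apply: ler_wpDr; last first.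
  apply: ub_le_sup; last by exists t.
  by exists (N + M) => _ [s _ <-]; apply: (le_trans (ler_normB _ _)); exact: lerD.
have [L gL] := lipfun_lipschitz g; have [K hK] := lipfun_lipschitz h.
(* The set of quotients is shown nonempty and bounded so that its [sup] is a genuine supremum, hence
   nonnegative. *)
set E := [set _ | _].
have E0 : E (`|(h 0 - g 0) - (h 1 - g 1)| / `|0 - 1|).
  by exists 0, 1; split => //; rewrite eq_sym oner_neq0.
apply: (@le_trans _ _ (`|(h 0 - g 0) - (h 1 - g 1)| / `|0 - 1|)).
  by rewrite divr_ge0.
apply: ub_le_sup => //; exists (K + L) => _ [x [y [xy ->]]].
rewrite ler_pdivrMr ?normr_gt0 ?subr_eq0// mulrDl.
have -> : h x - g x - (h y - g y) = (h x - h y) - (g x - g y) by ring.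
by apply: (le_trans (ler_normB _ _)); exact: lerD.
Qed.

End LipNorm.

Section RandomSeries.
Context {R : realType}.
Variables (h : nat -> R -> R) (T : nat -> R).
Hypothesis hper : forall i t, h i (t + 1) = h i t.
Hypothesis T_ge0 : forall i, 0 <= T i.
Hypothesis T_cvg0 : forall e : R, 0 < e -> exists n, T n < e.
Hypothesis h_le : forall i t, `|h i t| <= T i - T i.+1.
Hypothesis h_lip : forall i s t, `|h i s - h i t| <= (T i - T i.+1) * `|s - t|.
Implicit Types eps : nat -> bool.

Definition rterm eps t := fun i => (eps i)%:R * h i t.
Definition rseries eps t := limn (series (rterm eps t)).

Lemma norm_bool_mul (c : bool) (x : R) : `|c%:R * x| <= `|x|.
Proof. by case: c; rewrite ?mul1r// mul0r normr0. Qed.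

Lemma rterm_le eps t i : `|rterm eps t i| <= T i - T i.+1.
Proof. exact: le_trans (norm_bool_mul _ _) (h_le _ _). Qed.

Lemma rseries_tail eps t n : `|rseries eps t - series (rterm eps t) n| <= T n.
Proof. by apply: series_tail_bound => // i; exact: rterm_le. Qed.

Lemma rseries_cvg eps t : series (rterm eps t) @ \oo --> rseries eps t.
Proof. by apply: (@series_tail_cvg _ _ T) => // i; exact: rterm_le. Qed.

Lemma rseries_diff_tail eps s t n :
  `|(rseries eps s - rseries eps t) -
    (series (rterm eps s) n - series (rterm eps t) n)| <= T n * `|s - t|.
Proof.
pose u i := rterm eps s i - rterm eps t i.
have uE : series u = series (rterm eps s) - series (rterm eps t).
  by apply/funext => m; rewrite /series /= sumrB.
have cu : limn (series u) = rseries eps s - rseries eps t.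
  by rewrite uE; apply: cvg_lim => //; exact: cvgB (@rseries_cvg eps s) (@rseries_cvg eps t).
have -> : series (rterm eps s) n - series (rterm eps t) n = series u n by rewrite uE.
rewrite -cu; apply: (@series_tail_bound _ _ (fun k => T k * `|s - t|)).
  by move=> k; rewrite mulr_ge0.
move=> k; rewrite -mulrBl /u /rterm -mulrBr.
exact: le_trans (norm_bool_mul _ _) (h_lip _ _ _).
Qed.

Lemma rseries_periodic eps t : rseries eps (t + 1) = rseries eps t.
Proof.
congr (limn (series _)); apply/funext => i.
by rewrite /rterm hper.
Qed.

Lemma rseries_lipschitz eps s t : `|rseries eps s - rseries eps t| <= T 0%N * `|s - t|.
Proof.
have := rseries_diff_tail eps s t 0.
by rewrite /series /= !big_geq// !subr0.
Qed.

Definition rlip eps : lipS1 R :=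
  @LipS1 R (rseries eps) (rseries_periodic eps)
    (ex_intro _ (T 0%N) (rseries_lipschitz eps)).

(** Continuity of [rlip] on the Cantor space of bit sequences: the two tails contribute [2 T n] to
    the sup norm and [2 T n] to the Lipschitz seminorm. *)
Lemma rlip_close eps eps' n : (forall i, (i < n)%N -> eps i = eps' i) ->
  lip_norm (fun t => rlip eps t - rlip eps' t) <= 4 * T n.
Proof.
move=> ee.
have sE t : series (rterm eps t) n = series (rterm eps' t) n.
  rewrite /series /= !big_mkord; apply: eq_bigr => i _.
  by rewrite /rterm ee.
have -> : 4 * T n = 2 * T n + 2 * T n by ring.
apply: lip_norm_le => [t|s t] /=.
  have := rseries_tail eps t n; have := rseries_tail eps' t n.
  rewrite sE => h1 h2; rewrite -[X in `|X|](subrKA (series (rterm eps' t) n)).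
  apply: (le_trans (ler_normD _ _)).
  by rewrite (_ : 2 * T n = T n + T n) 1?lerD// 1?distrC//; ring.
have h1 := rseries_diff_tail eps s t n.
have h2 := rseries_diff_tail eps' s t n.
rewrite !sE in h1.
set a := (rseries eps s - _) in h1; set a' := (rseries eps' s - _) in h2.
rewrite (_ : rseries eps s - _ - _ = a - a'); last by rewrite /a /a'; ring.
set c := (_ - series _ n) in h1 h2.
rewrite -[a - a'](subrKA c).
apply: (le_trans (ler_normD _ _)).
rewrite (_ : 2 * T n * `|s - t| = T n * `|s - t| + T n * `|s - t|); last by ring.
by apply: lerD => //; rewrite distrC.
Qed.

(** Compactness of the Cantor space by descent in the binary tree: without a finite subcover some
    branch runs through cylinders that are not finitely covered, yet an open set containing the
    function of that branch contains a whole cylinder. *)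
Lemma rlip_compact : lip_compact (range rlip).
Proof.
move=> I U Uo cov; apply: contrapT => ncov.
pose pre (s : seq bool) eps := forall i, (i < size s)%N -> eps i = nth false s i.
pose bad s := ~ exists2 D : set I, finite_set D &
  [set rlip eps | eps in pre s] `<=` \bigcup_(i in D) U i.
have bad0 : bad [::].
  move=> [D Df DU]; apply: ncov; exists D => // g [eps _ <-].
  by apply: DU; exists eps.
have badS s : bad s -> exists c, bad (rcons s c).
  move=> bs; apply: contrapT => nb; apply: bs.
  have ok c : exists2 D : set I, finite_set D &
      [set rlip eps | eps in pre (rcons s c)] `<=` \bigcup_(i in D) U i.
    by apply: contrapT => nc; apply: nb; exists c.
  have [D0 f0 h0] := ok false; have [D1 f1 h1] := ok true.
  exists (D0 `|` D1); first by rewrite finite_setU.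
  move=> _ [eps peps <-].
  have hp c : eps (size s) = c -> pre (rcons s c) eps.
    move=> ec i; rewrite size_rcons ltnS leq_eqVlt nth_rcons => /orP[/eqP ->|lt].
      by rewrite ltnn eqxx.
    by rewrite lt; exact: peps.
  case e : (eps (size s)).
    have [i Di Ui] : (\bigcup_(i in D1) U i) (rlip eps).
      by apply: h1; exists eps => //; exact: hp.
    by exists i => //; right.
  have [i Di Ui] : (\bigcup_(i in D0) U i) (rlip eps).
    by apply: h0; exists eps => //; exact: hp.
  by exists i => //; left.
pose next s := ~~ `[< bad (rcons s false) >].
have badn s : bad s -> bad (rcons s (next s)).
  move=> bs; rewrite /next; case: asboolP => //= nf.
  by have [[] //] := badS _ bs.
pose path := fix path n := if n is n'.+1 then rcons (path n') (next (path n')) else [::].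
have badp n : bad (path n) by elim: n => //= n ih; exact: badn.
have sizep n : size (path n) = n by elim: n => //= n ih; rewrite size_rcons ih.
pose eps n := next (path n).
have nthp n i : (i < n)%N -> nth false (path n) i = eps i.
  elim: n => // n ih; rewrite ltnS leq_eqVlt /= nth_rcons sizep => /orP[/eqP ->|lt].
    by rewrite ltnn eqxx.
  by rewrite lt; exact: ih.
have [i _ Ui] : (\bigcup_i U i) (rlip eps) by apply: cov; exists eps.
have [e e0 he] := Uo i _ Ui.
have [n Tn] := T_cvg0 (divr_gt0 e0 (ltr0n _ 4)).
apply: (badp n); exists [set i] => //.
move=> _ [eps' pe <-]; exists i => //; apply: he.
apply: (@le_lt_trans _ _ (4 * T n)).
  apply: rlip_close => k kn; rewrite pe ?sizep// nthp//.
by rewrite mulrC -ltr_pdivlMr.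
Qed.

(** Binary digits of [theta]: Lebesgue measure on [[0, 1)] turns them into independent fair bits. *)
Definition bits (theta : R) (i : nat) : bool := odd (Num.trunc (2 ^+ i.+1 * theta)).

Lemma bits_cylinder (K p : nat) theta :
  p%:R / 2 ^+ K <= theta < p.+1%:R / 2 ^+ K ->
  forall i, (i < K)%N -> bits theta i = odd (p %/ 2 ^ (K - i.+1)).
Proof.
move=> /andP[h1 h2] i iK; rewrite /bits; congr odd; apply/eqP.
have p2 n : 0 < 2 ^+ n :> R by rewrite exprn_gt0.
have t0 : 0 <= theta by apply: le_trans h1; rewrite divr_ge0// ltW.
rewrite truncn_eq ?mulr_ge0 ?exprn_ge0//.
set d := (K - i.+1)%N; have dK : (K = d + i.+1)%N by rewrite /d subnK.
have d0 : (0 < 2 ^ d)%N by rewrite expn_gt0.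
rewrite dK exprD in h1 h2.
have pd : (2 ^ d)%:R = 2 ^+ d :> R by rewrite natrX.
apply/andP; split.
  rewrite ler_pdivrMr ?mulr_gt0// in h1.
  have : (p %/ 2 ^ d * 2 ^ d)%:R <= p%:R :> R by rewrite ler_nat leq_divM.
  rewrite natrM pd => /le_trans/(_ h1).
  rewrite (_ : theta * _ = 2 ^+ i.+1 * theta * 2 ^+ d); last by ring.
  by rewrite ler_pM2r.
rewrite ltr_pdivlMr ?mulr_gt0// in h2.
have : p.+1%:R <= ((p %/ 2 ^ d).+1 * 2 ^ d)%:R :> R by rewrite ler_nat ltn_ceil.
rewrite natrM pd => /(lt_le_trans h2).
rewrite (_ : theta * _ = 2 ^+ i.+1 * theta * 2 ^+ d); last by ring.
by rewrite ltr_pM2r.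
Qed.

Lemma bits_neg (theta : R) : theta < 0 -> bits theta = xpred0.
Proof.
move=> t0; apply/funext => i; rewrite /bits.
by rewrite truncn_floor leNgt pmulr_rlt0 ?t0 ?exprn_gt0.
Qed.

Definition rfun (theta : R) : lipBorel R := rlip (bits theta).

(** By [rlip_close] the preimage is a countable union of dyadic intervals, plus possibly the
    negative half-line, on which all bits are 0. *)
Lemma rfun_preimage_open (U : set (lipS1 R)) : lip_open U ->
  measurable (rfun @^-1` U).
Proof.
move=> Uo; pose I (K p : nat) := `[(p%:R / 2 ^+ K : R), (p.+1%:R / 2 ^+ K)[%classic.
have -> : rfun @^-1` U =
   (if `[< U (rlip xpred0) >] then `]-oo, (0 : R)[%classic else set0) `|`
   \bigcup_K \bigcup_p (if `[< I K p `<=` rfun @^-1` U >] then I K p else set0).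
  apply/seteqP; split => th.
    move=> /= Uth; have [th0|th0] := ltP th 0.
      left; have : U (rlip xpred0) by rewrite -(bits_neg th0).
      by move=> u; case: asboolP => //= _; rewrite in_itv.
    right; have [e e0 he] := Uo _ Uth.
    have [n Tn] := T_cvg0 (divr_gt0 e0 (ltr0n _ 4)).
    pose p := Num.trunc (2 ^+ n * th).
    have p2 : 0 < 2 ^+ n :> R by rewrite exprn_gt0.
    have thI : I n p th.
      have := truncn_itv (mulr_ge0 (ltW p2) th0).
      rewrite /I /= in_itv /= ler_pdivrMr// ltr_pdivlMr// [th * _]mulrC.
      exact.
    exists n => //; exists p => //; case: asboolP => //; case=> th' thI'.
    apply: he; apply: (@le_lt_trans _ _ (4 * T n)).
      apply: rlip_close => k kn; by rewrite !(@bits_cylinder n p).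
    by rewrite mulrC -ltr_pdivlMr.
  case; last first.
    by move=> [K _ [p _]]; case: asboolP => // IU /IU.
  case: asboolP => // u; rewrite /= in_itv /= => th0.
  by rewrite /rfun bits_neg.
apply: measurableU; first by case: asboolP => // _; exact: measurable_itv.
apply: bigcup_measurable => K _; apply: bigcup_measurable => p _.
by case: asboolP => // _; exact: measurable_itv.
Qed.

Lemma measurable_rfun : measurable_fun [set: R] rfun.
Proof.
apply: (@measurability _ _ _ (lipBorel R) [set: R] rfun (@lip_open R) erefl).
by move=> _ [U Uo <-]; rewrite setTI; exact: rfun_preimage_open.
Qed.

Let mD : measurable (`[0, 1[%classic : set R) := measurable_itv _.
Definition rlaw : set (lipBorel R) -> \bar R :=
  pushforward (mrestr (@lebesgue_measure R) mD) rfun.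

Let rlaw0 : rlaw set0 = 0%E.
Proof. by rewrite /rlaw /pushforward preimage_set0 measure0. Qed.

Let rlaw_ge0 A : (0 <= rlaw A)%E.
Proof. exact: outer_measure_ge0. Qed.

Let rlaw_sigma_additive : semi_sigma_additive rlaw.
Proof.
have mp (F : set (lipBorel R)) : measurable F -> measurable (rfun @^-1` F).
  by move=> mF; rewrite -[X in measurable X]setTI; exact: measurable_rfun.
move=> F mF tF mUF; rewrite /rlaw /pushforward preimage_bigcup.
apply: measure_semi_sigma_additive.
- by move=> n; exact: mp.
- apply/trivIsetP => /= i j _ _ ij; rewrite -preimage_setI.
  by move/trivIsetP : tF => /(_ _ _ _ _ ij) ->//; rewrite preimage_set0.
- by rewrite -preimage_bigcup; exact: mp.
Qed.

HB.instance Definition _ := isMeasure.Build _ _ _ rlaw rlaw0 rlaw_ge0 rlaw_sigma_additive.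

(** The law [rlaw] is a probability carried by the compact range of [rlip]; the mass of this range
    is read off from its preimage, the whole line. *)
Lemma shy_random (A : set (lipS1 R)) (B : set (lipBorel R)) :
  measurable B -> A `<=` B ->
  (forall x : lipS1 R, lebesgue_measure
    [set theta : R | 0 <= theta < 1 /\ exists2 g, B g & forall t, rseries (bits theta) t = x t + g t] = 0%E) ->
  shy A.
Proof.
move=> mB AB B0; exists rlaw, B; split => //.
- exists (range rlip); split; first exact: rlip_compact.
  have rlaw1 : rlaw (range rlip) = 1%E.
    rewrite /rlaw /pushforward /mrestr.
    have -> : rfun @^-1` range rlip = setT.
      by apply/seteqP; split => // th _; exists (bits th).
    by rewrite setTI lebesgue_measure_itv /= lte_fin ltr01 sube0.
  have : (0 < rlaw (range rlip) < +oo)%E by rewrite rlaw1 lte01 ltry.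
  exact.
move=> x; apply/eqP; rewrite eq_le rlaw_ge0 andbT -(B0 x).
apply: le_outer_measure => th [] /= [g Bg hg]; rewrite in_itv /= => th01.
by split => //; exists g.
Qed.

End RandomSeries.

(** * Energy criterion *)

Section EnergyCriterion.
Context {R : realType}.
Local Notation leb := (@lebesgue_measure R).
Variables (f : R -> R) (R0 : R) (W : nat -> finType) (pt : forall n, W n -> R).
Variables (lev : forall n, W n -> W n -> nat) (kappa gap rad : nat -> R) (top : R).
Hypothesis f_cont : continuous f.
Hypothesis f_le : forall x, `|f x| <= R0.
Hypothesis W_gt0 : forall n, (0 < #|W n|)%N.
Hypothesis pt_itv : forall n (w : W n), 0 <= pt w <= top.
Hypothesis kappa_gt0 : forall l, 0 < kappa l.
Hypothesis kappa_mono : {homo kappa : m n / (m <= n)%N >-> m <= n}.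
Hypothesis kappa_infty : forall A : R, exists l, A <= kappa l.
Hypothesis gap_gt0 : forall l, 0 < gap l.
Hypothesis gap_lev : forall n (w w' : W n) l, (l <= n)%N ->
  `|pt w - pt w'| < gap l -> (l <= lev w w')%N.
Hypothesis rad_gt0 : forall n, 0 < rad n.
Hypothesis rad_le1 : forall n, rad n <= 1.
Hypothesis rad_cvg0 : forall e : R, 0 < e -> exists K, forall n, (K <= n)%N -> rad n <= e.

(* Pairs are weighted by [kappa], an inverse power of their distance, and only
   those whose images nearly coincide count: this averages over the levels [y]
   the Riesz energy of uniform measures close to the level set of [y]. *)
Definition energy n : R := (#|W n|%:R ^+ 2)^-1 *
  \sum_w \sum_w' kappa (lev w w') * (`|f (@pt n w) - f (@pt n w')| < rad n)%R%:R / rad n.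

Variable B : R.
Hypothesis B0 : 0 < B.
Hypothesis energy_le : forall N : nat, exists2 n, (N <= n)%N & energy n <= B.

Let w0 n : R := (#|W n|%:R * rad n)^-1.
Let Iv n (w : W n) : set R := `[f (pt w), f (pt w) + rad n[%classic.
(** Density at a level of the image under [f] of the uniform law on coded points, smoothed over the
    length [rad n]. *)
Let mass n := step (fun=> w0 n) (@Iv n).
Let nrg n := step (fun u : W n * W n => w0 n ^+ 2 * kappa (lev u.1 u.2))
  (fun u => Iv u.1 `&` Iv u.2).

Let J : set R := `[- R0, R0 + 1]%classic.
(** The constants give [a * leb J = 1/4] and [c1 * B = 1/4], the latter as [1/8 + 1/8], so that the
    sets [V n] must carry half of the unit mass. *)
Let a : R := (4 * (2 * R0 + 1))^-1.
Let A : R := 16 * B ^+ 2 / kappa 0.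
Let lam : R := (8 * B)^-1.
Let c1 : R := lam + (4 * lam * kappa 0 * A)^-1.
Let c2 : R := lam * A + (4 * lam * kappa 0)^-1.
Let V n := [set y | (a <= mass n y)%R] `&` [set y | (nrg n y <= A)%R].

Let R0_ge0 : 0 <= R0. Proof. exact: le_trans (normr_ge0 _) (f_le 0). Qed.
Let cardW n : 0 < #|W n|%:R :> R. Proof. by rewrite ltr0n. Qed.
Let w0_gt0 n : 0 < w0 n. Proof. by rewrite invr_gt0 mulr_gt0. Qed.
Let a_gt0 : 0 < a. Proof. by rewrite invr_gt0 mulr_gt0// ltr_wpDl// mulr_ge0. Qed.
Let k0 : 0 < kappa 0. Proof. exact: kappa_gt0. Qed.
Let A_gt0 : 0 < A. Proof. by rewrite divr_gt0// mulr_gt0// exprn_gt0. Qed.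
Let lam_gt0 : 0 < lam. Proof. by rewrite invr_gt0 mulr_gt0. Qed.
Let c1_gt0 : 0 < c1. Proof. by rewrite /c1 /A /lam !(addr_gt0, mulr_gt0, invr_gt0, exprn_gt0). Qed.
Let c2_gt0 : 0 < c2. Proof. by rewrite /c2 /A /lam !(addr_gt0, mulr_gt0, invr_gt0, exprn_gt0). Qed.

Let nrgE n y : nrg n y = \sum_w \sum_w' w0 n ^+ 2 * kappa (lev w w') *
  (\1_(@Iv n w) y * \1_(@Iv n w') y).
Proof.
rewrite /nrg /step pair_bigA /=; apply: eq_bigr => u _; congr (_ * _).
by rewrite indicI.
Qed.

Let mass_sqr_le n y : kappa 0 * mass n y ^+ 2 <= nrg n y.
Proof.
rewrite nrgE /mass /step expr2 big_distrlr /= mulr_sumr; apply: ler_sum => w _.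
rewrite mulr_sumr; apply: ler_sum => w' _.
have -> : kappa 0 * (w0 n * \1_(Iv w) y * (w0 n * \1_(Iv w') y)) =
  w0 n ^+ 2 * kappa 0 * (\1_(Iv w) y * \1_(Iv w') y) by ring.
rewrite ler_wpM2r ?mulr_ge0// ler_wpM2l ?exprn_ge0 ?(ltW (w0_gt0 n))//.
exact: kappa_mono.
Qed.

Let mass_supp n y : mass n y != 0 -> J y.
Proof.
move=> m0; apply: contrapT => nJ; move/eqP: m0; apply.
rewrite /mass /step big1// => w _; rewrite indicE memNset ?mulr0//.
rewrite /Iv /= in_itv /= => /andP[h1 h2]; apply: nJ.
have := f_le (pt w); rewrite ler_norml => /andP[h3 h4].
rewrite /J /= in_itv /=; have := rad_le1 n; move: h1 h2 h3 h4; lra.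
Qed.

(** Three cases: a mass below [a] is charged to [J]; otherwise AM-GM bounds the mass by [lam * nrg]
    plus a constant, and the constant is charged to [V n] if the energy is at most [A], and to
    [nrg / A] if it is larger. *)
Let mass_le n y : mass n y <= a * \1_J y + c1 * nrg n y + c2 * \1_(V n) y.
Proof.
have nrg0 : 0 <= nrg n y.
  by apply: step_ge0 => u; rewrite mulr_ge0 ?exprn_ge0 ?ltW.
have mass0 : 0 <= mass n y by apply: step_ge0 => u; rewrite ltW.
have Vi : 0 <= \1_(V n) y :> R by rewrite indicE.
have Ji : 0 <= \1_J y :> R by rewrite indicE.
have [am|ma] := leP a (mass n y); last first.
  have [->|/mass_supp Jy] := eqVneq (mass n y) 0.
    by rewrite !addr_ge0 ?mulr_ge0 ?(ltW c1_gt0) ?(ltW c2_gt0) ?(ltW a_gt0).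
  rewrite indicE mem_set// mulr1 -addrA; apply: ler_wpDr; last exact: ltW.
  by rewrite addr_ge0 ?mulr_ge0 ?(ltW c1_gt0) ?(ltW c2_gt0).
have sq := mass_sqr_le n y.
have amgm : mass n y <= lam * nrg n y + (4 * lam * kappa 0)^-1.
  apply: (@le_trans _ _ (lam * (kappa 0 * mass n y ^+ 2) + (4 * lam * kappa 0)^-1)).
    rewrite -subr_ge0.
    have -> : lam * (kappa 0 * mass n y ^+ 2) + (4 * lam * kappa 0)^-1 - mass n y =
      (2 * lam * kappa 0 * mass n y - 1) ^+ 2 / (4 * lam * kappa 0).
      by field; rewrite !lt0r_neq0.
    by rewrite divr_ge0 ?sqr_ge0 ?mulr_ge0 ?(ltW k0) ?(ltW lam_gt0).
  by rewrite lerD2r ler_pM2l.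
have aJ : 0 <= a * \1_J y by rewrite mulr_ge0// ltW.
have [IA|AI] := leP (nrg n y) A.
  rewrite [\1_(V n) y]indicE mem_set// mulr1.
  have h1 : lam * nrg n y <= lam * A by rewrite ler_pM2l.
  have h2 : 0 <= c1 * nrg n y by rewrite mulr_ge0// ltW.
  rewrite /c2; lra.
have h2 : 0 <= c2 * \1_(V n) y by rewrite mulr_ge0// ltW.
have h3 : (4 * lam * kappa 0)^-1 <= (4 * lam * kappa 0 * A)^-1 * nrg n y.
  have p0 : 0 < (4 * lam * kappa 0)^-1 by rewrite invr_gt0 !mulr_gt0.
  rewrite [in leRHS](invfM _ A) -[leRHS]mulrA -[leLHS]mulr1 ler_pM2l//.
  by rewrite ler_pdivlMl// mulr1 ltW.
rewrite /c1 mulrDl; lra.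
Qed.

Let mIv n (w : W n) : measurable (Iv w). Proof. exact: measurable_itv. Qed.

Let lebIv n (w : W n) : leb (Iv w) = (rad n)%:E.
Proof.
by rewrite /Iv lebesgue_measure_itv /= lte_fin ltrDl rad_gt0 -EFinB addrC addKr.
Qed.

Let mV n : measurable (V n).
Proof.
apply: measurableI.
  rewrite -[X in measurable X]setTI.
  by apply: (measurable_fun_le measurableT (measurable_cst a)); apply: measurable_step.
rewrite -[X in measurable X]setTI.
apply: (measurable_fun_le measurableT _ (measurable_cst A)); apply: measurable_step.
by move=> u; exact: measurableI.
Qed.

Let int_mass n : (\int[leb]_y (mass n y)%:E = 1)%E.
Proof.
rewrite integral_step// => [|w]; last by rewrite ltW.
under eq_bigr do rewrite lebIv -EFinM.
rewrite sumEFin sumr_const -mulr_natl; congr EFin.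
by rewrite /w0; field; rewrite !lt0r_neq0.
Qed.

Let int_nrg n : (\sum_(u : W n * W n) (w0 n ^+ 2 * kappa (lev u.1 u.2))%:E * leb (Iv u.1 `&` Iv u.2) <= (energy n)%:E)%E.
Proof.
rewrite /energy pair_bigA mulr_sumr -sumEFin /=; apply: lee_sum => u _.
have h0 : 0 <= w0 n ^+ 2 * kappa (lev u.1 u.2) by rewrite mulr_ge0 ?exprn_ge0 ?ltW.
have -> : (#|W n|%:R ^+ 2)^-1 * (kappa (lev u.1 u.2) * (`|f (pt u.1) - f (pt u.2)| < rad n)%R%:R / rad n) =
  w0 n ^+ 2 * kappa (lev u.1 u.2) * (rad n * (`|f (pt u.1) - f (pt u.2)| < rad n)%R%:R) :> R.
  by rewrite /w0; field; rewrite !lt0r_neq0.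
rewrite [leRHS]EFinM; apply: lee_wpmul2l; first by rewrite lee_fin.
case: (boolP (`|f (pt u.1) - f (pt u.2)| < rad n)) => h; rewrite ?mulr1 ?mulr0.
  by rewrite -(lebIv u.1); apply: le_leb; exact: subIsetl.
have -> : Iv u.1 `&` Iv u.2 = set0; last by rewrite measure0.
apply/seteqP; split => y //=; rewrite /Iv /= !in_itv /= => -[h1 h2].
by move: h => /negP; apply; rewrite ltr_norml; move: h1 h2; lra.
Qed.

Let delta : R := (2 * c2)^-1.

(** A second moment argument: integrating [mass_le] gives [1 <= 1/4 + 1/4 + c2 * leb (V n)]. *)
Let leb_V n : energy n <= B -> (delta%:E <= leb (V n))%E.
Proof.
move=> EB.
pose I' : finType := (bool + (W n * W n))%type.
pose wt (i : I') := match i with inl true => a | inl false => c2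
  | inr u => c1 * (w0 n ^+ 2 * kappa (lev u.1 u.2)) end.
pose St (i : I') := match i with inl true => J | inl false => V n
  | inr u => Iv u.1 `&` Iv u.2 end.
have wt0 i : 0 <= wt i.
  case: i => [[]|u] /=; rewrite ?(ltW a_gt0) ?(ltW c2_gt0)//.
  by rewrite mulr_ge0 ?(ltW c1_gt0)// mulr_ge0 ?exprn_ge0 ?ltW.
have mSt i : measurable (St i).
  by case: i => [[]|u] //=; [exact: measurable_itv|exact: measurableI].
have big3 (G : I' -> \bar R) : (\sum_i G i = G (inl true) + G (inl false) + \sum_u G (inr u))%E.
  by rewrite big_sumType /= big_bool.
have stepE y : step wt St y = a * \1_J y + c1 * nrg n y + c2 * \1_(V n) y.
  rewrite /step big_sumType /= big_bool /= addrAC; congr (_ + _ + _).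
  by rewrite /nrg /step mulr_sumr; apply: eq_bigr => u _; rewrite [RHS]mulrA.
have int_le : (\int[leb]_y (mass n y)%:E <= \int[leb]_y (step wt St y)%:E)%E.
  apply: ge0_le_integral => //.
  - by move=> y _; rewrite lee_fin step_ge0// => w; rewrite ltW.
  - by apply/measurable_EFinP; exact: measurable_step.
  - by apply/measurable_EFinP; exact: measurable_step.
  - by move=> y _; rewrite lee_fin stepE; exact: mass_le.
move: int_le; rewrite int_mass integral_step// big3 /=.
have -> : (\sum_(u : W n * W n) (c1 * (w0 n ^+ 2 * kappa (lev u.1 u.2)))%:E * leb (Iv u.1 `&` Iv u.2) =
  c1%:E * \sum_(u : W n * W n) (w0 n ^+ 2 * kappa (lev u.1 u.2))%:E * leb (Iv u.1 `&` Iv u.2))%E.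
  rewrite ge0_sume_distrr; last first.
    by move=> u _; rewrite mule_ge0 ?leb_ge0// lee_fin mulr_ge0 ?exprn_ge0 ?ltW.
  by apply: eq_bigr => u _; rewrite EFinM muleA.
have lebJ : leb J = (2 * R0 + 1)%:E.
  rewrite /J lebesgue_measure_itv /= lte_fin (_ : - R0 < R0 + 1); last by move: R0_ge0; lra.
  by rewrite -EFinB; congr EFin; ring.
have c1B : c1 * B = 4^-1.
  by rewrite /c1 /A /lam; field; rewrite !lt0r_neq0.
have aJ : a * (2 * R0 + 1) = 4^-1.
  by rewrite /a; field; rewrite lt0r_neq0// ltr_wpDl// mulr_ge0.
have hI : (c1%:E * \sum_(u : W n * W n) (w0 n ^+ 2 * kappa (lev u.1 u.2))%:E * leb (Iv u.1 `&` Iv u.2) <= (4^-1)%:E)%E.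
  rewrite -c1B EFinM; apply: lee_wpmul2l; first by rewrite lee_fin ltW.
  by apply: (le_trans (int_nrg n)); rewrite lee_fin.
rewrite lebJ -EFinM aJ.
have := leb_ge0 (V n).
case: (leb (V n)) => [v| |] //; last by move=> *; rewrite leey.
move=> _ h; have {h} := le_trans h (leeD (lexx _) hI).
rewrite -EFinM -!EFinD !lee_fin => h.
rewrite /delta -[leLHS]mul1r ler_pdivrMr; last exact: mulr_gt0.
by move: h; lra.
Qed.

Definition good_values : set R :=
  \bigcap_K \bigcup_(n in [set n | (K <= n)%N /\ energy n <= B]) V n.

Let FF K := \bigcup_(n in [set n | (K <= n)%N /\ energy n <= B]) V n.

Let mFF K : measurable (FF K).
Proof. by apply: bigcup_measurable => n _; exact: mV. Qed.

Lemma measurable_good_values : measurable good_values.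
Proof. by apply: bigcap_measurable => [|K _]; [exists 0%N|exact: mFF]. Qed.

(** The upper limit of sets of measure at least [delta] inside the bounded interval [J] has measure
    at least [delta], by continuity from above. *)
Lemma leb_good_values : (0 < leb good_values)%E.
Proof.
apply: (@lt_le_trans _ _ delta%:E); first by rewrite lte_fin /delta invr_gt0; exact: mulr_gt0.
have FJ K : FF K `<=` J.
  by move=> y [n _ [h1 _]]; apply: (@mass_supp n); rewrite gt_eqF// (lt_le_trans a_gt0).
have c : (leb \o FF) @ \oo --> leb (\bigcap_n FF n).
  apply: (@nonincreasing_cvg_mu _ _ _ leb) => //.
  - apply: (le_lt_trans (le_leb (FJ 0%N))).
    by rewrite /J lebesgue_measure_itv /=; case: ifP => _; rewrite ?ltry// -EFinB ltry.
  - exact: measurable_good_values.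
  - move=> k l kl; apply/subsetPset => y [n [ln En] Vn]; exists n => //; split => //.
    exact: leq_trans kl ln.
rewrite -(cvg_lim _ c)//; apply: lime_ge; first by apply/cvg_ex; eexists; exact: c.
apply: nearW => K /=.
have [n Kn En] := energy_le K.
by apply: (le_trans (leb_V En)); apply: le_leb => y Vy; exists n.
Qed.

Lemma open_gt (y e : R) : open [set x | e < `|f x - y|].
Proof.
apply: (@open_comp _ _ (fun x => `|f x - y|) [set z | e < z]); last exact: open_gt.
by move=> x _; apply: cvg_norm; apply: cvgB; [exact: f_cont|exact: cvg_cst].
Qed.

(** The open sets where [f] differs from [y] by more than [1 / (i + 1)] complete the cover to one of
    the whole segment, and compactness applies. *)
Lemma compact_level_nbhs (y : R) (U : nat -> set R) :
  (forall i, open (U i)) -> [set x | 0 <= x <= top /\ f x = y] `<=` \bigcup_i U i ->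
  exists N : nat, forall x, 0 <= x <= top -> `|f x - y| <= N.+1%:R^-1 ->
    exists2 i, (i < N)%N & U i x.
Proof.
move=> Uo cov.
pose U' i := U i `|` [set x | i.+1%:R^-1 < `|f x - y|].
have := @segment_compact R 0 top; rewrite compact_cover => /(_ nat setT U').
case.
- by move=> i _; apply: openU => //; exact: open_gt.
- move=> x; rewrite /= in_itv /= => x01.
  have [fy|fy] := eqVneq (f x) y.
    by have [i _ Ui] : (\bigcup_i U i) x; [exact: cov|exists i => //; left].
  have p : 0 < `|f x - y| by rewrite normr_gt0 subr_eq0.
  exists (Num.bound (`|f x - y|^-1)) => //; right => /=.
  rewrite invf_plt ?posrE//; apply: (lt_trans (archi_boundP _)); first by rewrite invr_ge0.
  by rewrite ltr_nat.
move=> D _ cD.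
exists (\max_(i <- finmap.enum_fset D) i).+1 => x x01 fx.
have [i Di [Ui|]] := cD x ltac:(by rewrite /= in_itv).
  by exists i => //; rewrite ltnS; exact: (@leq_bigmax_seq _ _ xpredT id).
move=> /=; rewrite ltNge => /negP; case; apply: (le_trans fx).
rewrite lef_pV2 ?posrE// ler_nat ltnS ltnW// ltnS.
exact: (@leq_bigmax_seq _ _ xpredT id).
Qed.

(** Take the first [l] with [gap l.+1 <= diam F]. Then [kappa l] is at least [c / diam F ^ s], and
    if [l] is positive then [diam F < gap l], which leaves room to thicken [F] while keeping its
    points [gap l]-close. *)
Lemma cover_scale (s c e : R) (F : set R) : 0 <= s -> 0 < c -> 0 < e ->
  (forall l, c <= kappa l * gap l.+1 `^ s) -> (diam F <= 1)%E -> F !=set0 ->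
  exists u : nat * R, [/\ 0 < u.2, (kappa u.1)^-1 <= c^-1 * hcontent s F + e &
    u.1 = 0%N \/ forall x x' z z', F z -> F z' -> `|x - z| < u.2 -> `|x' - z'| < u.2 ->
      `|x - x'| < gap u.1].
Proof.
move=> s0 c0 e0 hc dF [z0 Fz0].
have d0 : (0 <= diam F)%E by have := diam_ge Fz0 Fz0; rewrite subrr normr0.
have fd : diam F \is a fin_num by rewrite ge0_fin_numE//; exact: le_lt_trans dF (ltry _).
pose d := fine (diam F).
have dE : diam F = d%:E by rewrite fineK.
have d0' : 0 <= d by rewrite fine_ge0.
have Fd z z' : F z -> F z' -> `|z - z'| <= d.
  by move=> Fz Fz'; rewrite -lee_fin -dE; exact: diam_ge.
have hE : hcontent s F = d `^ s.
  rewrite /hcontent; case: pselect => // F0; exfalso.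
  by move: Fz0; rewrite F0.
have near_gap l : d < gap l -> forall x x' z z', F z -> F z' ->
    `|x - z| < (gap l - d) / 2 -> `|x' - z'| < (gap l - d) / 2 -> `|x - x'| < gap l.
  move=> dl x x' z z' Fz Fz' h1 h2; have h3 := Fd _ _ Fz Fz'.
  have -> : x - x' = (x - z) + (z - z') - (x' - z') by ring.
  apply: (le_lt_trans (ler_normB _ _)); apply: (@le_lt_trans _ _ (`|x - z| + `|z - z'| + `|x' - z'|)).
    by rewrite lerD2r ler_normD.
  by lra.
have kl l : gap l.+1 <= d -> (kappa l)^-1 <= c^-1 * hcontent s F + e.
  move=> gd; rewrite hE; apply: ler_wpDr; first exact: ltW.
  rewrite ler_pdivlMl// ler_pdivrMr// [leRHS]mulrC.
  apply: (le_trans (hc l)); rewrite ler_pM2l//.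
  by apply: ge0_ler_powR; rewrite ?nnegrE// ltW.
have [ex|nex] := pselect (exists l, gap l.+1 <= d).
  have [l gl lmin] := ex_minnP ex.
  case: l gl lmin => [|l] gl lmin.
    by exists (0%N, 1); split => //=; [exact: kl|left].
  have dl : d < gap l.+1.
    by rewrite ltNge; apply/negP => /lmin; rewrite ltnn.
  exists (l.+1, (gap l.+1 - d) / 2); split => //=.
  - by rewrite divr_gt0// subr_gt0.
  - exact: kl.
  - by right; exact: near_gap.
(* No gap is below the diameter, as for a single point: any scale is admissible, and the error [e]
   pays for it. *)
have [l hl] := kappa_infty e^-1.
have dl : d < gap l.+1 by rewrite ltNge; apply/negP => h; apply: nex; exists l.
exists (l.+1, (gap l.+1 - d) / 2); split => //=.
- by rewrite divr_gt0// subr_gt0.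
- apply: ler_wpDl; first by rewrite mulr_ge0 ?hcontent_ge0// invr_ge0 ltW.
  rewrite -[e]invrK lef_pV2 ?posrE ?invr_gt0//.
  by apply: (le_trans hl); exact: kappa_mono.
- by right; exact: near_gap.
Qed.

Lemma sum_pow_half (N : nat) : \sum_(i < N) (2^-1 : R) ^+ i.+1 <= 1.
Proof.
have -> : \sum_(i < N) (2^-1 : R) ^+ i.+1 = 1 - 2^-1 ^+ N.
  elim: N => [|N ih]; first by rewrite big_ord0 expr0 subrr.
  by rewrite big_ord_recr /= ih exprS; field.
by rewrite gerBl exprn_ge0.
Qed.

(** Mass distribution at a finite stage, with no limit measure: the coded points near level [y] are
    shared out among the thickened covering sets. Two points in one set have level at least its
    scale, so the energy bounds the squared masses from below. *)
Lemma good_values_content (y s c : R) : good_values y -> 0 <= s -> 0 < c ->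
  (forall l, c <= kappa l * gap l.+1 `^ s) ->
  exists2 e : R, 0 < e & forall F : nat -> set R,
    [set x | 0 <= x <= top /\ f x = y] `<=` \bigcup_i F i ->
    (forall i, (diam (F i) <= 1)%E) ->
    exists N, e <= \sum_(i < N) hcontent s (F i).
Proof.
move=> gy s0 c0 hc.
have A2 : 0 < 2 * A by exact: mulr_gt0.
have a2 : 0 < 2 * a by exact: mulr_gt0.
have aA : 0 < a / (2 * A) := divr_gt0 a_gt0 A2.
have Aa : 0 < A / (2 * a) := divr_gt0 A_gt0 a2.
(* The AM-GM bounds sum to [a <= a / 2 + A / (2 a) * sum t], that is, [sum t >= 2 * eta]; the errors
   [eta * 2 ^ - (i + 1)] use at most half of this. *)
pose eta : R := a ^+ 2 / (2 * A).
have eta0 : 0 < eta by rewrite /eta; apply: divr_gt0; [exact: exprn_gt0|exact: mulr_gt0].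
exists (c * eta); first by rewrite mulr_gt0.
move=> F cov dF.
have half0 i : 0 < (2^-1 : R) ^+ i.+1 by rewrite exprn_gt0.
pose scale i (u : nat * R) := F i !=set0 ->
    [/\ 0 < u.2, (kappa u.1)^-1 <= c^-1 * hcontent s (F i) + eta * 2^-1 ^+ i.+1 &
    u.1 = 0%N \/ forall x x' z z', F i z -> F i z' -> `|x - z| < u.2 ->
      `|x' - z'| < u.2 -> `|x - x'| < gap u.1].
have /choice[u hu] : forall i, exists u, scale i u.
  move=> i; rewrite /scale.
  have [Fi|nFi] := pselect (F i !=set0); last by exists (0%N, 1).
  have [ui h] := cover_scale s0 c0 (mulr_gt0 eta0 (half0 i)) hc (dF i) Fi.
  by exists ui.
pose U i := [set x | exists2 z, F i z & `|x - z| < (u i).2].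
have Uo i : open (U i).
  have -> : U i = \bigcup_(z in F i) ball z (u i).2.
    apply/seteqP; split => x; [move=> [z Fz h]|move=> [z Fz h]]; exists z => //.
      by rewrite /ball /= distrC.
    by move: h; rewrite /ball /= distrC.
  by apply: bigcup_open => z _; exact: ball_open.
have covU : [set x | 0 <= x <= top /\ f x = y] `<=` \bigcup_i U i.
  move=> x /cov[i _ Fx]; exists i => //; exists x => //.
  by rewrite subrr normr0; have [] := hu i (ex_intro _ x Fx).
have [N hN] := compact_level_nbhs Uo covU.
exists N.
have [K hK] := rad_cvg0 (ltac:(by rewrite invr_gt0) : 0 < N.+1%:R^-1 :> R).
(* The stage [n] must exceed every scale in use, for [gap_lev] to apply, and have
   [rad n <= 1 / (N + 1)], for the points counted at [y] to lie in the finite cover. *)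
pose L := \max_(i < N) (u i).1.
have [n [nK _] [ma IA]] := gy (maxn K L) I.
have {}hK := hK n (leq_trans (leq_maxl _ _) nK).
have hL i : (i < N)%N -> ((u i).1 <= n)%N.
  move=> iN; apply: leq_trans (leq_trans (leq_maxr K _) nK).
  exact: (@leq_bigmax _ (fun i : 'I_N => (u i).1) (Ordinal iN)).
have /choice[idx hidx] : forall w : W n, exists i : nat, Iv w y -> (i < N)%N /\ U i (pt w).
  move=> w.
  have [Iw|nI] := pselect (Iv w y); last by exists 0%N.
  have [||i iN Ui] := hN (pt w); first exact: pt_itv.
    apply: le_trans hK; move: Iw; rewrite /Iv /= in_itv /= ler_norml; lra.
  by exists i.
pose cnt i : R := \sum_w \1_(@Iv n w) y * (idx w == i)%:R.
have massE : mass n y = \sum_(i < N) w0 n * cnt i.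
  rewrite -mulr_sumr /cnt exchange_big /= mulr_sumr; apply: eq_bigr => w _.
  congr (_ * _); rewrite -mulr_sumr indicE.
  case: (boolP (y \in Iv w)) => [|_]; last by rewrite mul0r.
  rewrite inE => /hidx[iN _]; rewrite mul1r (bigD1 (Ordinal iN))//= eqxx big1 ?addr0//.
  by move=> i; rewrite -val_eqE /= eq_sym => /negbTE ->.
have nrg_ge : \sum_(i < N) w0 n ^+ 2 * kappa (u i).1 * cnt i ^+ 2 <= nrg n y.
  rewrite nrgE.
  have -> : \sum_(i < N) w0 n ^+ 2 * kappa (u i).1 * cnt i ^+ 2 =
    \sum_w \sum_w' \sum_(i < N) w0 n ^+ 2 * kappa (u i).1 *
       ((\1_(Iv w) y * (idx w == i)%:R) * (\1_(Iv w') y * (idx w' == i)%:R)).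
    under [RHS]eq_bigr do rewrite exchange_big /=.
    rewrite exchange_big /=; apply: eq_bigr => i _.
    rewrite [cnt i ^+ 2]expr2 /cnt big_distrlr /= mulr_sumr; apply: eq_bigr => w _.
    by rewrite mulr_sumr.
  apply: ler_sum => w _; apply: ler_sum => w' _; rewrite !indicE.
  have w2 : 0 <= w0 n ^+ 2 by rewrite exprn_ge0// ltW.
  case: (boolP (y \in Iv w)) => [|_]; last by rewrite !mul0r mulr0 big1// => i _; rewrite !mul0r mulr0.
  rewrite inE => Iw; have [iN Uw] := hidx _ Iw.
  case: (boolP (y \in Iv w')) => [|_]; last by rewrite mulr0 mulr0 big1// => i _; rewrite mul0r !mulr0.
  rewrite inE => Iw'; have [iN' Uw'] := hidx _ Iw'.
  rewrite (bigD1 (Ordinal iN))//= eqxx big1 ?addr0; last first.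
    by move=> i; rewrite -val_eqE /= eq_sym => /negbTE ->; rewrite mul1r mul0r mulr0.
  rewrite !mul1r; case: eqVneq => [ii|_]; last first.
    by rewrite !mulr0 !mulr1 mulr_ge0// ltW.
  rewrite !mulr1 ler_wpM2l//; apply: kappa_mono.
  have [z Fz hz] := Uw; have [z' Fz' hz'] := Uw'; rewrite ii in Fz' hz'.
  have [_ _ [->//|hgap]] := hu _ (ex_intro _ z Fz).
  by apply: gap_lev; [exact: hL|exact: hgap Fz Fz' hz hz'].
pose t i := c^-1 * hcontent s (F i) + eta * 2^-1 ^+ i.+1.
have t0 i : 0 <= t i.
  by rewrite addr_ge0// mulr_ge0 ?hcontent_ge0 ?invr_ge0 ?ltW.
have key i : (i < N)%N -> w0 n * cnt i <=
    a / (2 * A) * (w0 n ^+ 2 * kappa (u i).1 * cnt i ^+ 2) + A / (2 * a) * t i.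
  move=> iN.
  have [Fi|nFi] := pselect (F i !=set0); last first.
    have -> : cnt i = 0.
      rewrite /cnt big1// => w _; rewrite indicE.
      case: (boolP (y \in Iv w)) => [|_]; last by rewrite mul0r.
      rewrite inE => /hidx[_ [z Fz _]]; case: eqVneq => [e|_]; last by rewrite mulr0.
      by exfalso; apply: nFi; exists z; rewrite -e.
    by rewrite mulr0 expr0n /= !mulr0 add0r mulr_ge0// ltW.
  have [_ hk _] := hu _ Fi.
  apply: (@le_trans _ _ (a / (2 * A) * (w0 n ^+ 2 * kappa (u i).1 * cnt i ^+ 2) + A / (2 * a) * (kappa (u i).1)^-1)); last first.
    by rewrite lerD2l ler_pM2l.
  have k1 := kappa_gt0 (u i).1.
  rewrite -subr_ge0.
  have -> : a / (2 * A) * (w0 n ^+ 2 * kappa (u i).1 * cnt i ^+ 2) + A / (2 * a) * (kappa (u i).1)^-1 - w0 n * cnt i =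
    (a * kappa (u i).1 * (w0 n * cnt i) - A) ^+ 2 / (2 * A * a * kappa (u i).1).
    by field; rewrite !lt0r_neq0.
  apply: divr_ge0; first exact: sqr_ge0.
  by apply: ltW; apply: mulr_gt0 => //; apply: mulr_gt0.
have h1 : a <= a / (2 * A) * A + A / (2 * a) * \sum_(i < N) t i.
  apply: (le_trans ma); rewrite massE.
  apply: (@le_trans _ _ (\sum_(i < N) (a / (2 * A) * (w0 n ^+ 2 * kappa (u i).1 * cnt i ^+ 2) + A / (2 * a) * t i))).
    by apply: ler_sum => i _; exact: key.
  rewrite big_split /= -!mulr_sumr lerD2r ler_pM2l//.
  exact: le_trans nrg_ge IA.
have h2 : \sum_(i < N) t i <= c^-1 * \sum_(i < N) hcontent s (F i) + eta.
  rewrite /t big_split /= -!mulr_sumr lerD2l -[leRHS]mulr1 ler_pM2l//.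
  exact: sum_pow_half.
have h3 : a / 2 <= A / (2 * a) * \sum_(i < N) t i.
  move: h1; rewrite (_ : a / (2 * A) * A = a / 2); last by field; rewrite lt0r_neq0.
  lra.
have h4 : 2 * eta <= \sum_(i < N) t i.
  rewrite -(ler_pM2l Aa).
  apply: le_trans h3; rewrite le_eqVlt; apply/orP; left; apply/eqP.
  by rewrite /eta; field; rewrite !lt0r_neq0.
rewrite -ler_pdivlMl//.
move: h2 h4; lra.
Qed.

End EnergyCriterion.

(** * Coded points and markers *)

Section Blocks.
Variable width : nat -> nat.
Hypothesis width_gt0 : forall n, (0 < width n)%N.

(** Block number and offset of position [i]. It is used twice: for the blocks of digits, and with
    widths [S] to enumerate the pairs [(D, m)] with [m <= D]. *)
Fixpoint loc i : nat * nat :=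
  if i is i'.+1 then
    let: (n, o) := loc i' in if (o.+1 < width n)%N then (n, o.+1) else (n.+1, 0%N)
  else (0%N, 0%N).

Definition start n := (\sum_(j < n) width j)%N.

Lemma startS n : start n.+1 = (start n + width n)%N.
Proof. by rewrite /start big_ord_recr. Qed.

Lemma loc_lt i : ((loc i).2 < width (loc i).1)%N.
Proof.
elim: i => [|i ih] /=; first exact: width_gt0.
case: (loc i) ih => n o /= ih; case: ifP => //= _; exact: width_gt0.
Qed.

Lemma locK i : (start (loc i).1 + (loc i).2)%N = i.
Proof.
elim: i => [|i]; first by rewrite /= /start big_ord0.
have := loc_lt i; rewrite /=; case: (loc i) => n o /= ho ih.
case: ifP => h /=; first by rewrite addnS ih.
by rewrite startS addn0 -ih -addnS; congr addn; lia.
Qed.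

Lemma start_mono m n : (m <= n)%N -> (start m <= start n)%N.
Proof.
elim: n => [|n ih]; first by rewrite leqn0 => /eqP ->.
rewrite leq_eqVlt => /orP[/eqP -> //|mn].
by rewrite startS (leq_trans (ih _))// leq_addr.
Qed.

Lemma start_lt m n : (m < n)%N -> (start m + width m <= start n)%N.
Proof. by move=> /start_mono; rewrite startS. Qed.

Lemma loc_start n o : (o < width n)%N -> loc (start n + o) = (n, o).
Proof.
move=> h; have := locK (start n + o); have := loc_lt (start n + o).
case: (loc _) => m r /= hr e.
have mn : m = n.
  case: (ltngtP m n) => // /start_lt; lia.
by subst m; congr pair; lia.
Qed.

Lemma loc1_lt i n : (i < start n)%N -> ((loc i).1 < n)%N.
Proof.
move=> h; rewrite ltnNge; apply/negP => /start_mono; have := locK i; lia.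
Qed.

End Blocks.

Section Digits.
Context (R : realType) (b : nat).
Hypothesis b2 : (2 <= b)%N.
Local Notation bR := (b%:R : R).
Variables (d : nat -> nat) (L : nat).
Hypothesis d_lt : forall i, (d i < b)%N.
Hypothesis d_z : forall i, (L <= i)%N -> d i = 0%N.

(** The number with base [b] expansion [d k, d (k + 1), ...]; since [d] vanishes from [L] on, [L]
    terms suffice for every [k]. *)
Definition dtail (k : nat) : R := \sum_(j < L) (d (k + j))%:R / bR ^+ j.+1.

Fixpoint dhead (k : nat) : nat := if k is k'.+1 then (b * dhead k' + d k')%N else 0%N.

Let b0 : 0 < bR. Proof. exact: b_gt0. Qed.

Lemma dtail_rec k : dtail k = ((d k)%:R + dtail k.+1) / bR.
Proof.
have e : dtail k = \sum_(j < L.+1) (d (k + j))%:R / bR ^+ j.+1.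
  by rewrite big_ord_recr /= d_z ?leq_addl// mul0r addr0.
rewrite e big_ord_recl /= addn0 expr1 mulrDl; congr (_ + _).
rewrite /dtail mulr_suml; apply: eq_bigr => j _.
by rewrite /bump /= add1n addnS addSn exprS [in RHS]mulrAC -mulrA -invfM mulrC.
Qed.

Lemma dtail_ge0 k : 0 <= dtail k.
Proof. by apply: sumr_ge0 => j _; rewrite divr_ge0 ?exprn_ge0 ?(ltW b0). Qed.

Lemma dtail_lt1 k : dtail k < 1.
Proof.
have h : dtail k <= \sum_(j < L) (bR - 1) / bR ^+ j.+1.
  apply: ler_sum => j _; rewrite ler_pM2r ?invr_gt0 ?exprn_gt0//.
  by rewrite lerBrDr natr1 ler_nat.
apply: (le_lt_trans h).
have -> : \sum_(j < L) (bR - 1) / bR ^+ j.+1 = 1 - bR ^- L.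
  elim: (L) => [|n ih]; first by rewrite big_ord0 expr0 invr1 subrr.
  rewrite big_ord_recr /= ih exprS; field.
  by rewrite expf_neq0 ?lt0r_neq0.
by rewrite ltrBlDr ltrDl invr_gt0 exprn_gt0.
Qed.

(** Hence a 1-periodic function takes the same value at [b ^ k x] and at [dtail k], which turns the
    terms of the Weierstrass series into functions of shifted digits. *)
Lemma dhead_tail k : bR ^+ k * dtail 0 = (dhead k)%:R + dtail k.
Proof.
elim: k => [|k ih]; first by rewrite expr0 mul1r add0r.
rewrite exprS -mulrA ih dtail_rec /= natrD natrM; field; exact: lt0r_neq0.
Qed.

Lemma dtail_zeros k m : (forall j, (j < m)%N -> d (k + j) = 0%N) ->
  dtail k = dtail (k + m) / bR ^+ m.
Proof.
elim: m k => [|m ih] k h; first by rewrite addn0 expr0 divr1.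
rewrite dtail_rec -[k in d k]addn0 h// add0r (ih k.+1).
  by rewrite addSnnS exprS invfM mulrA mulrAC.
by move=> j jm; rewrite addSnnS h.
Qed.

Lemma dtail_ge k j : (0 < d (k + j))%N -> bR ^- j.+1 <= dtail k.
Proof.
move=> h; have jL : (j < L)%N.
  by rewrite ltnNge; apply/negP => Lj; rewrite d_z// in h; apply: leq_trans Lj (leq_addl _ _).
rewrite /dtail (bigD1 (Ordinal jL))//= ler_wpDr//.
  by apply: sumr_ge0 => i _; rewrite divr_ge0 ?exprn_ge0 ?(ltW b0).
by rewrite ler_peMl ?invr_ge0 ?exprn_ge0 ?(ltW b0)// ler1n.
Qed.

Lemma dtail_end k : (L <= k)%N -> dtail k = 0.
Proof.
move=> Lk; rewrite /dtail big1// => j _.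
by rewrite d_z ?mul0r// (leq_trans Lk)// leq_addr.
Qed.

End Digits.

Lemma dhead_inj (b : nat) (d d' : nat -> nat) k :
  (forall i, (d i < b)%N) -> (forall i, (d' i < b)%N) ->
  dhead b d k = dhead b d' k -> forall i, (i < k)%N -> d i = d' i.
Proof.
move=> db db'; elim: k => // k ih /= e.
have b0 : (0 < b)%N by apply: leq_ltn_trans (db 0%N).
have dk : d k = d' k.
  have := congr1 (modn^~ b) e; rewrite /= !(mulnC b) !modnMDl !modn_small//.
have ek : dhead b d k = dhead b d' k.
  by move: e; rewrite dk => /addIn/eqP; rewrite eqn_mul2l => /orP[/eqP b00|/eqP//]; lia.
by move=> i; rewrite ltnS leq_eqVlt => /orP[/eqP ->//|]; exact: ih.
Qed.

Section Bump.
Context {R : realType} (v c : R).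
Hypotheses (v0 : 0 <= v) (vc : v <= c) (cv : c + v <= 1).

Definition frac (t : R) : R := t - (Num.floor t)%:~R.

Lemma frac_itv t : 0 <= frac t < 1.
Proof.
have := floor_itv t; rewrite intrD /frac => /andP[h1 h2].
by rewrite subr_ge0 h1/= ltrBlDl.
Qed.

Definition tent (t : R) : R := Num.max 0 (v - `|frac t - c|).

Lemma tent_periodic t : tent (t + 1) = tent t.
Proof.
rewrite /tent /frac (_ : Num.floor (t + 1) = Num.floor t + 1); last first.
  by apply: floor_def; have := floor_itv t; rewrite !intrD !lerD2r !ltrD2r.
by rewrite intrD opprD addrACA subrr addr0.
Qed.

Lemma tent_ge0 t : 0 <= tent t. Proof. by rewrite le_max lexx. Qed.

Lemma tent_le t : tent t <= v.
Proof. by rewrite ge_max v0/= gerBl. Qed.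

Lemma tent_frac t : 0 <= t < 1 -> tent t = Num.max 0 (v - `|t - c|).
Proof.
move=> t01; rewrite /tent /frac (@floor_def _ t 0); last by rewrite add0r.
by rewrite subr0.
Qed.

Let tent_le_frac t : tent t <= frac t.
Proof.
have /andP[f0 f1] := frac_itv t; rewrite ge_max f0/=.
have := ler_norm (c - frac t); rewrite distrC; move: vc; lra.
Qed.

Let tent_le_onem t : tent t <= 1 - frac t.
Proof.
have /andP[f0 f1] := frac_itv t; rewrite ge_max subr_ge0 (ltW f1)/=.
have := ler_norm (frac t - c); move: cv; lra.
Qed.

(** If an integer separates the points, each value is at most the distance to it, because the tent
    is supported inside [[0, 1]]. *)
Lemma tent_lipschitz s t : `|tent s - tent t| <= `|s - t|.
Proof.
wlog st : s t / s <= t.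
  move=> h; have [/h//|/ltW/h] := leP s t.
  by rewrite distrC [X in _ <= X]distrC.
rewrite [leRHS]distrC [leRHS]ger0_norm ?subr_ge0//.
have := le_floor st; rewrite le_eqVlt => /orP[/eqP e|lt].
  rewrite /tent.
  have -> : t - s = `|frac s - frac t|.
    by rewrite /frac e distrC ger0_norm ?opprB ?addrA ?subrK ?subr_ge0//; lra.
  have h := ler_dist_dist (frac s - c) (frac t - c).
  rewrite (_ : frac s - c - (frac t - c) = frac s - frac t) in h; last by ring.
  move: h; rewrite !ler_norml => /andP[h1 h2].
  set x := `|frac s - c| in h1 h2 *; set y := `|frac t - c| in h1 h2 *.
  by case: (leP 0 (v - x)) => hx; case: (leP 0 (v - y)) => hy; apply/andP; split; lra.
have fl : (Num.floor s)%:~R + 1 <= (Num.floor t)%:~R :> R.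
  by rewrite -(intrD _ _ 1) ler_int; lia.
have := tent_le_onem s; have := tent_le_frac t.
have := tent_ge0 s; have := tent_ge0 t.
have := frac_itv s; have := frac_itv t; rewrite /frac ler_norml; lra.
Qed.

End Bump.

Lemma natr_close (R : realType) (m n : nat) :
  m%:R < n%:R + 1 :> R -> n%:R < m%:R + 1 :> R -> m = n.
Proof. by rewrite !natr1 !ltr_nat !ltnS => mn nm; apply/eqP; rewrite eqn_leq mn nm. Qed.

Section Coding.
Context (R : realType) (b k0 : nat).
Hypotheses (b2 : (2 <= b)%N) (k3 : (3 <= k0)%N).
Local Notation bR := (b%:R : R).

Definition cell n := (n + k0)%N.
Definition bw n := (cell n ^ 2)%N.
Notation N := (start bw).

Lemma cell_ge n : (k0 <= cell n)%N. Proof. exact: leq_addl. Qed.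
Lemma cell_gt2 n : (2 < cell n)%N.
Proof. exact: leq_trans k3 (cell_ge n). Qed.

(** This sets the horizon of marker [m]: before block [m + k0 - 1], consecutive forced ones are
    closer than the run of zeros that the marker detects. *)
Lemma cell_lt2 m n : (n < (m + k0).-1)%N -> (cell n <= (2 * cell m).-2)%N.
Proof. rewrite /cell; lia. Qed.

Lemma cell_lt m n : (n < m)%N -> ((2 * cell n).+2 <= 2 * cell m)%N.
Proof. rewrite /cell; lia. Qed.

Lemma cell2_lt_bw n : (2 * cell n < bw n)%N.
Proof. by rewrite /bw expnS expn1 ltn_mul2r (cell_gt2 n) andbT; have := cell_gt2 n; lia. Qed.

Lemma bw_gt0 n : (0 < bw n)%N.
Proof. by rewrite expn_gt0 /cell addn_gt0 (leq_trans _ k3)// orbT. Qed.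

(* Block [n] fills the positions [start bw n + o] with [o < bw n]. Its forced
   digits are 1 at [o = 0], 0 for [0 < o < 2 * cell n], and 1 at the later
   multiples of [cell n]; hence a run of [2 * cell n - 1] zeros marks the block. *)
Definition free i := let: (n, o) := loc bw i in (2 * cell n <= o)%N && ~~ (cell n %| o)%N.

(** The expansion ends with a 1 at [N n], the start of an otherwise empty block [n]; statements
    about block starts thus also hold at the last one. *)
Definition digit (w : nat -> nat) n i : nat :=
  if (i <= N n)%N then
    if free i then w i else ((loc bw i).2 == 0%N) || (2 * cell (loc bw i).1 <= (loc bw i).2)%N
  else 0%N.

(* The tent is supported where the expansion reads 1 followed by about
   [2 * cell m] zeros but not many more, i.e. at the start of block [m]. *)
Definition bmark m : R := bR ^- (2 * cell m).+1.
Definition marker m : R -> R := tent (bmark m) (bR^-1 + 2 * bmark m).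

Let b0 : 0 < bR. Proof. exact: b_gt0. Qed.
Let b1 : 1 < bR. Proof. exact: b_gt1. Qed.

Lemma expr_inv_le i j : (i <= j)%N -> bR ^- j <= bR ^- i.
Proof. by move=> ij; rewrite lef_pV2 ?posrE ?exprn_gt0// ler_eXn2l. Qed.

Lemma bmark_gt0 m : 0 < bmark m. Proof. by rewrite invr_gt0 exprn_gt0. Qed.

Lemma bmark_sq m : 3 * bmark m <= bR ^- (2 * cell m).-1.
Proof.
have e : (2 * cell m).+1 = ((2 * cell m).-1 + 2)%N.
  by have := cell_ge m; lia.
rewrite /bmark e exprD invfM mulrCA -[leRHS]mulr1 ler_pM2l ?invr_gt0 ?exprn_gt0//.
rewrite ler_pdivrMr ?exprn_gt0// mul1r.
have : 2 <= bR by rewrite ler_nat.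
rewrite expr2; nra.
Qed.

Lemma bmark_le m : bR^-1 + 3 * bmark m <= 2 / bR.
Proof.
have h := @expr_inv_le 1 (2 * cell m).-1 ltac:(by have := cell_ge m; lia).
rewrite expr1 in h; have := bmark_sq m; lra.
Qed.

Let two_b : 2 / bR <= 1.
Proof. by rewrite ler_pdivrMr// mul1r ler_nat. Qed.

Lemma marker_ok m : [/\ 0 <= bmark m, bmark m <= bR^-1 + 2 * bmark m
  & bR^-1 + 2 * bmark m + bmark m <= 1].
Proof.
have h := bmark_le m; have h0 := bmark_gt0 m; have hi : 0 < bR^-1 by rewrite invr_gt0.
by move: two_b => h2; split; lra.
Qed.

Lemma marker0 m t : 0 <= t < 1 ->
  t <= bR^-1 + bmark m \/ bR^-1 + 3 * bmark m <= t -> marker m t = 0.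
Proof.
move=> t01 h; rewrite /marker tent_frac//; apply/max_idPl.
rewrite subr_le0; case: h => h.
  by rewrite distrC; apply: le_trans (ler_norm _); lra.
by apply: le_trans (ler_norm _); lra.
Qed.

Section Stage.
Variables (w : nat -> nat) (n : nat).
Hypothesis w_lt : forall i, (w i < b)%N.
Notation d := (digit w n).
Notation L := (N n).+1.
Notation tau := (dtail R b d L).

Lemma digit_lt i : (d i < b)%N.
Proof.
rewrite /digit; case: ifP => _; last by apply: leq_trans b2.
case: ifP => _ //; case: (_ || _) => //; exact: ltnW.
Qed.

Lemma digit_end i : (L <= i)%N -> d i = 0%N.
Proof. by rewrite /digit ltnNge => /negbTE ->. Qed.

Lemma digit_block n' o : (n' < n)%N -> (o < bw n')%N ->
  ((o == 0)%N || [&& (2 * cell n' <= o)%N & (cell n' %| o)%N]) -> d (N n' + o) = 1%N.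
Proof.
move=> n'n ho h; rewrite /digit /free (loc_start bw_gt0 ho) /=.
have -> : (N n' + o <= N n)%N by have := start_lt bw n'n; lia.
case/orP: h => [/eqP ->|/andP[h1 h2]]; last by rewrite h1 h2 /= orbT.
by have -> : (2 * cell n' <= 0)%N = false by have := cell_ge n'; lia.
Qed.

Lemma digit_start n' : (n' <= n)%N -> d (N n') = 1%N.
Proof.
rewrite leq_eqVlt => /orP[/eqP ->|h]; last first.
  by rewrite -[N n']addn0 digit_block// bw_gt0.
have e : loc bw (N n) = (n, 0%N) by rewrite -[N n]addn0 (loc_start bw_gt0 (bw_gt0 n)).
rewrite /digit leqnn /free e /=.
by have -> : (2 * cell n <= 0)%N = false by have := cell_ge n; lia.
Qed.

Lemma digit_gap n' j : (n' < n)%N -> (0 < j < 2 * cell n')%N -> d (N n' + j) = 0%N.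
Proof.
move=> n'n /andP[j0 j2].
have hj : (j < bw n')%N by exact: ltn_trans j2 (cell2_lt_bw n').
rewrite /digit /free (loc_start bw_gt0 hj) /=.
have -> : (2 * cell n' <= j)%N = false by lia.
by case: ifP => // _; case: j j0 {j2 hj}.
Qed.

Let tau01 i : 0 <= tau i < 1.
Proof. by rewrite dtail_ge0// dtail_lt1//; exact: digit_lt. Qed.

Let tau_rec i : tau i = ((d i)%:R + tau i.+1) / bR.
Proof. by apply: dtail_rec => //; exact: digit_end. Qed.

(* A block start is seen at distance [2 * cell n'] from itself; any other
   position carrying the digit 1 is followed by another 1 within [cell n']. *)
Lemma marker_off m i : (i < N (m + k0).-1)%N -> i != N m -> marker m (tau i) = 0.
Proof.
move=> iN im; apply: marker0; first exact: tau01.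
have h0 := bmark_gt0 m; have hm := bmark_le m; have hsq := bmark_sq m.
have /andP[u0 u1] := tau01 i.+1.
have hi : 0 < bR^-1 by rewrite invr_gt0.
have [Ni|iNn] := leqP L i.
  by left; rewrite dtail_end// ?addr_ge0 ?ltW//; exact: digit_end.
have [->|iNn'] := eqVneq i (N n).
  left; rewrite tau_rec digit_start// dtail_end ?addr0 ?mul1r ?lerDl ?ltW//.
  exact: digit_end.
have hlt : (i < N n)%N by rewrite ltn_neqAle iNn' -ltnS.
have := locK bw_gt0 i; have := loc_lt bw_gt0 i.
have := loc1_lt bw_gt0 hlt; have := loc1_lt bw_gt0 iN.
case: (loc bw i) => n' o /= n'm n'n ho e.
have ub1 j : (0 < d (i.+1 + j))%N -> (j.+1 < (2 * cell m).-1)%N -> d i = 1%N ->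
    bR^-1 + 3 * bmark m <= tau i.
  move=> hd hj d1; rewrite tau_rec d1 [leRHS]mulrDl mul1r lerD2l.
  apply: (le_trans hsq); apply: (@le_trans _ _ (bR ^- j.+2)); first exact: expr_inv_le.
  rewrite exprSr invfM ler_pM2r ?invr_gt0//.
  by apply: dtail_ge => //; exact: digit_end.
have d0le : d i = 0%N -> tau i <= bR^-1 + bmark m.
  move=> d0; rewrite tau_rec d0 add0r -[X in _ <= X + _]mul1r; apply: ler_wpDr; first exact: ltW.
  by rewrite ler_pM2r// ltW.
have c3 := cell_gt2 n'.
have cp : (0 < 2 * cell n')%N by rewrite muln_gt0 /= (ltn_trans _ c3).
have [ez|ep] := posnP o.
  subst o; rewrite addn0 in e.
  have d1 : d i = 1%N by rewrite -e digit_start// ltnW.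
  (* The start of an earlier block shows its second 1 too soon, putting the value right of the tent;
     a later block has a longer run of zeros, putting it left. *)
  have [n'm'|n'm'|n'm'] := ltngtP n' m; last by rewrite -e n'm' eqxx in im.
    right; apply: (@ub1 (2 * cell n').-1) => //.
      rewrite addSnnS prednK// -e digit_block//; first exact: cell2_lt_bw.
      by rewrite leqnn dvdn_mull// orbT.
    by move: (cell_lt n'm') cp; clear; lia.
  left; rewrite tau_rec d1 mulrDl mul1r lerD2l.
  rewrite (@dtail_zeros _ _ _ _ digit_end i.+1 (2 * cell n').-1); last first.
    by move=> j hj; rewrite addSnnS -e digit_gap//=; move: hj cp; clear; lia.
  rewrite -mulrA -invfM -exprSr prednK//.
  apply: (@le_trans _ _ (bR ^- (2 * cell n'))).
    by rewrite ler_piMl ?invr_ge0 ?exprn_ge0 ?(ltW b0)// ltW//; case/andP: (tau01 (i.+1 + (2 * cell n').-1)).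
  by apply: expr_inv_le; apply: ltnW; exact: cell_lt.
have [e2|e2] := ltnP o (2 * cell n').
  by left; apply: d0le; rewrite -e digit_gap// ep.
case d01: (d i) => [|[|di]]; first by left; exact: d0le.
- right; pose j := (cell n' - o %% cell n')%N.
  have hmod : (o %% cell n' < cell n')%N by rewrite ltn_mod (ltn_trans _ c3).
  have j0 : (0 < j)%N by rewrite subn_gt0.
  have jn : (j <= cell n')%N by exact: leq_subr.
  have oj : (cell n' %| o + j)%N.
    rewrite /dvdn -modnDml subnKC ?modnn//; exact: ltnW.
  apply: (@ub1 j.-1) => //; last by move: (cell_lt2 n'm) j0 jn c3; clear; lia.
  rewrite addSnnS prednK// -e -addnA.
  have [oj2|oj2] := ltnP (o + j) (bw n').
    by rewrite digit_block// oj (leq_trans e2) ?leq_addr ?orbT.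
  (* The width is a multiple of the cell, so the next multiple of the cell is at worst the start of
     the next block, which also carries a 1. *)
  have -> : (o + j = bw n')%N.
    apply/eqP; rewrite eqn_leq oj2 andbT.
    have /dvdnP[r er] := oj; rewrite er /bw expnS expn1 leq_mul2r.
    have : (o < cell n' * cell n')%N by move: ho; rewrite /bw expnS expn1.
    have : (r * cell n' <= o + cell n')%N by rewrite -er leq_add2l.
    move=> h1 h2; apply/orP; right.
    have : (r * cell n' < cell n' * cell n' + cell n')%N by move: h1 h2; clear; lia.
    by rewrite -mulSnr ltn_mul2r ltnS => /andP[].
  by rewrite -startS digit_start.
- right; rewrite tau_rec d01 [in leRHS]mulrDl; apply: (le_trans hm).
  apply: ler_wpDr; first by rewrite divr_ge0// ltW.
  by rewrite ler_pM2r ?invr_gt0// ler_nat.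
Qed.

(** The 1 forced at offset [2 * cell m] places the value between [bmark] and [2 * bmark] above
    [1 / b]. There the tent is affine of slope 1 and preserves differences. *)
Lemma marker_on m : (m < n)%N -> marker m (tau (N m)) = tau (N m) - bR^-1 - bmark m.
Proof.
move=> mn; have h0 := bmark_gt0 m.
have c3 := cell_ge m.
have e : tau (N m) = bR^-1 + tau (N m + 2 * cell m) / bR ^+ (2 * cell m).
  rewrite tau_rec digit_start ?(ltnW mn)// mulrDl mul1r; congr (_ + _).
  rewrite (@dtail_zeros _ _ _ _ digit_end (N m).+1 (2 * cell m).-1); last first.
    by move=> j hj; rewrite addSnnS digit_gap//; lia.
  rewrite addSnnS prednK; last by lia.
  by rewrite -mulrA -invfM -exprSr prednK//; lia.
have d1 : d (N m + 2 * cell m) = 1%N.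
  by rewrite digit_block//; [exact: cell2_lt_bw|rewrite leqnn dvdn_mull// orbT].
set u := tau (N m + 2 * cell m) / bR ^+ (2 * cell m) in e.
have /andP[t0 t1] := tau01 (N m + 2 * cell m).+1.
have [u1 u2] : bmark m <= u /\ u <= 2 * bmark m.
  have uE : u = (1 + tau (N m + 2 * cell m).+1) * bmark m.
    by rewrite /u tau_rec d1 /bmark exprS invfM mulrA.
  rewrite uE; split; first by rewrite ler_peMl ?(ltW h0)// lerDl.
  by rewrite ler_pM2r//; lra.
rewrite /marker tent_frac ?tau01// e.
rewrite (_ : bR^-1 + u - _ = - (2 * bmark m - u)); last by ring.
rewrite normrN ger0_norm ?subr_ge0//.
rewrite (_ : bmark m - _ = u - bmark m); last by ring.
rewrite (_ : bR^-1 + u - _ - _ = u - bmark m); last by ring.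
by apply/max_idPr; rewrite subr_ge0.
Qed.

(** Each block start reads 1 and then 0, which confines the tail to a window of length [1/4]. *)
Lemma tail_start l : (l <= n)%N -> bR^-1 <= tau (N l) <= bR^-1 + 4^-1.
Proof.
move=> ln; rewrite tau_rec digit_start// mulrDl mul1r lerDl.
have /andP[t0 t1] := tau01 (N l).+1.
rewrite divr_ge0 ?(ltW b0)//= lerD2l.
move: ln; rewrite leq_eqVlt => /orP[/eqP ->|ln].
  by rewrite dtail_end ?mul0r//; exact: digit_end.
have c3 := cell_ge l.
rewrite tau_rec -addn1 digit_gap//; last by lia.
rewrite add0r -mulrA -invfM.
have /andP[t0' t1'] := tau01 (N l + 1).+1.
apply: (@le_trans _ _ (bR * bR)^-1).
  by rewrite ler_piMl ?invr_ge0 ?mulr_ge0 ?(ltW b0)// ltW.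
rewrite lef_pV2 ?posrE ?mulr_gt0// -natrM ler_nat.
by rewrite (leq_mul b2 b2).
Qed.

(** The coded points stay in a compact segment inside [[0, 1)], as the compactness argument on
    levels requires. *)
Lemma point_itv : 0 <= tau 0 <= 3 / 4.
Proof.
have := tail_start (leq0n n); rewrite [N 0]/start big_ord0 => /andP[h1 h2].
case/andP: (tau01 0) => -> _ /=; apply: (le_trans h2).
have : bR^-1 <= 2^-1 by rewrite lef_pV2 ?posrE// ler_nat.
lra.
Qed.

End Stage.

(** Carries cannot occur: the tails differ by at most [1/4], so integer heads at distance below
    [1/2 + 1/4] are equal. *)
Lemma separation w w' n l : (forall i, (w i < b)%N) -> (forall i, (w' i < b)%N) ->
  (l <= n)%N ->
  `|dtail R b (digit w n) (N n).+1 0 - dtail R b (digit w' n) (N n).+1 0| < 2^-1 * bR ^- (N l) ->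
  dhead b (digit w n) (N l) = dhead b (digit w' n) (N l).
Proof.
move=> wb wb' ln h.
set x := dtail _ _ _ _ _ in h; set x' := dtail _ _ (digit w' n) _ _ in h.
have bl : 0 < bR ^+ N l by rewrite exprn_gt0.
have e := @dhead_tail R b b2 (digit w n) (N n).+1 (@digit_end w n) (N l).
have e' := @dhead_tail R b b2 (digit w' n) (N n).+1 (@digit_end w' n) (N l).
have /andP[t1 t2] := tail_start wb ln.
have /andP[t1' t2'] := tail_start wb' ln.
have : `|bR ^+ N l * (x - x')| < 2^-1.
  by rewrite normrM gtr0_norm// mulrC -ltr_pdivlMr.
rewrite mulrBr /x /x' e e' ltr_norml => /andP[h1 h2].
set H := dhead _ _ _ in h1 h2 *; set H' := dhead _ _ _ in h1 h2 *.
have d1 : H%:R < H'%:R + 1 :> R by move: h1 h2 t1 t2 t1' t2'; clear; lra.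
have d2 : H'%:R < H%:R + 1 :> R by move: h1 h2 t1 t2 t1' t2'; clear; lra.
exact: natr_close d1 d2.
Qed.

End Coding.

(** * Small ball estimates *)

Section BitAverages.
Context {R : realType}.
Implicit Types (a : nat -> R) (s : seq R) (F : R -> R) (c : R).

Definition nbit (K p i : nat) : bool := odd (p %/ 2 ^ (K - i.+1)).

(** The mean of [F] at [c] plus the sum of a uniformly random subfamily of [s]. *)
Fixpoint avg s F c : R :=
  if s is x :: s' then (avg s' F c + avg s' F (c + x)) / 2 else F c.

Lemma avg_mid s F x c :
  avg s (fun c => (F c + F (c + x)) / 2) c = (avg s F c + avg s F (c + x)) / 2.
Proof.
elim: s c => //= z s ih c; rewrite !ih.
by rewrite (addrAC c z x); field.
Qed.

Lemma avg_rcons s F x c :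
  avg (rcons s x) F c = avg s (fun c => (F c + F (c + x)) / 2) c.
Proof. by elim: s c => //= z s ih c; rewrite !ih. Qed.

(* The averaging operators commute and contract the sup norm, so conditioning
   on a subfamily of the bits can only increase the sup. *)
Lemma avg_subseq s' s F (M : R) : subseq s' s ->
  (forall c, avg s' F c <= M) -> forall c, avg s F c <= M.
Proof.
elim: s s' F => [|x s ih] [|x' s'] F //=.
- move=> _ h c; have h2 := ih [::] F (sub0seq _) h.
  by rewrite ler_pdivrMr// mulr_natr mulr2n lerD.
- case: eqVneq => [-> ss h c|_ ss h c]; last first.
    have h2 := ih _ F ss h.
    by rewrite ler_pdivrMr// mulr_natr mulr2n lerD.
  by rewrite -avg_mid; apply: ih ss _ _ => c'; rewrite avg_mid.
Qed.

Lemma sum_pairs (G : nat -> R) n :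
  \sum_(p < 2 * n) G p = \sum_(p < n) (G (2 * p)%N + G (2 * p).+1).
Proof.
elim: n => [|n ih]; first by rewrite muln0 !big_ord0.
by rewrite mulnS !big_ord_recr /= -ih mul2n -addrA.
Qed.

Lemma nbit_double K p (e : bool) i : (i < K)%N ->
  nbit K.+1 (2 * p + e) i = nbit K p i.
Proof.
move=> iK; rewrite /nbit; congr odd.
have -> : (K.+1 - i.+1 = (K - i.+1).+1)%N by rewrite subSS subnSK.
rewrite expnS divnMA; congr divn.
by case: e; rewrite ?addn0 ?addn1; lia.
Qed.

Lemma nbit_last K p (e : bool) : nbit K.+1 (2 * p + e) K = e.
Proof. by rewrite /nbit subnn expn0 divn1 oddD mul2n odd_double; case: e. Qed.

Lemma sum_nbit K a F c :
  \sum_(p < 2 ^ K) F (c + \sum_(i < K) (nbit K p i)%:R * a i) =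
  2 ^+ K * avg (mkseq a K) F c.
Proof.
elim: K F => [|K ih] F; first by rewrite expn0 big_ord1 big_ord0 addr0 expr0 mul1r.
rewrite mkseqS avg_rcons exprSr -mulrA [2 * _]mulrC mulrA -ih mulr_suml expnS.
rewrite (sum_pairs (fun p => F (c + \sum_(i < K.+1) (nbit K.+1 p i)%:R * a i))).
apply: eq_bigr => p _.
have h (e : bool) : \sum_(i < K.+1) (nbit K.+1 (2 * p + e) i)%:R * a i =
    \sum_(i < K) (nbit K p i)%:R * a i + e%:R * a K.
  rewrite big_ord_recr /= nbit_last; congr (_ + _).
  by apply: eq_bigr => i _; rewrite nbit_double.
have := h false; rewrite addn0 mul0r addr0 => ->.
have := h true; rewrite addn1 mul1r => ->.
by rewrite addrA divfK.
Qed.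

Lemma sum_nbit_geometric K p : (p < 2 ^ K)%N ->
  \sum_(i < K) (nbit K p i)%:R * (2^-1 : R) ^+ i.+1 = p%:R / 2 ^+ K.
Proof.
elim: K p => [|K ih] p; first by rewrite expn0 ltnS leqn0 big_ord0 => /eqP ->; rewrite mul0r.
move=> hp; have pE : p = (2 * (p./2) + odd p)%N by rewrite mul2n addnC odd_double_half.
have hp2 : (p./2 < 2 ^ K)%N.
  by rewrite -(@ltn_pmul2l 2)// -expnS; apply: leq_ltn_trans hp; rewrite [leqRHS]pE leq_addr.
rewrite big_ord_recr /= {2}pE nbit_last {1}pE.
rewrite [X in X + _](_ : _ = \sum_(i < K) (nbit K p./2 i)%:R * (2^-1 : R) ^+ i.+1); last first.
  by apply: eq_bigr => i _; rewrite nbit_double.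
rewrite ih// [in RHS]pE natrD natrM exprVn exprS; field.
by rewrite expf_neq0.
Qed.

Lemma sum_nat_window (P : nat -> bool) n p0 t :
  (forall p, P p -> (p0 <= p < p0 + t)%N) -> (\sum_(p < n) P p <= t)%N.
Proof.
move=> h; rewrite -(big_mkord xpredT (fun p => nat_of_bool (P p))).
have -> : (\sum_(0 <= p < n) P p = \sum_(0 <= p < n | P p) 1)%N.
  by rewrite [RHS]big_mkcond; apply: eq_bigr => p _; case: (P p).
rewrite sum1_count -size_filter -[t in leqRHS](size_iota p0).
apply: uniq_leq_size; first by rewrite filter_uniq// iota_uniq.
by move=> p; rewrite mem_filter mem_iota => /andP[/h].
Qed.

Lemma count_progression (c x rho : R) n : x != 0 -> 0 <= rho ->
  \sum_(p < n) (`|c + x * p%:R| <= rho)%R%:R <= 2 * rho / `|x| + 1.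
Proof.
move=> x0 r0; pose P (p : nat) := `|c + x * p%:R| <= rho.
have nx : 0 < `|x| by rewrite normr_gt0.
have B0 : 0 <= 2 * rho / `|x| by rewrite divr_ge0// mulr_ge0.
have [ex|nex] := pselect (exists p, P p); last first.
  rewrite big1 ?addr_ge0// => p _.
  have /negbTE -> // : ~~ (`|c + x * p%:R| <= rho).
  by apply/negP => h; apply: nex; exists p.
have [p0 P0 pmin] := ex_minnP ex.
pose t := Num.trunc (2 * rho / `|x|).
have /andP[t1 t2] := truncn_itv B0.
have near p : P p -> (p < p0 + t.+1)%N.
  move=> Pp; have pp := pmin p Pp; rewrite -ltn_subLR//.
  rewrite -(ltr_nat R) natrB//; apply: le_lt_trans t2.
  rewrite ler_pdivlMr//.
  have -> : (p%:R - p0%:R) * `|x| = `|(c + x * p%:R) - (c + x * p0%:R)|.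
    rewrite -(@ger0_norm _ (p%:R - p0%:R)) ?subr_ge0 ?ler_nat//.
    by rewrite -normrM; congr `|_|; ring.
  by apply: (le_trans (ler_normB _ _)); rewrite mulr_natl mulr2n lerD.
have Pp0 p : P p -> (p0 <= p)%N by exact: pmin.
apply: (@le_trans _ _ t.+1%:R); last by rewrite -natr1 lerD2r.
rewrite -natr_sum ler_nat; apply: (@sum_nat_window P n p0) => p Pp.
by rewrite pmin// near.
Qed.

(** The subset sums form an arithmetic progression of step [x / 2 ^ J], so the average counts its
    terms in a window; [2 ^ - J] is the discretization error. *)
Lemma avg_geometric (x rho c : R) J : x != 0 -> 0 <= rho ->
  avg (mkseq (fun j => x * 2^-1 ^+ j.+1) J) (fun z => (`|z| <= rho)%R%:R) c <=
  2 * rho / `|x| + 2^-1 ^+ J.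
Proof.
move=> x0 r0; have p2 : 0 < 2 ^+ J :> R by rewrite exprn_gt0.
have nx : 0 < `|x| by rewrite normr_gt0.
rewrite -(ler_pM2l p2) -sum_nbit.
under eq_bigr => p _.
  have -> : \sum_(i < J) (nbit J p i)%:R * (x * 2^-1 ^+ i.+1) = x / 2 ^+ J * p%:R.
    under eq_bigr do rewrite mulrCA.
    by rewrite -mulr_sumr sum_nbit_geometric// mulrAC mulrA.
  over.
have x1 : x / 2 ^+ J != 0 by rewrite mulf_neq0// invr_eq0 lt0r_neq0.
apply: (le_trans (count_progression _ _ x1 r0)).
rewrite normrM normfV (ger0_norm (ltW p2)) exprVn.
rewrite le_eqVlt; apply/orP; left; apply/eqP; field.
by rewrite !lt0r_neq0.
Qed.

End BitAverages.

Section Diagonal.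
Context {R : realType}.

(** Every marker index [m] must recur with a geometric sequence of weights inside a single series:
    it appears once in each row [D >= m], at index [st D + m]. *)
Definition diag i : nat * nat := loc S i.
Local Notation st := (start S).

Lemma diag_start D m : (m <= D)%N -> diag (st D + m) = (D, m).
Proof. by move=> mD; rewrite /diag loc_start. Qed.

(* With [diag i = (D, m)], [m <= D], the weight is [2 ^ - (D + m)], and [dtailw i]
   is the sum of the weights from [i] on, with all rows made infinite. *)
Definition dweight i : R := 2^-1 ^+ ((diag i).1 + (diag i).2).
Definition dtailw i : R := 2^-1 ^+ (diag i).1 * (2 * 2^-1 ^+ (diag i).2 + 2).

Lemma dtailw_ge0 i : 0 <= dtailw i.
Proof. by rewrite /dtailw mulr_ge0 ?addr_ge0 ?mulr_ge0 ?exprn_ge0. Qed.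

(** Equality holds inside a row; at the end of a row the omitted infinite remainder gives slack. *)
Lemma dweight_le i : dweight i <= dtailw i - dtailw i.+1.
Proof.
rewrite /dweight /dtailw /diag /=; case: (loc S i) => D m /=.
have hD : 0 < (2^-1 : R) ^+ D by rewrite exprn_gt0.
have hm : 0 < (2^-1 : R) ^+ m by rewrite exprn_gt0.
rewrite exprD; case: ifP => _ /=; rewrite ?exprS ?expr0; nra.
Qed.

Lemma dtailw_start D : dtailw (st D) = 4 * 2^-1 ^+ D.
Proof.
have e : diag (st D) = (D, 0%N) by rewrite -[st D]addn0 diag_start.
by rewrite /dtailw e expr0 /=; ring.
Qed.

Lemma dtailw_cvg0 (e : R) : 0 < e -> exists n, dtailw n < e.
Proof.
move=> e0.
have [J h] := @expr_lt_eps R 2^-1 (e / 4) ltac:(by rewrite invr_ge0 ler0n invf_lt1 ?ltr1n) (divr_gt0 e0 (ltr0n _ 4)).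
exists (st J); rewrite dtailw_start mulrC -ltr_pdivlMr//; exact: h.
Qed.

Lemma subseq_diag m J : subseq [seq (st (m + j) + m)%N | j <- iota 0 J] (iota 0 (st (m + J))).
Proof.
elim: J => [|J ih]; first by rewrite sub0seq.
rewrite -addn1 iotaD add0n map_cat addn1 addnS startS iotaD add0n.
rewrite (_ : [seq _ | j <- iota J 1] = [:: (st (m + J) + m)%N])//.
apply: cat_subseq => //; rewrite sub1seq mem_iota; lia.
Qed.

Lemma avg_diag (a : nat -> R) (x rho c : R) m D : (m <= D)%N -> x != 0 -> 0 <= rho ->
  (forall j, a (st (m + j) + m)%N = x * 2^-1 ^+ j.+1) ->
  avg (mkseq a (st D)) (fun z => (`|z| <= rho)%R%:R) c <=
  2 * rho / `|x| + 2^-1 ^+ (D - m).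
Proof.
move=> mD x0 r0 ha; set J := (D - m)%N.
apply: (@avg_subseq _ (mkseq (fun j => x * 2^-1 ^+ j.+1) J)); last first.
  by move=> c'; exact: avg_geometric.
have -> : mkseq (fun j => x * 2^-1 ^+ j.+1) J =
    map a [seq (st (m + j) + m)%N | j <- iota 0 J].
  by rewrite -map_comp; apply: eq_map => j /=; rewrite ha.
rewrite /mkseq; apply: map_subseq.
by rewrite -(subnKC mD) -/J; exact: subseq_diag.
Qed.

End Diagonal.

(** * Separation by markers *)

Section MarkerFunctions.
Context (R : realType) (b k0 : nat) (alpha : R).
Hypotheses (b2 : (2 <= b)%N) (a01 : 0 < alpha < 1) (k3 : (3 <= k0)%N).
Local Notation q := (wratio b alpha).
Local Notation bR := (b%:R : R).
Hypothesis kq : q ^+ k0.-1 * bR <= 1.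
Hypothesis kv : 8 <= bR ^+ k0 * (1 - q).

Local Notation N := (start (bw k0)).
Local Notation d := (digit k0).
Local Notation Wf := (weierstrass alpha b).

Let b0 : 0 < bR. Proof. exact: b_gt0. Qed.
Let q0 : 0 < q. Proof. exact: wratio_gt0. Qed.
Let q1 : 0 < 1 - q. Proof. exact: onem_wratio_gt0. Qed.

Definition point (w : nat -> nat) n : R := dtail R b (d w n) (N n).+1 0.

Lemma marker_norm m t : `|marker b k0 m t| <= bmark R b k0 m.
Proof. by rewrite ger0_norm ?tent_ge0// tent_le// ltW// bmark_gt0. Qed.

Lemma start_addn m j : (N m + j * bw k0 m <= N (m + j))%N.
Proof.
elim: j => [|j ih]; first by rewrite mul0n !addn0.
rewrite addnS startS mulSn.
have : (bw k0 m <= bw k0 (m + j))%N by rewrite /bw leq_exp2r// /cell; lia.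
lia.
Qed.

Lemma start_marker m : (N m + k0.-1 * bw k0 m <= N (m + k0).-1)%N.
Proof.
have -> : ((m + k0).-1 = m + k0.-1)%N by move: k3; clear; lia.
exact: start_addn.
Qed.

Lemma wterm_point g (w : nat -> nat) n i : (forall t, g (t + 1) = g t) ->
  wterm b alpha g (point w n) i = q ^+ i * g (dtail R b (d w n) (N n).+1 i).
Proof.
move=> gp; rewrite /wterm /point (@dhead_tail _ _ b2); last exact: digit_end.
by rewrite addrC periodic_nat.
Qed.

Lemma weierstrass_marker (w : nat -> nat) n m : (forall i, (w i < b)%N) -> (m < n)%N ->
  `|Wf (marker b k0 m) (point w n) -
    q ^+ N m * (dtail R b (d w n) (N n).+1 (N m) - bR^-1 - bmark R b k0 m)| <=
  wtail b alpha (bmark R b k0 m) (N (m + k0).-1).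
Proof.
move=> wb mn; set K := N (m + k0).-1.
have mK : (N m < K)%N.
  apply: leq_trans (start_marker m).
  have : (0 < k0.-1 * bw k0 m)%N by rewrite muln_gt0 (bw_gt0 k3) andbT; move: k3; clear; lia.
  by clear; lia.
have mp t : marker b k0 m (t + 1) = marker b k0 m t by exact: tent_periodic.
have -> : q ^+ N m * (dtail R b (d w n) (N n).+1 (N m) - bR^-1 - bmark R b k0 m) =
    series (wterm b alpha (marker b k0 m) (point w n)) K.
  rewrite /series /= big_mkord (bigD1 (Ordinal mK))//= big1 ?addr0.
    by rewrite wterm_point// marker_on.
  move=> i; rewrite -val_eqE /= => im.
  by rewrite wterm_point// marker_off ?mulr0.
exact: weierstrass_tail (marker_norm m).
Qed.

Lemma bmark_le_pow m : bmark R b k0 m <= bR ^- k0.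
Proof. by apply: expr_inv_le => //; rewrite /cell; move: k3; clear; lia. Qed.

(** Beyond the horizon at least [(k0 - 1) * bw m] further factors [q] are available; [kq] turns them
    into [b ^ - bw m], and [kv] supplies the constant [1/8]. *)
Lemma marker_tail_le m :
  wtail b alpha (bmark R b k0 m) (N (m + k0).-1) <= 8^-1 * (q ^+ N m / bR ^+ bw k0 m).
Proof.
have [j e] : exists j, (N (m + k0).-1 = N m + k0.-1 * bw k0 m + j)%N.
  by exists (N (m + k0).-1 - (N m + k0.-1 * bw k0 m))%N; rewrite subnKC// start_marker.
have -> : wtail b alpha (bmark R b k0 m) (N (m + k0).-1) =
  bmark R b k0 m / (1 - q) * (q ^+ N m * ((q ^+ k0.-1) ^+ bw k0 m * q ^+ j)).
  by rewrite /wtail e !exprD exprM; field; rewrite lt0r_neq0.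
have h1 : bmark R b k0 m / (1 - q) <= 8^-1.
  rewrite ler_pdivrMr//; apply: (le_trans (bmark_le_pow m)).
  by rewrite -div1r ler_pdivrMr ?exprn_gt0// -mulrA ler_pdivlMl// mulr1 mulrC.
have h2 : (q ^+ k0.-1) ^+ bw k0 m <= (bR ^+ bw k0 m)^-1.
  rewrite -div1r ler_pdivlMr ?exprn_gt0// -exprMn.
  by apply: exprn_ile1 => //; rewrite mulr_ge0 ?exprn_ge0 ?(ltW q0) ?(ltW b0).
have h3 : q ^+ j <= 1 by apply: exprn_ile1; rewrite ?(ltW q0)//; move: q1; lra.
have qn i : 0 <= q ^+ i by rewrite exprn_ge0// ltW.
apply: ler_pM => //.
- by rewrite divr_ge0 ?(ltW q1)// ltW// bmark_gt0.
- by rewrite !mulr_ge0// exprn_ge0.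
rewrite ler_wpM2l//; apply: le_trans h2.
by rewrite ler_piMr// exprn_ge0.
Qed.

(** The factor [1/4] is the [1/2] of [separation] minus a tail of [1/8] for each of the two
    points. *)
Definition msep m : R := 4^-1 * (q ^+ N m / bR ^+ bw k0 m).

Lemma msep_gt0 m : 0 < msep m.
Proof. by rewrite mulr_gt0 ?invr_gt0// divr_gt0 ?exprn_gt0. Qed.

Lemma msep_le1 m : msep m <= 1.
Proof.
have h1 : q ^+ N m <= 1 by apply: exprn_ile1; rewrite ?(ltW q0)//; move: q1; lra.
have h2 : (bR ^+ bw k0 m)^-1 <= 1.
  by rewrite invf_le1 ?exprn_gt0// exprn_ege1// ler1n; apply: ltnW.
have h3 : q ^+ N m / bR ^+ bw k0 m <= 1.
  by rewrite -[leRHS]mulr1; apply: ler_pM; rewrite ?invr_ge0 ?exprn_ge0 ?(ltW q0) ?(ltW b0).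
by rewrite /msep; lra.
Qed.

(** With equal heads up to block [m], the shifted tails differ by [b ^ N m] times the distance of
    the points, which [separation] bounds below at [m.+1]. *)
Lemma marker_separates (w w' : nat -> nat) n m :
  (forall i, (w i < b)%N) -> (forall i, (w' i < b)%N) -> (m < n)%N ->
  dhead b (d w n) (N m) = dhead b (d w' n) (N m) ->
  dhead b (d w n) (N m.+1) <> dhead b (d w' n) (N m.+1) ->
  msep m <= `|Wf (marker b k0 m) (point w n) - Wf (marker b k0 m) (point w' n)|.
Proof.
move=> wb wb' mn e ne.
have h1 := weierstrass_marker wb mn; have h2 := weierstrass_marker wb' mn.
have ht := marker_tail_le m.
have hx : 2^-1 * bR ^- N m.+1 <= `|point w n - point w' n|.
  rewrite leNgt; apply/negP => lt; apply: ne.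
  exact: (@separation R b k0 b2 k3 w w' n m.+1).
have ez := @dhead_tail R b b2 (d w n) (N n).+1 (@digit_end k0 w n) (N m).
have ez' := @dhead_tail R b b2 (d w' n) (N n).+1 (@digit_end k0 w' n) (N m).
set t := dtail _ _ _ _ (N m) in h1 ez; set t' := dtail _ _ _ _ (N m) in h2 ez'.
have tt : bR ^+ N m * (point w n - point w' n) = t - t'.
  by rewrite mulrBr /point ez ez' e; ring.
have bn i : 0 < bR ^+ i by rewrite exprn_gt0.
have ht1 : 2^-1 / bR ^+ bw k0 m <= `|t - t'|.
  rewrite -tt normrM (gtr0_norm (bn _)).
  apply: le_trans (ler_wpM2l (ltW (bn (N m))) hx).
  rewrite startS exprD le_eqVlt; apply/orP; left; apply/eqP; field.
  by rewrite !lt0r_neq0.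
have qn : 0 <= q ^+ N m by rewrite exprn_ge0// ltW.
have ht2 := ler_wpM2l qn ht1.
have : q ^+ N m * `|t - t'| <= `|Wf (marker b k0 m) (point w n) - Wf (marker b k0 m) (point w' n)| +
   (8^-1 * (q ^+ N m / bR ^+ bw k0 m) + 8^-1 * (q ^+ N m / bR ^+ bw k0 m)).
  have -> : q ^+ N m * `|t - t'| = `|q ^+ N m * (t - t')| by rewrite normrM ger0_norm.
  set X := Wf _ _ in h1 *; set Y := Wf _ _ in h2 *.
  have -> : q ^+ N m * (t - t') = (X - Y) - ((X - q ^+ N m * (t - bR^-1 - bmark R b k0 m)) -
    (Y - q ^+ N m * (t' - bR^-1 - bmark R b k0 m))) by ring.
  apply: (le_trans (ler_normB _ _)); rewrite lerD2l.
  apply: (le_trans (ler_normB _ _)); apply: lerD; [exact: le_trans h1 ht|exact: le_trans h2 ht].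
rewrite /msep; set Z := q ^+ N m / bR ^+ bw k0 m in ht ht2 *.
rewrite (_ : q ^+ N m * (2^-1 / bR ^+ bw k0 m) = 2^-1 * Z) in ht2; last by rewrite /Z mulrCA.
move: ht2; lra.
Qed.

End MarkerFunctions.

(** * Counting words with a common prefix *)

Section Words.
Context (b k0 : nat).
Hypotheses (b2 : (2 <= b)%N) (k3 : (3 <= k0)%N).
Local Notation N := (start (bw k0)).

(** Words also carry symbols at forced positions, where [digit] ignores them: every point gets the
    same multiplicity and the number of words is exactly [b ^ N n]. *)
Definition word n := {ffun 'I_(N n) -> 'I_b}.
Definition wdig n (w : word n) (i : nat) : nat :=
  if insub i is Some j then (w j : nat) else 0%N.

Lemma wdig_lt n (w : word n) i : (wdig w i < b)%N.
Proof. by rewrite /wdig; case: insub => [j|]; [exact: ltn_ord|exact: ltnW]. Qed.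

Lemma wdigE n (w : word n) (j : 'I_(N n)) : wdig w j = w j.
Proof. by rewrite /wdig valK. Qed.

Lemma word_gt0 n : (0 < #|word n|)%N.
Proof. by rewrite card_ffun card_ord expn_gt0 (leq_trans _ b2). Qed.

Definition whead n (w : word n) m := dhead b (digit k0 (wdig w) n) (N m).
Definition level n (w w' : word n) : nat := \max_(m < n.+1 | whead w m == whead w' m) m.

Lemma level_le n (w w' : word n) : (level w w' <= n)%N.
Proof. by apply/bigmax_leqP => i _; rewrite -ltnS. Qed.

Lemma level_ge n (w w' : word n) l : (l <= n)%N -> whead w l = whead w' l ->
  (l <= level w w')%N.
Proof.
rewrite -ltnS => ln e; rewrite /level.
by apply: (@leq_bigmax_cond _ (fun m : 'I_n.+1 => whead w m == whead w' m) (fun m => m : nat) (Ordinal ln)); rewrite /= e.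
Qed.

Lemma level_eq n (w w' : word n) : whead w (level w w') = whead w' (level w w').
Proof.
have e0 : whead w (@ord0 n) == whead w' (@ord0 n) by rewrite /whead /start /= big_ord0.
rewrite /level (bigop.bigmax_eq_arg (@ord0 n))//.
by case: arg_maxnP => // i /eqP.
Qed.

Lemma level_neq n (w w' : word n) : (level w w' < n)%N ->
  whead w (level w w').+1 <> whead w' (level w w').+1.
Proof. by move=> ln /(level_ge ln); rewrite ltnn. Qed.

Definition nforced m := (\sum_(i < N m) ~~ free k0 i)%N.

(** A common head determines the free symbols before [N m]; the forced positions before [N m] and
    everything after it remain arbitrary. *)
Lemma card_whead n (w : word n) m : (m <= n)%N ->
  (#|[pred w' : word n | whead w m == whead w' m]| <= b ^ (N n - N m + nforced m))%N.
Proof.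
move=> mn; have NN := start_mono (bw k0) mn.
pose F (i : 'I_(N n)) : pred 'I_b := if (i < N m)%N && free k0 i then pred1 (w i) else predT.
apply: (@leq_trans #|family F|).
  apply: subset_leq_card; apply/fintype.subsetP => w'; rewrite inE => /eqP e.
  apply/familyP => i; rewrite /F; case: ifP => // /andP[im fi].
  have := dhead_inj (@digit_lt b k0 b2 (wdig w) n (wdig_lt w)) (@digit_lt b k0 b2 (wdig w') n (wdig_lt w')) e im.
  rewrite /digit fi ltnW// !wdigE => /val_inj ->.
  by rewrite inE.
rewrite card_family.
have -> : foldr muln 1%N [seq #|F x| | x : 'I_(N n)] = (\prod_(i < N n) #|F i|)%N.
  by rewrite foldrE big_map enumT.
have cF (i : 'I_(N n)) : #|F i| = (b ^ (~~ ((i < N m)%N && free k0 i)))%N.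
  by rewrite /F; case: ifP => _ /=; rewrite ?card1// card_ord expn1.
rewrite (eq_bigr _ (fun i _ => cF i)) -expn_sum leq_exp2l//.
rewrite -(big_mkord xpredT (fun i => nat_of_bool (~~ ((i < N m)%N && free k0 i)))).
rewrite (@big_cat_nat _ _ _ (N m))//= addnC leq_add//.
  apply: (@leq_trans (\sum_(N m <= i < N n) 1)%N); last by rewrite sum_nat_const_nat muln1.
  by apply: leq_sum => i _; case: (~~ _).
rewrite /nforced big_mkord; apply: leq_sum => i _.
by rewrite ltn_ord.
Qed.

Lemma sum_dvdn p n : (0 < p)%N -> (\sum_(o < n * p) (p %| o) = n)%N.
Proof.
move=> p0; rewrite -(big_mkord xpredT (fun o => nat_of_bool (p %| o)%N)).
elim: n => [|n ih]; first by rewrite mul0n big_geq.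
rewrite mulSn addnC (@big_cat_nat _ _ _ (n * p))//= ?leq_addr// ih -addn1; congr addn.
rewrite -{1}[(n * p)%N]add0n big_addn addKn big_mkord.
case: p p0 ih => // p _ _; rewrite big_ord_recl /= add0n dvdn_mull//= big1// => i _.
by rewrite /bump /= dvdn_addl ?dvdn_mull// gtnNdvd//= add1n ltnS ltn_ord.
Qed.

Lemma sum_ltn m n : (\sum_(o < n) (o < m) <= m)%N.
Proof. by apply: (@sum_nat_window (fun o => o < m)%N n 0) => p; rewrite add0n. Qed.

(** A block has at most [2 * cell] forced digits in its opening and [cell] multiples of the cell;
    summing [3 * cell] over blocks gives [3/2 * cell ^ 2]. *)
Lemma nforced_le m : (2 * nforced m <= 3 * cell k0 m ^ 2)%N.
Proof.
elim: m => [|m ih]; first by rewrite /nforced /start !big_ord0 muln0.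
have -> : nforced m.+1 = (nforced m + \sum_(o < bw k0 m) ~~ free k0 (N m + o))%N.
  rewrite /nforced startS -!(big_mkord xpredT (fun i => nat_of_bool (~~ free k0 i))).
  rewrite (@big_cat_nat _ _ _ (N m))//= ?leq_addr//; congr addn.
  rewrite -{1}[N m]add0n big_addn addKn big_mkord.
  by apply: eq_bigr => i _; rewrite addnC.
have h : (\sum_(o < bw k0 m) ~~ free k0 (N m + o) <= 3 * cell k0 m)%N.
  apply: (@leq_trans (\sum_(o < bw k0 m) ((o < 2 * cell k0 m) + (cell k0 m %| o)))%N).
    apply: leq_sum => o _; rewrite /free (loc_start (bw_gt0 k3))//.
    by case: (ltnP o (2 * cell k0 m)); case: (cell k0 m %| o)%N.
  rewrite big_split /=.
  have h1 := sum_ltn (2 * cell k0 m) (bw k0 m).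
  have h2 : (\sum_(o < bw k0 m) (cell k0 m %| o) = cell k0 m)%N.
    by rewrite /bw expnS expn1 sum_dvdn// (ltn_trans _ (cell_gt2 k3 m)).
  by apply: (leq_trans (leq_add h1 (eq_leq h2))); rewrite -mulSnr.
have e : cell k0 m.+1 = (cell k0 m).+1 by rewrite /cell addSn.
by rewrite e; move: ih h; clear; nia.
Qed.

End Words.

(** * Growth of the weights, window radii and gaps *)

Section Exponents.
Context (R : realType) (b k0 : nat) (alpha : R).
Hypotheses (b2 : (2 <= b)%N) (a01 : 0 < alpha < 1) (k3 : (3 <= k0)%N).
Hypothesis kk : 13 <= (1 - alpha) * k0%:R.
Local Notation bR := (b%:R : R).
Local Notation N := (start (bw k0)).
Local Notation p m := ((cell k0 m)%:R : R).

(* [4 * p ^ 2] and [2 * p ^ 2] absorb the losses due to forced digits and to the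
   separation constants; they are negligible against [N m], which is cubic in [m]. *)
Definition kexp m : R := (1 - alpha) * (N m)%:R - 4 * p m ^+ 2.
Definition kap m : R := bR `^ kexp m.
Definition rad m : R := bR `^ (- (alpha * (N m)%:R + 2 * p m ^+ 2)).
Definition gap m : R := 2^-1 * bR ^- N m.

Let b0 : 0 < bR. Proof. exact: b_gt0. Qed.
Let b1 : 1 < bR. Proof. exact: b_gt1. Qed.

Lemma kap_gt0 m : 0 < kap m. Proof. exact: powR_gt0. Qed.
Lemma rad_gt0 m : 0 < rad m. Proof. exact: powR_gt0. Qed.
Lemma gap_gt0 m : 0 < gap m. Proof. by rewrite mulr_gt0 ?invr_gt0 ?exprn_gt0. Qed.

Lemma cellS m : p m.+1 = p m + 1.
Proof. by rewrite natr1 /cell addSn. Qed.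

Lemma startSr m : (N m.+1)%:R = (N m)%:R + p m ^+ 2 :> R.
Proof. by rewrite startS natrD /bw natrX. Qed.

Lemma cell_geR m : k0%:R <= p m. Proof. by rewrite ler_nat cell_ge. Qed.

(** By [kk] the increment [(1 - alpha) p ^ 2 - 4 (2 p + 1)] is at least [13 p - 8 p - 4], hence at
    least 1. *)
Lemma kexpS m : kexp m + 1 <= kexp m.+1.
Proof.
rewrite /kexp startSr cellS.
have h1 := cell_geR m; have h2 : 3 <= p m by apply: le_trans h1; rewrite ler_nat.
have h3 : 13 <= (1 - alpha) * p m.
  by apply: (le_trans kk); rewrite ler_wpM2l//; case/andP: a01; lra.
have : 13 * p m <= (1 - alpha) * p m * p m by rewrite ler_wpM2r//; lra.
rewrite !expr2; move: h2; lra.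
Qed.

Lemma kexp_mono m n : (m <= n)%N -> kexp m <= kexp n.
Proof.
elim: n => [|n ih]; first by rewrite leqn0 => /eqP ->.
rewrite leq_eqVlt => /orP[/eqP -> //|/ih h].
by apply: (le_trans h); have := kexpS n; lra.
Qed.

Lemma kexp_ge m : kexp 0 + m%:R <= kexp m.
Proof. by elim: m => [|m ih]; rewrite ?addr0// -natr1; have := kexpS m; lra. Qed.

Lemma kap_mono : {homo kap : m n / (m <= n)%N >-> m <= n}.
Proof. by move=> m n mn; apply: ler_powR; [exact: ltW|exact: kexp_mono]. Qed.

Lemma expr_unbounded (x A : R) : 1 < x -> exists m : nat, A <= x ^+ m.
Proof.
move=> x1; exists (Num.bound (`|A| / (x - 1))).
have x10 : 0 < x - 1 by rewrite subr_gt0.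
have := @bernoulli_ge R (x - 1) (Num.bound (`|A| / (x - 1))) (ltW x10).
rewrite subrKC; apply: le_trans.
have : `|A| / (x - 1) < (Num.bound (`|A| / (x - 1)))%:R by rewrite archi_boundP// divr_ge0// ltW.
rewrite ltr_pdivrMr// => h; have := ler_norm A; move: h; lra.
Qed.

Lemma kap_infty (A : R) : exists l, A <= kap l.
Proof.
have [m hm] := expr_unbounded (`|A| / bR `^ kexp 0) b1.
exists m; apply: (le_trans (ler_norm A)).
rewrite ler_pdivrMr ?powR_gt0// in hm; apply: (le_trans hm).
rewrite -powR_mulrn ?(ltW b0)// -powRD ?(gt_eqF b0) ?implybT//.
by apply: ler_powR; rewrite ?(ltW b1)// addrC; exact: kexp_ge.
Qed.

Lemma rad_le m : rad m <= bR^-1 ^+ m.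
Proof.
rewrite exprVn -powR_invn ?(ltW b0)//; apply: ler_powR; first exact: ltW.
rewrite lerN2; apply: ler_wpDl; first by rewrite mulr_ge0//; case/andP: a01; lra.
have h : m%:R <= p m by rewrite ler_nat /cell leq_addr.
have h2 : 3 <= p m by apply: le_trans (cell_geR m); rewrite ler_nat.
rewrite expr2; nra.
Qed.

Lemma rad_le1 m : rad m <= 1.
Proof.
apply: (le_trans (rad_le m)); apply: exprn_ile1; rewrite ?invr_ge0 ?(ltW b0)//.
by rewrite invf_le1// ltW.
Qed.

Lemma rad_cvg0 (e : R) : 0 < e -> exists K, forall n, (K <= n)%N -> rad n <= e.
Proof.
move=> e0.
have ib : 0 <= bR^-1 < 1 by rewrite invr_ge0 (ltW b0)/= invf_lt1.
have [K hK] := expr_lt_eps ib e0; exists K => n /hK h.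
exact: le_trans (rad_le n) (ltW h).
Qed.

Lemma eventually_mono_bounded (x : nat -> R) l0 :
  (forall l, (l0 <= l)%N -> x l <= x l.+1) -> exists c, forall l, c <= x l.
Proof.
move=> h.
have [c0 hc0] : exists c, forall l, (l <= l0)%N -> c <= x l.
  elim: (l0) => [|l [c hc]]; first by exists (x 0%N) => l; rewrite leqn0 => /eqP ->.
  exists (Num.min c (x l.+1)) => i; rewrite leq_eqVlt => /orP[/eqP ->|/hc hi].
    by rewrite ge_min lexx orbT.
  by rewrite ge_min hi.
exists c0 => l; have [/hc0//|/ltnW] := leqP l l0.
elim: l => [|l ih]; first by rewrite leqn0 => /eqP e; apply: hc0; rewrite e.
rewrite leq_eqVlt => /orP[/eqP e|ll]; first by apply: hc0; rewrite e.
exact: le_trans (ih ll) (h _ ll).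
Qed.

Lemma kap_gap (s : R) : 0 <= s -> s < 1 - alpha ->
  exists2 c : R, 0 < c & forall l, c <= kap l * gap l.+1 `^ s.
Proof.
move=> s0 s1.
have [a0 a1] : 0 < alpha /\ alpha < 1 by case/andP: a01.
pose x l : R := (1 - alpha - s) * (N l)%:R - (4 + s) * p l ^+ 2.
have eta0 : 0 < 1 - alpha - s by lra.
have [c hc] : exists c, forall l, c <= x l.
  (* The increment of [x] is [(1 - alpha - s) p ^ 2 - (4 + s) (2 p + 1)], and the loss is at most
     [5 (2 p + 1) <= 15 p]. *)
  apply: (@eventually_mono_bounded x (Num.bound (15 / (1 - alpha - s)))) => l hl.
  rewrite /x startSr cellS.
  have h15 : 15 <= (1 - alpha - s) * p l.
    rewrite mulrC -ler_pdivrMr//.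
    apply: (le_trans (ltW (archi_boundP _))); first by rewrite divr_ge0// ltW.
    by rewrite ler_nat (leq_trans hl)// /cell leq_addr.
  have h2 : 3 <= p l by apply: le_trans (cell_geR l); rewrite ler_nat.
  have h3 : 15 * p l <= (1 - alpha - s) * p l * p l by rewrite ler_wpM2r//; lra.
  have h4 : s * (2 * p l + 1) <= 2 * p l + 1 by rewrite ler_piMl//; lra.
  rewrite !expr2; move: h2 h3 h4; nra.
exists (2^-1 * bR `^ c); first by rewrite mulr_gt0 ?invr_gt0 ?powR_gt0.
move=> l.
have -> : gap l.+1 `^ s = 2^-1 `^ s * bR `^ (- (s * (N l.+1)%:R)).
  rewrite /gap powRM ?invr_ge0 ?exprn_ge0 ?(ltW b0)//; congr (_ * _).
  by rewrite -powR_invn ?(ltW b0)// -powRrM mulNr mulrC.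
rewrite mulrCA /kap -powRD ?(gt_eqF b0) ?implybT//.
apply: ler_pM; rewrite ?invr_ge0 ?powR_ge0//.
  by apply: ger1_powR; [rewrite invr_gt0 ltr0n/= invf_le1 ?ler1n|lra].
apply: ler_powR; first exact: ltW.
apply: (le_trans (hc l)); rewrite /x /kexp startSr; lra.
Qed.

End Exponents.

(** * Expected energy *)

Section Cutoff.
Context {R : realType}.

(* A Lipschitz cutoff makes the energy continuous in [g], hence the sets of
   functions it defines open. *)
Definition chi (z : R) : R := Num.max 0 (2 - z).

Lemma chi_ge z : (z < 1)%R%:R <= chi z.
Proof. by rewrite /chi le_max; case: ltP => h /=; apply/orP; [right|left]; lra. Qed.

Lemma chi_le (z : R) : 0 <= z -> chi z <= 2 * (z <= 2)%R%:R.
Proof.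
move=> z0; rewrite /chi ge_max; have [h|h] := leP z 2; rewrite /= ?mulr1 ?mulr0.
  by apply/andP; split; lra.
by rewrite lexx/=; lra.
Qed.

Lemma chi_lipschitz y z : `|chi y - chi z| <= `|y - z|.
Proof.
wlog yz : y z / y <= z.
  move=> h; have [/h//|/ltW/h] := leP y z.
  by rewrite distrC [X in _ <= X]distrC.
rewrite [leRHS]distrC (ger0_norm (_ : 0 <= z - y)) ?subr_ge0// ler_norml /chi.
by case: (leP 0 (2 - y)) => hx; case: (leP 0 (2 - z)) => hy; apply/andP; split; lra.
Qed.

End Cutoff.

Section Energies.
Local Opaque kap rad msep.
Context (R : realType) (b k0 : nat) (alpha : R).
Hypotheses (b2 : (2 <= b)%N) (a01 : 0 < alpha < 1) (k3 : (3 <= k0)%N).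
Local Notation q := (wratio b alpha).
Local Notation bR := (b%:R : R).
Hypothesis kq : q ^+ k0.-1 * bR <= 1.
Hypothesis kv : 8 <= bR ^+ k0 * (1 - q).
Hypothesis kk : 13 <= (1 - alpha) * k0%:R.
Local Notation N := (start (bw k0)).
Local Notation Wf := (weierstrass alpha b).
Local Notation leb := (@lebesgue_measure R).
Local Notation kap := (kap b k0 alpha).
Local Notation rad := (rad b k0 alpha).
Local Notation word := (word b k0).
Local Notation msep := (msep b k0 alpha).

Let b0 : 0 < bR. Proof. exact: b_gt0. Qed.
Let q0 : 0 < q. Proof. exact: wratio_gt0. Qed.
Let q1 : 0 < 1 - q. Proof. exact: onem_wratio_gt0. Qed.
Let r0 n : 0 < rad n. Proof. exact: rad_gt0. Qed.
Let kap0 n : 0 < kap n. Proof. exact: kap_gt0. Qed.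

Definition pts n (w : word n) : R := point R b k0 (wdig w) n.

Definition pair_avg n (G : word n -> word n -> R) : R :=
  (#|word n|%:R ^+ 2)^-1 * \sum_w \sum_w' G w w'.

Lemma pair_avg_le n (G H : word n -> word n -> R) :
  (forall w w', G w w' <= H w w') -> pair_avg G <= pair_avg H.
Proof.
move=> GH; rewrite ler_wpM2l ?invr_ge0 ?exprn_ge0//.
by apply: ler_sum => w _; apply: ler_sum.
Qed.

Lemma pair_avgM n (G : word n -> word n -> R) c :
  pair_avg (fun w w' => G w w' * c) = pair_avg G * c.
Proof.
rewrite /pair_avg -mulrA; congr (_ * _); rewrite mulr_suml.
by apply: eq_bigr => w _; rewrite mulr_suml.
Qed.

Lemma pair_avgD n (G H : word n -> word n -> R) :
  pair_avg (fun w w' => G w w' + H w w') = pair_avg G + pair_avg H.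
Proof.
rewrite /pair_avg -mulrDr -big_split; congr (_ * _).
by apply: eq_bigr => w _; rewrite -big_split.
Qed.

Definition senergy n (f : R -> R) : R :=
  pair_avg (fun w w' => kap (level w w') * chi (`|f (@pts n w) - f (@pts n w')| / rad n) / rad n).

Lemma senergy_dist n (f h : R -> R) (e : R) : (forall x, `|f x - h x| <= e) ->
  senergy n f <= senergy n h +
    @pair_avg n (fun w w' => kap (level w w') * (2 / rad n) / rad n) * e.
Proof.
move=> fh; rewrite -pair_avgM -pair_avgD; apply: pair_avg_le => w w'.
set z := `|f _ - f _| / rad n; set y := `|h _ - h _| / rad n.
have zy : chi z <= chi y + 2 / rad n * e.
  rewrite -lerBlDl; apply: (le_trans (ler_norm _)); apply: (le_trans (chi_lipschitz _ _)).
  rewrite /z /y -mulrBl normrM (gtr0_norm (_ : 0 < (rad n)^-1)) ?invr_gt0//.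
  rewrite mulrAC ler_pM2r ?invr_gt0//; apply: (le_trans (ler_dist_dist _ _)).
  rewrite (_ : _ - _ = (f (pts w) - h (pts w)) - (f (pts w') - h (pts w'))); last by ring.
  by apply: (le_trans (ler_normB _ _)); rewrite mulr_natl mulr2n lerD.
have -> : kap (level w w') * chi y / rad n + kap (level w w') * (2 / rad n) / rad n * e =
  kap (level w w') * (chi y + 2 / rad n * e) / rad n by ring.
by rewrite ler_pM2r ?invr_gt0// ler_pM2l.
Qed.

Lemma senergy_open n (M : R) : lip_open [set g : lipS1 R | senergy n (Wf g) < M].
Proof.
move=> g /= gM.
set C := @pair_avg n (fun w w' => kap (level w w') * (2 / rad n) / rad n).
have C0 : 0 <= C.
  rewrite mulr_ge0 ?invr_ge0 ?exprn_ge0//; apply: sumr_ge0 => w _; apply: sumr_ge0 => w' _.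
  have h1 := kap0 (level w w'); have h2 := r0 n.
  by apply: divr_ge0; [apply: mulr_ge0; [exact: ltW|apply: divr_ge0 => //; exact: ltW]|exact: ltW].
pose e := (M - senergy n (Wf g)) / (C + 1) * (1 - q).
have C1 : 0 < C + 1 by rewrite ltr_wpDl.
have e0 : 0 < e by rewrite mulr_gt0// divr_gt0// subr_gt0.
exists e => // h hg.
have [Mg hMg] := lipS1_bounded g; have [Mh hMh] := lipS1_bounded h.
have gh x : `|Wf h x - Wf g x| <= e / (1 - q).
  rewrite -(@weierstrassB _ _ _ b2 a01 _ _ _ _ x hMh hMg).
  apply: weierstrass_le => // t; apply: (le_trans (lip_norm_ge g h t)); exact: ltW.
apply: (le_lt_trans (senergy_dist n gh)); rewrite -/C /e mulfK ?lt0r_neq0//.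
rewrite -ltrBrDl mulrA ltr_pdivrMr// mulrC ltr_pM2l ?subr_gt0//.
by rewrite ltrDl.
Qed.

(** The complement consists of the [g] whose smoothed energies tend to infinity. *)
Definition good_functions : set (lipBorel R) :=
  \bigcup_(M : nat) \bigcap_(K : nat) \bigcup_(n in [set n | (K <= n)%N])
     [set g : lipS1 R | senergy n (Wf g) < M%:R].

Lemma measurable_good_functions : measurable good_functions.
Proof.
apply: bigcup_measurable => M _; apply: bigcap_measurable => [|K _]; first by exists 0%N.
apply: bigcup_measurable => n _; apply: sub_sigma_algebra; exact: senergy_open.
Qed.

Definition probe i t : R := dweight i * marker b k0 (diag i).2 t.

Lemma bmark_le1 m : bmark R b k0 m <= 1.
Proof.
apply: (le_trans (bmark_le_pow R b2 k3 m)).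
by rewrite invf_le1 ?exprn_gt0// exprn_ege1// ler1n ltnW.
Qed.

Lemma dweight_ge0 i : 0 <= @dweight R i. Proof. by rewrite exprn_ge0. Qed.

Lemma probe_per i t : probe i (t + 1) = probe i t.
Proof. by rewrite /probe /marker tent_periodic. Qed.

Lemma probe_le i t : `|probe i t| <= dtailw i - dtailw i.+1.
Proof.
apply: le_trans (dweight_le i); rewrite /probe normrM (ger0_norm (dweight_ge0 i)).
rewrite ler_piMr ?dweight_ge0//; apply: le_trans (marker_norm k0 b2 _ t) _.
exact: bmark_le1.
Qed.

Lemma probe_lip i s t : `|probe i s - probe i t| <= (dtailw i - dtailw i.+1) * `|s - t|.
Proof.
rewrite /probe -mulrBr normrM (ger0_norm (dweight_ge0 i)).
apply: ler_pM => //; [exact: dweight_ge0|exact: dweight_le|].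
by have [h1 h2 h3] := marker_ok R b2 k3 (diag i).2; exact: tent_lipschitz.
Qed.

Local Notation rnd := (rseries probe).

Section Expectation.
Variables (g : R -> R) (Mg : R).
Hypothesis gM : forall t, `|g t| <= Mg.

Variable n : nat.
Variable D : nat.
Hypothesis nD : (n <= D)%N.
Hypothesis D1 : 2^-1 ^+ (D - n) <= rad n.
Hypothesis D2 : 4 * 2^-1 ^+ D / (1 - q) <= rad n / 2.
Local Notation K := (start S D).

Definition fprobe (p : nat) t : R := \sum_(i < K) (nbit K p i)%:R * probe i t.

Lemma nbit_probe_le p i t : `|(nbit K p i)%:R * probe i t| <= dtailw i - dtailw i.+1.
Proof. exact: le_trans (norm_bool_mul _ _) (probe_le _ _). Qed.

Lemma fprobe_le p t : `|fprobe p t| <= \sum_(i < K) (dtailw i - dtailw i.+1).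
Proof.
by apply: (le_trans (ler_norm_sum _ _ _)); apply: ler_sum => i _; exact: nbit_probe_le.
Qed.

Definition ff p := Wf (fun t => fprobe p t - g t).

Lemma ffE p x : ff p x = \sum_(i < K) (nbit K p i)%:R * Wf (probe i) x - Wf g x.
Proof.
rewrite /ff (@weierstrassB _ _ _ b2 a01 _ _ _ _ x (fprobe_le p) gM); congr (_ - _).
rewrite /fprobe (@weierstrass_sum _ _ _ b2 a01 _ _ _ (fun i : 'I_K => dtailw i - dtailw i.+1)); last first.
  by move=> i t; exact: nbit_probe_le.
by apply: eq_bigr => i _; rewrite (@weierstrassZ _ _ _ b2 a01 _ _ _ x (probe_le i)).
Qed.

Lemma rnd_close (p : nat) (theta : R) t : p%:R / 2 ^+ K <= theta < p.+1%:R / 2 ^+ K ->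
  `|rnd (bits theta) t - fprobe p t| <= 4 * 2^-1 ^+ D.
Proof.
move=> hp; rewrite -dtailw_start.
have -> : fprobe p t = series (rterm probe (bits theta) t) K.
  rewrite /series /= big_mkord; apply: eq_bigr => i _.
  by rewrite /rterm (bits_cylinder hp).
exact: (rseries_tail dtailw_ge0 probe_le).
Qed.

Lemma rnd_bounded eps : exists M : R, forall t, `|rnd eps t| <= M.
Proof.
exists (dtailw 0) => t.
have := rseries_tail dtailw_ge0 probe_le eps t 0.
by rewrite /series /= big_geq// subr0.
Qed.

Definition cenergy (p : nat) : R := pair_avg (fun w w' =>
  kap (level w w') * (2 * (`|ff p (@pts n w) - ff p (@pts n w')| <= 3 * rad n)%R%:R) / rad n).

(** The cutoff vanishes beyond [2 * rad n]; truncating the random series moves each of the two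
    values by at most [rad n / 2], whence the window [3 * rad n]. *)
Lemma senergy_le_cenergy (p : nat) (theta : R) : p%:R / 2 ^+ K <= theta < p.+1%:R / 2 ^+ K ->
  senergy n (Wf (fun t => rnd (bits theta) t - g t)) <= cenergy p.
Proof.
move=> hp; apply: pair_avg_le => w w'.
rewrite ler_pM2r ?invr_gt0// ler_pM2l//.
apply: (le_trans (chi_le (divr_ge0 (normr_ge0 _) (ltW (r0 n))))).
rewrite ler_pM2l// ler_nat ler_pdivrMr//.
set F := Wf (fun t => rnd (bits theta) t - g t).
have Ff x : `|F x - ff p x| <= rad n / 2.
  have [Mr hMr] := rnd_bounded (bits theta).
  have h1 t : `|rnd (bits theta) t - g t| <= Mr + Mg.
    by apply: (le_trans (ler_normB _ _)); exact: lerD.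
  have h2 t : `|fprobe p t - g t| <= \sum_(i < K) (dtailw i - dtailw i.+1) + Mg.
    by apply: (le_trans (ler_normB _ _)); apply: lerD => //; exact: fprobe_le.
  rewrite /F /ff -(@weierstrassB _ _ _ b2 a01 _ _ _ _ x h1 h2).
  apply: le_trans D2; apply: weierstrass_le => // t.
  by rewrite opprB addrA subrK; exact: rnd_close.
have h1 := Ff (pts w); have h2 := Ff (pts w').
case: (leP `|F (pts w) - F (pts w')|) => //= h3.
rewrite lt0b; apply: (@le_trans _ _ (`|F (pts w) - F (pts w')| + (rad n / 2 + rad n / 2))); last first.
  by move: h3; lra.
have -> : ff p (pts w) - ff p (pts w') = (F (pts w) - F (pts w')) -
   ((F (pts w) - ff p (pts w)) - (F (pts w') - ff p (pts w'))) by ring.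
apply: (le_trans (ler_normB _ _)); rewrite lerD2l.
by apply: (le_trans (ler_normB _ _)); exact: lerD.
Qed.

(* Along the bits enumerated by [diag] with second coordinate [m], the difference
   of the values at the two points runs through a dyadic expansion scaled by [x],
   so it lies in a window of size [rad n] with probability about [rad n / |x|]. *)
Lemma pair_count (w w' : word n) : (level w w' < n)%N ->
  \sum_(p < 2 ^ K) (`|ff p (pts w) - ff p (pts w')| <= 3 * rad n)%R%:R <=
  2 ^+ K * (4 * rad n * (4 ^+ level w w' / msep (level w w'))).
Proof.
move=> ln; set m := level w w' in ln *.
pose a i := Wf (probe i) (pts w) - Wf (probe i) (pts w').
pose Del := Wf (marker b k0 m) (pts w) - Wf (marker b k0 m) (pts w').
have hD : msep m <= `|Del|.
  apply: (@marker_separates _ _ _ _ b2 a01 k3 kq kv _ _ n) => //; try exact: wdig_lt.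
    exact: level_eq.
  exact: level_neq.
have ms0 : 0 < msep m by exact: msep_gt0.
have Del0 : 0 < `|Del| by exact: lt_le_trans hD.
(* Marker [m] has weight [2 ^ - (2 m + j)] in row [m + j], which is
   [2 * 4 ^ - m * 2 ^ - (j + 1)]. *)
pose x := 2 * 4^-1 ^+ m * Del.
have x0 : x != 0 by rewrite !mulf_neq0 ?expf_neq0 ?invr_eq0// -normr_gt0.
have aE i : a i = dweight i * (Wf (marker b k0 (diag i).2) (pts w) - Wf (marker b k0 (diag i).2) (pts w')).
  by rewrite /a /probe !(@weierstrassZ _ _ _ b2 a01 _ _ _ _ (marker_norm k0 b2 _)) mulrBr.
have ha j : a (start S (m + j) + m)%N = x * 2^-1 ^+ j.+1.
  rewrite aE diag_start ?leq_addr//= /dweight diag_start ?leq_addr//= /x -/Del.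
  have -> : (4^-1 : R) = 2^-1 * 2^-1 by rewrite -invfM -natrM.
  rewrite exprMn !exprD exprS.
  have gen (A B C : R) : A * B * A * C = 2 * (A * A) * C * (2^-1 * B) by field.
  exact: gen.
rewrite (_ : \sum_(p < 2 ^ K) _ = \sum_(p < 2 ^ K)
    (fun z => (`|z| <= 3 * rad n)%R%:R) (- (Wf g (pts w) - Wf g (pts w')) + \sum_(i < K) (nbit K p i)%:R * a i)); last first.
  apply: eq_bigr => p _; rewrite !ffE /=; congr ((`|_| <= _)%R%:R).
  under [in RHS]eq_bigr do rewrite /a mulrBr.
  by rewrite sumrB; ring.
rewrite (@sum_nbit _ K a (fun z => (`|z| <= 3 * rad n)%R%:R) (- (Wf g (pts w) - Wf g (pts w')))) ler_pM2l ?exprn_gt0//.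
have rr := ltW (r0 n).
apply: (le_trans (@avg_diag R a x (3 * rad n) _ m D _ x0 _ ha)).
- exact: leq_trans (ltnW ln) nD.
- by rewrite mulr_ge0.
have pm : 0 < (4 ^+ m : R) by rewrite exprn_gt0.
have hx : 2 * (3 * rad n) / `|x| <= 3 * rad n * (4 ^+ m / msep m).
  rewrite /x normrM (ger0_norm (_ : 0 <= 2 * 4^-1 ^+ m)) ?mulr_ge0 ?exprn_ge0// exprVn.
  have -> : 2 * (3 * rad n) / (2 * (4 ^+ m)^-1 * `|Del|) = 3 * rad n * (4 ^+ m / `|Del|).
    have gen (r A B : R) : A != 0 -> B != 0 -> 2 * (3 * r) / (2 / A * B) = 3 * r * (A / B).
      by move=> A0 B0; field; rewrite A0 B0.
    by apply: gen; exact: lt0r_neq0.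
  rewrite ler_wpM2l ?mulr_ge0// ler_pM2l// lef_pV2 ?posrE//.
(* The discretization error costs one more [rad n], so [3] becomes the [4] of the statement. *)
have h2 : 2^-1 ^+ (D - m) <= rad n * (4 ^+ m / msep m).
  apply: (@le_trans _ _ (rad n)).
    apply: le_trans D1; rewrite !exprVn lef_pV2 ?posrE ?exprn_gt0// ler_eXn2l ?ltr1n//.
    by rewrite leq_sub2l// ltnW.
  rewrite ler_peMr// ler_pdivlMr// mul1r.
  have h1 : msep m <= 1 by exact: msep_le1.
  by apply: (le_trans h1); rewrite exprn_ege1// ler1n.
have gen (r A : R) : 3 * r * A + r * A = 4 * r * A by ring.
by apply: (le_trans (lerD hx h2)); rewrite gen.
Qed.

(** Mean contribution of a pair of level [m]: the small ball bound cancels [rad n] when [m < n], and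
    the trivial bound 1 on the probability is used when [m = n]. *)
Definition pair_weight m : R := if (m < n)%N then 8 * kap m * (4 ^+ m / msep m) else 2 * kap n / rad n.

Lemma pair_weight_ge0 m : 0 <= pair_weight m.
Proof.
have kk0 i := ltW (kap0 i); have rr0 := ltW (r0 n).
rewrite /pair_weight; case: ifP => _.
  apply: mulr_ge0; first by apply: mulr_ge0.
  by apply: divr_ge0; [exact: exprn_ge0|apply: ltW; exact: msep_gt0].
by apply: divr_ge0 => //; apply: mulr_ge0.
Qed.

Lemma sum_cenergy : \sum_(p < 2 ^ K) cenergy p <= 2 ^+ K *
  \sum_(m < n.+1) pair_weight m * (b ^ (N n - N m + nforced k0 m))%:R / (b ^ N n)%:R.
Proof.
have cW : #|word n|%:R = (b ^ N n)%:R :> R by rewrite card_ffun !card_ord.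
have B0 : 0 < (b ^ N n)%:R :> R by rewrite ltr0n expn_gt0 ltnW.
rewrite /cenergy /pair_avg -mulr_sumr cW.
rewrite ler_pdivrMl ?exprn_gt0//.
rewrite exchange_big /=.
apply: (@le_trans _ _ (\sum_(w : word n) \sum_(w' : word n) 2 ^+ K * pair_weight (level w w'))).
  apply: ler_sum => w _; rewrite exchange_big /=; apply: ler_sum => w' _.
  have -> : \sum_(p < 2 ^ K) kap (level w w') * (2 * (`|ff p (pts w) - ff p (pts w')| <= 3 * rad n)%R%:R) / rad n =
    2 * kap (level w w') / rad n * \sum_(p < 2 ^ K) (`|ff p (pts w) - ff p (pts w')| <= 3 * rad n)%R%:R.
    by rewrite mulr_sumr; apply: eq_bigr => p _; ring.
  have c0 : 0 <= 2 * kap (level w w') / rad n by apply: divr_ge0; [apply: mulr_ge0 => //; exact: ltW|exact: ltW].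
  rewrite /pair_weight; case: ifP => [ln|/negbT].
    apply: (le_trans (ler_wpM2l c0 (pair_count ln))).
    have gen (k r A B : R) : r != 0 -> 2 * k / r * (A * (4 * r * B)) = A * (8 * k * B).
      by move=> ?; field.
    by rewrite gen// lt0r_neq0.
  rewrite -leqNgt => nl.
  have ln : level w w' = n by apply/eqP; rewrite eqn_leq nl level_le.
  rewrite ln in c0 *; rewrite [leRHS]mulrC ler_wpM2l//.
  apply: (@le_trans _ _ (\sum_(p < 2 ^ K) 1)).
    by apply: ler_sum => p _; case: (leP _ (3 * rad n)) => _ /=; rewrite ?lexx ?ler01.
  by rewrite sumr_const card_ord natrX.
apply: (@le_trans _ _ (\sum_(w : word n) 2 ^+ K * \sum_(m < n.+1) pair_weight m * (b ^ (N n - N m + nforced k0 m))%:R)).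
  apply: ler_sum => w _; rewrite -mulr_sumr ler_pM2l ?exprn_gt0//.
  (* Having level exactly [m] is relaxed to agreeing up to block [m], which [card_whead] counts. *)
  apply: (@le_trans _ _ (\sum_(w' : word n) \sum_(m < n.+1) pair_weight m * (whead w m == whead w' m)%:R)).
    apply: ler_sum => w' _.
    have hl : (level w w' < n.+1)%N by rewrite ltnS level_le.
    rewrite (bigD1 (Ordinal hl))//= level_eq// eqxx mulr1 ler_wpDr//.
    by apply: sumr_ge0 => m _; apply: mulr_ge0 => //; exact: pair_weight_ge0.
  rewrite exchange_big /=; apply: ler_sum => m _; rewrite -mulr_sumr.
  apply: ler_wpM2l; first exact: pair_weight_ge0.
  have mn : (m <= n)%N by rewrite -ltnS.
  rewrite -natr_sum ler_nat; apply: leq_trans (card_whead b2 w mn).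
  rewrite -sum1_card [leqRHS]big_mkcond; apply: leq_sum => w' _; rewrite !inE.
  by case: (_ == _).
rewrite sumr_const -[leLHS]mulr_natl (_ : #|_|%:R = (b ^ N n)%:R :> R); last exact: cW.
rewrite le_eqVlt; apply/orP; left; apply/eqP.
rewrite -mulr_suml; field; exact: lt0r_neq0.
Qed.

End Expectation.

End Energies.

(** * Uniform bound on the mean energy and almost sure consequences *)

Section EnergyExpectation.
Context (R : realType) (b k0 : nat) (alpha : R).
Hypotheses (b2 : (2 <= b)%N) (a01 : 0 < alpha < 1) (k3 : (3 <= k0)%N).
Local Notation q := (wratio b alpha).
Local Notation bR := (b%:R : R).
Hypothesis kq : q ^+ k0.-1 * bR <= 1.
Hypothesis kv : 8 <= bR ^+ k0 * (1 - q).
Local Notation N := (start (bw k0)).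
Local Notation Wf := (weierstrass alpha b).
Local Notation leb := (@lebesgue_measure R).
Local Notation p m := ((cell k0 m)%:R : R).
Local Notation rnd := (rseries (@probe R b k0)).

Let b0 : 0 < bR. Proof. exact: b_gt0. Qed.
Let b1 : 1 <= bR. Proof. exact/ltW/b_gt1. Qed.
Let q1 : 0 < 1 - q. Proof. exact: onem_wratio_gt0. Qed.

Let expE i : bR ^+ i = bR `^ i%:R.
Proof. by rewrite powR_mulrn// ltW. Qed.

Let powD x y : bR `^ (x + y) = bR `^ x * bR `^ y.
Proof. by rewrite powRD// (gt_eqF b0) implybT. Qed.

Let sum_half n : \sum_(i < n) (2^-1 : R) ^+ i = 2 - 2 * 2^-1 ^+ n.
Proof.
elim: n => [|n ih]; first by rewrite big_ord0 expr0 mulr1 subrr.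
rewrite big_ord_recr /= ih exprS; move: (2^-1 ^+ n) => x; lra.
Qed.

Lemma branching_ratio n m : (m <= n)%N ->
  (b ^ (N n - N m + nforced k0 m))%:R / (b ^ N n)%:R =
  bR `^ ((nforced k0 m)%:R - (N m)%:R).
Proof.
move=> mn; have NN := start_mono (bw k0) mn.
rewrite -{2}(subnK NN) !natrX !exprD !expE powD powRN.
have h i : bR `^ i != 0 by rewrite gt_eqF// powR_gt0.
by rewrite invfM mulrACA divff// mul1r.
Qed.

Lemma nforced_leR m : 2 * (nforced k0 m)%:R <= 3 * p m ^+ 2.
Proof. by rewrite -natrX -!natrM ler_nat nforced_le. Qed.

(** The linear parts of the exponents cancel. What remains is at most [4 ^ m * b ^ (- 3/2 * p ^ 2)],
    of which [b ^ - m] suffices because [p ^ 2 >= 3 m]. *)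
Lemma pair_weight_lt n m : (m < n)%N ->
  pair_weight b k0 alpha n m * (b ^ (N n - N m + nforced k0 m))%:R / (b ^ N n)%:R <=
  32 * 2^-1 ^+ m.
Proof.
move=> mn; rewrite -mulrA branching_ratio 1?ltnW// /pair_weight mn.
have -> : 8 * kap b k0 alpha m * (4 ^+ m / msep b k0 alpha m) =
    32 * 4 ^+ m * bR `^ (kexp k0 alpha m + alpha * (N m)%:R + p m ^+ 2).
  have hb : bR ^+ bw k0 m = bR `^ (p m ^+ 2) by rewrite expE /bw natrX.
  rewrite /msep /kap hb wratio_expE powRN; move: (kexp k0 alpha m) => E; rewrite 2!powD.
  have h i : bR `^ i != 0 by rewrite gt_eqF// powR_gt0.
  have gen (k t x y : R) : x != 0 -> y != 0 ->
    8 * k * (t / (4^-1 * (x^-1 / y))) = 32 * t * (k * x * y).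
    by move=> x0 y0; field; rewrite x0 y0.
  exact: gen.
rewrite -!mulrA ler_wpM2l// -powD.
have h4 : 4 ^+ m <= bR `^ (2 * m%:R).
  rewrite powRrM powR_mulrn ?powR_ge0// powR_mulrn ?(ltW b0)//.
  apply: lerXn2r; rewrite ?nnegrE ?exprn_ge0//.
  by rewrite -natrX ler_nat -[4%N]/(2 ^ 2)%N leq_exp2r.
apply: (le_trans (ler_wpM2r (powR_ge0 _ _) h4)); rewrite -powD.
apply: (@le_trans _ _ (bR `^ (- m%:R))).
  apply: ler_powR => //.
  have := nforced_leR m; rewrite /kexp.
  have h1 : m%:R <= p m by rewrite ler_nat /cell leq_addr.
  have h2 : 3 <= p m by rewrite ler_nat (leq_trans k3)// cell_ge.
  have h3 : 3 * m%:R <= p m ^+ 2 by rewrite expr2; apply: ler_pM.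
  have h5 : 0 <= m%:R :> R by [].
  move: h3 h5; set P := p m ^+ 2; set M := m%:R; set c := (nforced _ _)%:R.
  by move: (N m)%:R => n0; lra.
rewrite powRN -expE -exprVn lerXn2r ?nnegrE ?invr_ge0 ?(ltW b0)//.
by rewrite lef_pV2 ?posrE// ler_nat.
Qed.

Lemma pair_weight_diag n :
  pair_weight b k0 alpha n n * (b ^ (N n - N n + nforced k0 n))%:R / (b ^ N n)%:R <= 2.
Proof.
rewrite -mulrA branching_ratio// /pair_weight ltnn /kap /rad powRN invrK -!mulrA -!powD.
rewrite ler_piMr//; apply: (@le_trans _ _ (bR `^ 0)); last by rewrite powRr0.
apply: ler_powR => //; rewrite /kexp.
have := nforced_leR n; have : 0 <= p n ^+ 2 by rewrite exprn_ge0.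
set P := p n ^+ 2; set c := (nforced _ _)%:R.
by move: (N n)%:R => n0; lra.
Qed.

Lemma sum_pair_weight n : \sum_(m < n.+1)
  pair_weight b k0 alpha n m * (b ^ (N n - N m + nforced k0 m))%:R / (b ^ N n)%:R <= 66.
Proof.
rewrite big_ord_recr /=.
have h : \sum_(m < n) 32 * (2^-1 : R) ^+ m <= 64.
  rewrite -mulr_sumr sum_half.
  have : 0 <= (2^-1 : R) ^+ n by rewrite exprn_ge0.
  move: (2^-1 ^+ n) => x; lra.
have h1 : \sum_(m < n) pair_weight b k0 alpha n m * (b ^ (N n - N m + nforced k0 m))%:R / (b ^ N n)%:R
  <= \sum_(m < n) 32 * 2^-1 ^+ m.
  by apply: ler_sum => m _; exact: pair_weight_lt.
have h2 := pair_weight_diag n.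
by apply: (le_trans (lerD (le_trans h1 h) h2)); rewrite -natrD.
Qed.

(** The depth must make both the grid of each dyadic sum and the Weierstrass function of the
    neglected tail small against [rad n]. *)
Lemma exists_depth n : exists D, [/\ (n <= D)%N, 2^-1 ^+ (D - n) <= rad b k0 alpha n &
  4 * 2^-1 ^+ D / (1 - q) <= rad b k0 alpha n / 2].
Proof.
have r0 : 0 < rad b k0 alpha n by exact: rad_gt0.
have e0 : 0 < rad b k0 alpha n * (1 - q) / 8 by apply: divr_gt0 => //; apply: mulr_gt0.
have h2 : 0 <= (2^-1 : R) < 1 by apply/andP; split; lra.
have [K hK] := expr_lt_eps h2 e0; exists (n + K)%N; split; first exact: leq_addr.
  rewrite addKn; apply: (le_trans (ltW (hK K (leqnn K)))).
  rewrite -mulrA ler_piMr ?(ltW r0)//.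
  by rewrite ler_pdivrMr//; have := wratio_gt0 alpha b2; lra.
rewrite ler_pdivrMr//; have := hK (n + K)%N (leq_addl _ _).
set r := rad _ _ _ _; set x := 2^-1 ^+ _; set o := 1 - q.
rewrite ltr_pdivlMr// mulrAC => h.
by rewrite ler_pdivlMr//; move: (r * o) h => z; lra.
Qed.

Lemma cenergy_ge0 g n D i : 0 <= cenergy b k0 alpha g n D i.
Proof.
rewrite /cenergy /pair_avg; apply: mulr_ge0; first by rewrite invr_ge0 exprn_ge0.
apply: sumr_ge0 => w _; apply: sumr_ge0 => w' _.
by apply: divr_ge0; [apply: mulr_ge0; [exact/ltW/kap_gt0|exact: mulr_ge0]|exact/ltW/rad_gt0].
Qed.

(** Markov's inequality for the step function of [theta] that dominates the energy on dyadic
    intervals; its superlevel set is a measurable hull of the event. *)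
Lemma senergy_markov (g : R -> R) (Mg : R) n (t : R) : (forall x, `|g x| <= Mg) -> 0 < t ->
  exists A : set R, [/\ measurable A, (t%:E * leb A <= 66%:E)%E & forall theta : R, 0 <= theta < 1 ->
    t <= senergy b k0 alpha n (Wf (fun x => rnd (bits theta) x - g x)) -> A theta].
Proof.
move=> gM t0; have [D [nD D1 D2]] := exists_depth n; set K := start S D.
pose A (i : 'I_(2 ^ K)) : set R := `[i%:R / 2 ^+ K, i.+1%:R / 2 ^+ K[%classic.
pose w (i : 'I_(2 ^ K)) := cenergy b k0 alpha g n D i.
have w0 i : 0 <= w i by exact: cenergy_ge0.
have mA i : measurable (A i) by exact: measurable_itv.
have K0 : 0 < 2 ^+ K :> R by rewrite exprn_gt0.
exists [set y | t <= step w A y]; split.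
- rewrite -[X in measurable X]setTI.
  exact: (measurable_fun_le measurableT (measurable_cst t) (measurable_step w mA)).
- apply: (le_trans (step_markov w0 mA t0)).
  have lA i : leb (A i) = ((2 ^+ K)^-1)%:E.
    rewrite /A lebesgue_measure_itv /= lte_fin ltr_pM2r ?invr_gt0// ltr_nat ltnSn.
    by rewrite -EFinB -mulrBl -natr1 addrC addKr mul1r.
  under eq_bigr do rewrite lA -EFinM.
  rewrite sumEFin lee_fin -mulr_suml ler_pdivrMr// mulrC.
  apply: (le_trans (sum_cenergy b2 a01 k3 kq kv gM nD D1)).
  by rewrite ler_pM2l// sum_pair_weight.
move=> theta /andP[th0 th1] /= h; apply: (le_trans h).
have x0 : 0 <= theta * 2 ^+ K by rewrite mulr_ge0// ltW.
have /andP[p1 p2] := truncn_itv x0.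
set i := Num.trunc _ in p1 p2.
have pK : (i < 2 ^ K)%N.
  by rewrite -(ltr_nat R) natrX (le_lt_trans p1)// gtr_pMl.
have hp : i%:R / 2 ^+ K <= theta < i.+1%:R / 2 ^+ K.
  by rewrite ler_pdivrMr// p1 ltr_pdivlMr.
rewrite /step (bigD1 (Ordinal pK))//= ler_wpDr//.
  by apply: sumr_ge0 => j _; rewrite mulr_ge0.
rewrite indicE mem_set ?mulr1; last by rewrite /A /= in_itv.
exact: (senergy_le_cenergy b2 a01 k3 gM D2 hp).
Qed.

(** If the energies tend to infinity, all of them eventually exceed [M]. This event is an increasing
    union of sets contained in a single [A n], of measure at most [66 / M], and [M] is arbitrary. *)
Lemma bad_random_null (x : lipS1 R) : leb [set theta | 0 <= theta < 1 /\
  exists2 g, (~` good_functions b k0 alpha) g & forall t, rnd (bits theta) t = x t + g t] = 0%E.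
Proof.
have [Mx hx] := lipS1_bounded x.
pose F (theta : R) n := senergy b k0 alpha n (Wf (fun t => rnd (bits theta) t - x t)).
apply: leb_eq0 => e e0.
pose M := (Num.bound (66 / e)).+1.
have M0 : 0 < M%:R :> R by [].
have /choice[A hA] : forall n, exists A : set R, [/\ measurable A, (M%:R%:E * leb A <= 66%:E)%E &
    forall theta : R, 0 <= theta < 1 -> M%:R <= F theta n -> A theta].
  by move=> n; exact: senergy_markov hx M0.
pose G K := \bigcap_(n in [set n | (K <= n)%N]) A n.
have mG K : measurable (G K).
  by apply: bigcap_measurable => [|n _]; [exists K => /=|case: (hA n)].
have leA n : (leb (A n) <= e%:E)%E.
  have [_ h _] := hA n; rewrite -(@lee_pmul2l _ M%:R%:E)//; apply: (le_trans h).
  rewrite -EFinM lee_fin -ler_pdivrMr//; apply: (le_trans (ltW (archi_boundP _))).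
    by rewrite divr_ge0// ltW.
  by rewrite ler_nat.
have c : (leb \o G) @ \oo --> leb (\bigcup_K G K).
  apply: (@nondecreasing_cvg_mu _ _ _ leb) => //.
  - by apply: bigcup_measurable => K _; exact: mG.
  - move=> k l kl; apply/subsetPset => y Gy n /= ln; apply: Gy => /=.
    exact: leq_trans kl ln.
apply: (@le_trans _ _ (leb (\bigcup_K G K))).
  apply: le_leb => theta [th [g gg hg]].
  have gE : (g : R -> R) = (fun t => rnd (bits theta) t - x t).
    by apply/funext => t; rewrite hg addrAC subrr add0r.
  have : exists K : nat, forall n, (K <= n)%N -> M%:R <= F theta n.
    apply: contra_notP gg => h; exists M => // K _.
    apply: contrapT => h2; apply: h; exists K => n Kn.
    rewrite leNgt; apply/negP => h3; apply: h2; exists n => //=.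
    by rewrite gE.
  move=> [K hK]; exists K => // n /= Kn.
  by have [_ _] := hA n; apply => //; exact: hK.
rewrite -(cvg_lim _ c)//; apply: lime_le; first by apply/cvg_ex; eexists; exact: c.
apply: nearW => K /=; apply: le_trans (leA K); apply: le_leb => y; apply.
exact: leqnn.
Qed.

End EnergyExpectation.

(** * Dimension of the levels of functions with bounded energies *)

Section GoodFunctions.
Context (R : realType) (b k0 : nat) (alpha : R).
Hypotheses (b2 : (2 <= b)%N) (a01 : 0 < alpha < 1) (k3 : (3 <= k0)%N).
Local Notation q := (wratio b alpha).
Local Notation bR := (b%:R : R).
Hypothesis kk : 13 <= (1 - alpha) * k0%:R.
Local Notation leb := (@lebesgue_measure R).
Variable g : lipS1 R.
Local Notation f := (weierstrass alpha b g).

Lemma weierstrass_lip_holder : exists2 C : R, 0 < C &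
  forall x y j, `|x - y| <= bR ^- j -> `|f x - f y| <= C * q ^+ j.
Proof.
have [M hM] := lipS1_bounded g; have [L hL] := lipfun_lipschitz g.
have hM' t : `|g t| <= `|M| + 1.
  by apply: (le_trans (hM t)); apply: (le_trans (ler_norm M)); rewrite lerDl.
have hL' s t : `|g s - g t| <= (`|L| + 1) * `|s - t|.
  by apply: (le_trans (hL s t)); rewrite ler_wpM2r//; apply: (le_trans (ler_norm L)); rewrite lerDl.
exists ((`|L| + 1) / (q * bR - 1) + 2 * (`|M| + 1) / (1 - q)).
  have L0 : 0 < `|L| + 1 by rewrite ltr_wpDl.
  have M0 : 0 < `|M| + 1 by rewrite ltr_wpDl.
  have q1 : 0 < 1 - q by exact: onem_wratio_gt0.
  have qb1 : 0 < q * bR - 1 by rewrite subr_gt0; exact: wratio_b_gt1.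
  by apply: addr_gt0; apply: divr_gt0 => //; apply: mulr_gt0.
by move=> x y j xy; exact: (weierstrass_holder b2 a01 hM' hL' xy).
Qed.

Lemma weierstrass_lip_continuous : continuous f.
Proof.
have [C C0 hC] := weierstrass_lip_holder.
have q0 := wratio_gt0 alpha b2; have b0 := @b_gt0 R _ b2.
have q01 : 0 <= q < 1 by rewrite (ltW q0)/= -subr_gt0; exact: onem_wratio_gt0.
move=> x; apply/cvgrPdist_lt => e e0.
have [j hj] := expr_lt_eps q01 (divr_gt0 e0 C0).
have bj : 0 < bR ^- j by rewrite invr_gt0 exprn_gt0.
near=> y.
have xy : `|x - y| <= bR ^- j.
  by apply: ltW; near: y; exact: (@cvgr_dist_lt _ _ _ _ _ id x (@cvg_id _ _)).
apply: (le_lt_trans (hC _ _ _ xy)).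
by rewrite mulrC -ltr_pdivlMr//; exact: hj.
Unshelve. all: by end_near.
Qed.

Hypothesis g_good : good_functions b k0 alpha g.

Lemma good_function_levels : (0 < leb [set y : R |
  (exists2 x : R, (0 <= x < 1)%R & f x = y) /\
  hausdorff_dim [set x : R | (0 <= x < 1)%R /\ f x = y] = (1 - alpha)%R%:E])%E.
Proof.
have [M hM] := lipS1_bounded g; have [C C0 fC] := weierstrass_lip_holder.
have f_cont := weierstrass_lip_continuous.
have f_le x : `|f x| <= M / (1 - q) by exact: weierstrass_le.
have [m _ gm] := g_good.
pose W n : finType := word b k0 n.
pose pt n (w : W n) := pts R w.
pose lev n (w w' : W n) := level w w'.
pose gap' := gap R b k0.
have Wn n : (0 < #|W n|)%N by exact: word_gt0.
have gl n (w w' : W n) l : (l <= n)%N -> `|pt n w - pt n w'| < gap' l -> (l <= lev n w w')%N.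
  move=> ln h; apply: level_ge => //.
  by apply: (separation b2 k3 _ _ ln h); exact: wdig_lt.
have pi n (w : W n) : 0 <= pt n w <= 3 / 4.
  by apply: point_itv => //; exact: wdig_lt.
have kp l : 0 < kap b k0 alpha l by exact: kap_gt0.
have r0 l : 0 < rad b k0 alpha l by exact: rad_gt0.
have el K : exists2 n, (K <= n)%N &
    energy f pt lev (kap b k0 alpha) (rad b k0 alpha) n <= m%:R + 1.
  have [n Kn hn] := gm K I; exists n => //.
  apply: (@le_trans _ _ m%:R); last by rewrite lerDl.
  apply: le_trans (ltW hn); rewrite /senergy /pair_avg /energy.
  apply: ler_wpM2l; first by rewrite invr_ge0 exprn_ge0.
  apply: ler_sum => w _; apply: ler_sum => w' _.
  rewrite ler_pM2r ?invr_gt0// ler_pM2l//.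
  apply: le_trans (chi_ge _); rewrite ltr_pdivrMr// mul1r.
  exact: lexx.
have B0 : 0 < m%:R + 1 :> R by rewrite ltr_wpDl.
have km := kap_mono b2 a01 k3 kk.
pose Y := good_values f (M / (1 - q)) pt lev (kap b k0 alpha) (rad b k0 alpha) (m%:R + 1).
have Y0 : (0 < leb Y)%E.
  by apply: (leb_good_values f_le Wn kp km r0 _ B0 el); exact: rad_le1.
have Yc y s : Y y -> 0 <= s -> s < 1 - alpha -> exists2 e : R, 0 < e &
    forall F : nat -> set R, [set x | 0 <= x <= 3 / 4 /\ f x = y] `<=` \bigcup_i F i ->
    (forall i, (diam (F i) <= 1)%E) -> exists n, e <= \sum_(i < n) hcontent s (F i).
  move=> Yy s0 s1; have [c c0 hc] := kap_gap b2 a01 k3 s0 s1.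
  have ki : forall A : R, exists i, A <= kap b k0 alpha i by exact: kap_infty.
  have g0 i : 0 < gap' i by exact: gap_gt0.
  have rc : forall e : R, 0 < e -> exists K, forall n, (K <= n)%N -> rad b k0 alpha n <= e.
    exact: rad_cvg0.
  have H := good_values_content f_cont f_le Wn pi kp km ki g0 gl r0 rc B0 Yy s0 c0 hc.
  exact: H.
set T := [set y | _].
have YT : Y `<=` T `|` level_null b alpha f C.
  move=> y Yy; have [ny|ny] := pselect (level_null b alpha f C y); [by right|left; split].
    apply: contrapT => h.
    (* Nonemptiness of the level is the case [s = 0]: a cover by empty sets would have content 0. *)
    have [e e0 he] := Yc y 0 Yy (lexx 0) (ltac:(by case/andP: a01; lra)).
    have [||n] := he (fun=> set0).
    - move=> x [/andP[x0 x1] fx]; exfalso; apply: h; exists x => //.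
      by rewrite x0 (le_lt_trans x1)//; lra.
    - by move=> i; apply: diam_le => // x y'.
    rewrite big1 => [|i _]; last by rewrite /hcontent; case: pselect.
    by rewrite leNgt e0.
  apply/eqP; rewrite eq_le; apply/andP; split.
    apply/lee_addgt0Pr => e e0; rewrite -EFinD; apply: ge_ereal_inf; exists (1 - alpha + e)%:E => //.
    exists (1 - alpha + e) => //; split; first by case/andP: a01; lra.
    by apply: (level_dim_upper b2 a01 fC ny); rewrite ltrDl.
  apply/ereal_infP => _ [s [s0 hs] <-]; rewrite lee_fin leNgt; apply/negP => s1.
  have [e e0 he] := Yc y s Yy s0 s1.
  have : (e%:E <= hausdorff_measure s [set x | (0 <= x < 1)%R /\ f x = y])%E.
    apply: (@le_trans _ _ (hausdorff_content s 1 [set x | (0 <= x < 1)%R /\ f x = y])); last first.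
      by apply: ereal_sup_ubound; exists 1 => //=.
    apply/ereal_infP => _ [F [cF dF] <-].
    have [||n hn] := he F.
    - move=> x [/andP[x0 x1] fx]; apply: cF; split => //.
      by rewrite x0 (le_lt_trans x1)//; lra.
    - exact: dF.
    apply: (@le_trans _ _ (\sum_(0 <= i < n) (hcontent s (F i))%:E)%E); last first.
      by apply: nneseries_lim_ge => i _ _; rewrite lee_fin hcontent_ge0.
    by rewrite big_mkord sumEFin lee_fin.
  by rewrite hs lee_fin leNgt e0.
(* Subadditivity of the outer measure is used, as [T] is not shown to be measurable. *)
apply: (lt_le_trans Y0); apply: (le_trans (le_leb YT)).
apply: (le_trans (@outer_measureU2 _ _ (mu_ext (wlength idfun)) _ _)).
by rewrite [X in (_ + X)%E](leb_level_null alpha b2 f C0) adde0.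
Qed.

End GoodFunctions.

Theorem theorem1p3 (R : realType) (b : nat) (alpha : R) :
  (2 <= b)%N -> 0 < alpha < 1 ->
  prevalent (fun g : lipS1 R =>
    (0 < (@lebesgue_measure R)
      [set y : R | (exists2 x : R, (0 <= x < 1)%R & weierstrass alpha b g x = y) /\
         hausdorff_dim [set x : R | (0 <= x < 1)%R /\ weierstrass alpha b g x = y]
           = (1 - alpha)%R%:E])%E).
Proof.
move=> b2 a01.
have q0 := wratio_gt0 alpha b2; have b0 := @b_gt0 R _ b2.
have q1 : 0 < 1 - wratio b alpha by exact: onem_wratio_gt0.
have a1 : 0 < 1 - alpha by case/andP: a01; lra.
have q01 : 0 <= wratio b alpha < 1 by rewrite (ltW q0)/= -subr_gt0.
have ib : 0 < b%:R^-1 :> R by rewrite invr_gt0.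
have [i hi] := expr_lt_eps q01 ib.
have [j hj] := expr_unbounded (8 / (1 - wratio b alpha)) (@b_gt1 R _ b2).
pose l := Num.bound (13 / (1 - alpha)).
(* The summands [i], [j], [l] secure the tail ratio [kq], the tail constant [kv] and the growth [kk]
   of the weights, respectively. *)
pose k0 := (3 + i + j + l)%N.
have k3 : (3 <= k0)%N by rewrite /k0 -!addnA leq_addr.
have kj : (j <= k0)%N by rewrite /k0 addnAC leq_addl.
have ki : (i <= k0.-1)%N by rewrite /k0 -!addnA addSn /= addnCA leq_addr.
have kq : wratio b alpha ^+ k0.-1 * b%:R <= 1.
  by rewrite -ler_pdivlMr// mul1r ltW// hi.
have kv : 8 <= b%:R ^+ k0 * (1 - wratio b alpha).
  rewrite -ler_pdivrMr//; apply: (le_trans hj).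
  by rewrite ler_eXn2l// b_gt1.
have kk : 13 <= (1 - alpha) * k0%:R.
  rewrite mulrC -ler_pdivrMr//; apply: (le_trans (ltW (archi_boundP _))).
    by rewrite divr_ge0// ltW.
  by rewrite ler_nat leq_addl.
apply: (@shy_random _ (@probe R b k0) dtailw _ _ _ _ _ _ (~` good_functions b k0 alpha)).
- by move=> m t; exact: probe_per.
- exact: dtailw_ge0.
- by move=> e; exact: dtailw_cvg0.
- by move=> m t; exact: probe_le.
- by move=> m s t; exact: probe_lip.
- by apply: measurableC; exact: measurable_good_functions.
- by move=> g; apply: contra_not => gg; exact: (good_function_levels b2 a01 k3 kk).
- by move=> x; exact: bad_random_null.
Qed.
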